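(* Let $n_1\ge 3$ and $m\ge 1$ be integers, let $\alpha^k,\gamma^k\in\mathbb{R}_{+}$ and $b_k\in\mathbb{R}$ for $k\in[m]$, and let $\beta,\delta\in\mathbb{R}^{n_1}$ be vectors with all components strictly positive. Put $$A^k:=\alpha^k\beta\beta^{\top}+\gamma^k\delta\delta^{\top}\in\mathbb{R}^{n_1\times n_1},\qquad k\in[m],$$ and suppose that the set $$\mathcal{U}:=\left\{W\in\mathbb{R}^{n_1\times n_1}_{+}\ \middle|\ \langle A^k,W\rangle\le b_k\ \ \forall k\in[m],\ \operatorname{rank}(W)\le 1\right\}$$ is bounded. Then $\operatorname{conv}(\mathcal{U})$ is second-order cone representable. Moreover, for fixed $m$, a linear function can be optimized in polynomial time over $\mathcal{U}$.
   Context: $[m]=\{1,\dots,m\}$; $\mathbb{R}^{n_1\times n_1}_+$ is the set of entrywise nonnegative matrices (not necessarily symmetric); $\langle U,V\rangle=\sum_{i,j}U_{ij}V_{ij}$; $\operatorname{conv}(S)$ is the convex hull of $S$. A set is second-order cone representable (SOCr) if it is the projection of a set defined by finitely many linear and second-order cone constraints $\|Bz+c\|_2\le d^{\top}z+e$ in the original and possibly finitely many additional variables. ''Polynomial time'' is in the size of the data describing $\mathcal{U}$ and of the linear objective, with $m$ regarded as a constant, in the usual sense for second-order cone programming (rational data, optimization to prescribed accuracy). *)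

(* Defs.v *)
From HB Require Import structures.
From mathcomp Require Import all_boot all_order all_algebra.
From mathcomp Require Import all_classical all_reals all_analysis.

Set Implicit Arguments.
Unset Strict Implicit.
Unset Printing Implicit Defensive.

Import Order.TTheory GRing.Theory Num.Theory.
Import numFieldNormedType.Exports.

Local Open Scope classical_set_scope.
Local Open Scope ring_scope.

Definition norm2 (R : realType) (r : nat) (v : 'cV[R]_r) : R :=
  Num.sqrt (\sum_i v i 0 ^+ 2).

(* The constraint ||B z + c||_2 <= d^T z + e in z : R^N. *)
Record soc_constraint (R : realType) (N : nat) := SocConstraint {
  soc_dim : nat;
  soc_B : 'M[R]_(soc_dim, N);
  soc_c : 'cV[R]_soc_dim;
  soc_d : 'cV[R]_N;
  soc_e : R }.

Definition soc_holds (R : realType) (N : nat) (k : soc_constraint R N)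
    (z : 'cV[R]_N) : Prop :=
  norm2 (soc_B k *m z + soc_c k) <= ((soc_d k)^T *m z) 0 0 + soc_e k.

(* [p] additional variables, [l] linear inequalities F z <= g (an equality is
   a pair of inequalities) and [q] second-order cone constraints. *)
Definition SOCr (R : realType) (N : nat) (S : set 'cV[R]_N) : Prop :=
  exists (p l q : nat) (F : 'M[R]_(l, N + p)) (g : 'cV[R]_l)
         (K : 'I_q -> soc_constraint R (N + p)),
    S = [set x | exists y : 'cV[R]_p,
           (forall i, (F *m col_mx x y) i 0 <= g i 0) /\
           (forall k, soc_holds (K k) (col_mx x y))].

Definition conv_hull (R : realType) (V : lmodType R) (S : set V) : set V :=
  smallest (@convex_set R V) S.

(* R^{n x n} identified with R^(n * n), entries read row by row. *)
Definition vec (R : realType) (n : nat) (W : 'M[R]_n) : 'cV[R]_(n * n) :=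
  (mxvec W)^T.

Record data (F : Type) (m n : nat) := Data {
  alpha : 'I_m -> F;
  gamma : 'I_m -> F;
  rhs : 'I_m -> F;
  beta : 'cV[F]_n;
  delta : 'cV[F]_n }.

Definition map_data (F G : Type) (f : F -> G) (m n : nat) (D : data F m n) :
    data G m n :=
  Data (f \o alpha D) (f \o gamma D) (f \o rhs D)
       (map_mx f (beta D)) (map_mx f (delta D)).

Definition inner (R : realType) (n : nat) (U V : 'M[R]_n) : R :=
  \sum_i \sum_j U i j * V i j.

Definition Amx (R : realType) (m n : nat) (D : data R m n) (k : 'I_m) :
    'M[R]_n :=
  alpha D k *: (beta D *m (beta D)^T) + gamma D k *: (delta D *m (delta D)^T).

Definition calU (R : realType) (m n : nat) (D : data R m n) : set 'M[R]_n :=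
  [set W : 'M[R]_n | [/\ forall i j, 0 <= W i j,
               forall k, inner (Amx D k) W <= rhs D k &
               (\rank W <= 1)%N]].

Definition admissible (R : realType) (m n : nat) (D : data R m n) : Prop :=
  [/\ forall k, 0 <= alpha D k /\ 0 <= gamma D k,
      forall i, 0 < beta D i 0,
      forall i, 0 < delta D i 0 &
      bounded_set (calU D)].

(* Random access machine with logarithmic cost:
   structured programs over integer arrays named by naturals, all arrays being
   of unbounded length.  Every value computed, including addresses and
   operands, is charged its number of binary digits; up to a polynomial, the
   cost of a run is the running time of a Turing machine. *)

Definition bitlen (z : int) : nat := (trunc_log 2 `|z|%N).+1.

Definition state := nat -> nat -> int.

Inductive binop := Add | Sub | Mul | Div.

Inductive expr :=
  | Cst of int
  | Get of nat & expr
  | Bin of binop & expr & expr.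

(* [Div] is Euclidean division, with value 0 when the divisor is 0. *)
Definition binop_sem (o : binop) (x y : int) : int :=
  match o with
  | Add => x + y
  | Sub => x - y
  | Mul => x * y
  | Div => (x %/ y)%Z
  end.

(* A negative index denotes the cell at its absolute value. *)
Fixpoint expr_val (s : state) (e : expr) : int :=
  match e with
  | Cst z => z
  | Get a i => s a `|expr_val s i|%N
  | Bin o e1 e2 => binop_sem o (expr_val s e1) (expr_val s e2)
  end.

Fixpoint expr_cost (s : state) (e : expr) : nat :=
  (bitlen (expr_val s e) +
   match e with
   | Cst _ => 0
   | Get _ i => expr_cost s i
   | Bin _ e1 e2 => expr_cost s e1 + expr_cost s e2
   end)%N.

Definition update (s : state) (a i : nat) (z : int) : state :=
  fun a' i' => if (a' == a) && (i' == i) then z else s a' i'.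

Inductive prog :=
  | Skip
  | Assign of nat & expr & expr
  | Seq of prog & prog
  | If of expr & prog & prog
  | While of expr & prog.

(* [exec c s t s']: from [s], [c] halts in [s'] at total cost [t]; tests ask
   whether the value is positive. *)
Inductive exec : prog -> state -> nat -> state -> Prop :=
  | ExSkip s : exec Skip s 1 s
  | ExAssign s a i e :
      exec (Assign a i e) s (1 + expr_cost s i + expr_cost s e)%N
           (update s a `|expr_val s i|%N (expr_val s e))
  | ExSeq c1 c2 s1 s2 s3 t1 t2 :
      exec c1 s1 t1 s2 -> exec c2 s2 t2 s3 ->
      exec (Seq c1 c2) s1 (t1 + t2)%N s3
  | ExIfT e c1 c2 s s' t :
      0 < expr_val s e -> exec c1 s t s' ->
      exec (If e c1 c2) s (1 + expr_cost s e + t)%N s'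
  | ExIfF e c1 c2 s s' t :
      expr_val s e <= 0 -> exec c2 s t s' ->
      exec (If e c1 c2) s (1 + expr_cost s e + t)%N s'
  | ExWhileT e c s1 s2 s3 t1 t2 :
      0 < expr_val s1 e -> exec c s1 t1 s2 -> exec (While e c) s2 t2 s3 ->
      exec (While e c) s1 (1 + expr_cost s1 e + t1 + t2)%N s3
  | ExWhileF e c s :
      expr_val s e <= 0 -> exec (While e c) s (1 + expr_cost s e)%N s.

(* The input is in array 0 and every other cell is 0. *)
Definition load (w : seq int) : state :=
  fun a i => if a == 0%N then nth 0 w i else 0.

Definition bitsize (w : seq int) : nat := \sum_(z <- w) bitlen z.

(* The output is read from array 1.  Only instances satisfying [promise] have
   to be solved, and [enc] is their encoding. *)
Definition polytime_solvable (I : Type) (enc : I -> seq int)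
    (promise : I -> Prop) (correct : I -> (nat -> int) -> Prop) : Prop :=
  exists (c : prog) (P : {poly nat}), forall x : I, promise x ->
    exists (t : nat) (s : state),
      [/\ exec c (load (enc x)) t s,
          (t <= P.[bitsize (enc x)])%N &
          correct x (s 1%N)].

Record instance (m : nat) := Instance {
  size_n : nat;
  dat : data rat m size_n;
  obj : 'M[rat]_size_n;
  eps : rat }.

Definition enc_rats (s : seq rat) : seq int :=
  flatten [seq [:: numq q; denq q] | q <- s].

Definition enc_instance (m : nat) (x : instance m) : seq int :=
  let D := dat x in
  (size_n x)%:Z ::
  enc_rats (codom (alpha D) ++ codom (gamma D) ++ codom (rhs D) ++
            [seq beta D i 0 | i <- enum 'I_(size_n x)] ++
            [seq delta D i 0 | i <- enum 'I_(size_n x)] ++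
            [seq obj x i j | i <- enum 'I_(size_n x), j <- enum 'I_(size_n x)] ++
            [:: eps x]).

Definition promise (R : realType) (m : nat) (x : instance m) : Prop :=
  [/\ (3 <= size_n x)%N,
      admissible (map_data (ratr : rat -> R) (dat x)) &
      0 < eps x].

(* [out] stores W row by row, each entry as a fraction whose numerator and
   (positive) denominator are consecutive; cell 0 holds a status flag. *)
Definition outputs (n : nat) (out : nat -> int) (W : 'M[rat]_n) : Prop :=
  forall i j : 'I_n, let k := (2 * (i * n + j))%N in
    0 < out k.+2 /\ W i j = (out k.+1)%:~R / (out k.+2)%:~R.

(* Either status 0 and U is empty, or status 1 and a point of U whose objective
   value is within [eps] of the supremum over U.  Minimization is the case of
   the opposite objective. *)
Definition optimizes (R : realType) (m : nat) (x : instance m)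
    (out : nat -> int) : Prop :=
  let q : rat -> R := ratr in
  let U := calU (map_data q (dat x)) in
  let C := map_mx q (obj x) in
  (out 0%N = 0 /\ U = set0) \/
  (out 0%N = 1 /\ exists W : 'M[rat]_(size_n x),
     [/\ outputs out W,
         U (map_mx q W) &
         forall W', U W' -> inner C W' <= inner C (map_mx q W) + q (eps x)]).

(* Main.v *)
(* A nonnegative matrix of rank at most 1 is W = x y^T with x, y >= 0, and the
   k-th constraint reads alpha_k u + gamma_k v <= b_k with
   u = (beta.x)(beta.y) and v = (delta.x)(delta.y). For fixed x it is linear in
   y, so y may be taken to be a vertex of a polytope, and conversely. A vertex
   has at most two nonzero entries, and exactly two only if two nonparallel
   constraints k, l are tight, which determines (u, v). Hence the convex hull of
   U is spanned by 0, finitely many matrices with a single nonzero entry, and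
   finitely many arcs x(s) y(s)^T, where x(s) and y(s) are supported on two
   indices with beta.x = 1, delta.x = s, beta.y = u, delta.y = v / s. The entries
   of x(s) y(s)^T are affine in (s, 1/s), and the convex hull of
   {(s, 1/s) | lo <= s <= hi} lies between a hyperbola and a chord, so it is
   second-order cone representable.

   A linear objective restricted to an arc is a s + b + c / s. Its maximum is at
   an end of the arc, or at sqrt(c/a) when a, c < 0; there any rational value of
   s gives an exactly feasible matrix, so an integer square root at a
   suitable scale yields a rational solution within the required accuracy. The
   algorithm tries all these candidates, testing each for feasibility, which makes
   the junk values of degenerate indices harmless. It is written in a small
   language of bounded loops over rational registers. Each register holds a
   fraction whose bit length is at most a fixed multiple, its degree, of the size
   of the input; this bounds the cost of the compiled program. *)
Require Import Defs.
From Stdlib Require PeanoNat.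
From HB Require Import structures.
From mathcomp Require Import all_boot all_order all_algebra.
From mathcomp Require Import all_classical all_reals all_analysis.
From mathcomp Require Import ring lra zify.
Import Order.TTheory GRing.Theory Num.Theory.
Local Open Scope classical_set_scope.
Local Open Scope ring_scope.

Set Implicit Arguments.
Unset Strict Implicit.
Unset Printing Implicit Defensive.

(** * Vertices of bounded polyhedra *)

(** Convexity is exploited in one factor at a time: a set of pairs closed under convex combinations
    in [x] for fixed [y], and in [y] for fixed [x], contains every feasible pair once it contains
    the extreme ones. Making one factor extreme must not spoil what is known of the other; this
    works because having two nonzero entries is a property of [y] alone, while the tight constraints
    can be taken from the last slice considered. Boundedness enters by excluding that all the [A^k]
    vanish, after which every slice with [x] nonzero is a polytope. A negative [b_k] makes the
    feasible set empty; otherwise 0 is feasible and serves as the initial candidate. The square root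
    is taken at scale K = 1 - a / (sigma eps), where sigma = delta_i / beta_i is a lower bound of
    the arc: an error of 1 / K in s then costs at most eps. Bit lengths stay bounded under nested
    loops because no register accumulates: values are recomputed from the input, and the best
    candidate is only copied. *)

Definition dot (F : pzRingType) (n : nat) (a x : 'cV[F]_n) : F :=
  \sum_i a i 0 * x i 0.

Lemma dotDr (F : comPzRingType) n (a x y : 'cV[F]_n) :
  dot a (x + y) = dot a x + dot a y.
Proof. by rewrite -big_split; apply: eq_bigr => i _; rewrite mxE mulrDr. Qed.

Lemma dotZr (F : comPzRingType) n (a x : 'cV[F]_n) c :
  dot a (c *: x) = c * dot a x.
Proof. by rewrite mulr_sumr; apply: eq_bigr => i _; rewrite mxE mulrCA. Qed.

Lemma dotNr (F : comPzRingType) n (a x : 'cV[F]_n) : dot a (- x) = - dot a x.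
Proof. by rewrite -scaleN1r dotZr mulN1r. Qed.

Lemma dotC (F : comPzRingType) n (a x : 'cV[F]_n) : dot a x = dot x a.
Proof. by apply: eq_bigr => i _; rewrite mulrC. Qed.

Lemma dot_delta (F : comPzRingType) n (a : 'cV[F]_n) j :
  dot a (delta_mx j 0) = a j 0.
Proof.
rewrite /dot (bigD1 j)//= big1 ?addr0 ?mxE ?eqxx ?mulr1// => i ij.
by rewrite mxE (negPf ij) mulr0.
Qed.

Section Vertices.
Variables (R : realFieldType) (n : nat) (I : finType).
Variables (a : I -> 'cV[R]_n) (b : I -> R).

Definition feasible (z : 'cV[R]_n) := forall h, dot (a h) z <= b h.

(** Extremality in its rank form: the normals of the tight constraints span the space. One nonzero
    direction [w] refutes it. *)
Definition vertex (z : 'cV[R]_n) :=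
  forall w, (forall h, dot (a h) z = b h -> dot (a h) w = 0) -> w = 0.

Hypothesis bounded : forall w, w != 0 -> exists h, 0 < dot (a h) w.

(** Ratio test: moving along [w] until the first constraint blocks keeps the tight constraints tight
    and adds the blocking one. *)
Lemma feasible_step (z w : 'cV[R]_n) : feasible z -> w != 0 ->
  (forall h, dot (a h) z = b h -> dot (a h) w = 0) ->
  exists t, [/\ 0 < t, feasible (z + t *: w) &
   (#|[pred h | dot (a h) (z + t *: w) != b h]|
      < #|[pred h | dot (a h) z != b h]|)%N].
Proof.
move=> fz w0 act; have [h0 h0P] := bounded w0.
pose f h := (b h - dot (a h) z) / dot (a h) w.
case: (@arg_minP _ _ _ h0 (fun h => 0 < dot (a h) w) f h0P) => k kP kmin.
have nk : dot (a k) z != b k by apply: contraTneq kP => /act ->; rewrite ltxx.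
have fk : 0 < f k by rewrite divr_gt0// subr_gt0 lt_neqAle nk fz.
exists (f k); split=> //.
  move=> h; rewrite dotDr dotZr.
  have [hP|hP] := ltP 0 (dot (a h) w); last first.
    by apply: le_trans (fz h); rewrite gerDl mulr_ge0_le0// ltW.
  by rewrite -lerBrDl -ler_pdivlMr// kmin.
apply/proper_card/properP; split.
  apply/fintype.subsetP => h; rewrite !inE; apply: contraNneq => e.
  by rewrite dotDr dotZr act ?e// mulr0 addr0.
exists k => //; rewrite inE negbK dotDr dotZr /f divfK ?(gt_eqF kP)//.
by rewrite addrC subrK.
Qed.

(** Minkowski's theorem as an induction principle: a point that is not a vertex lies between the
    ends of two steps, along [w] and [- w], each with fewer slack constraints. *)
Lemma vertex_ind (G : 'cV[R]_n -> Prop) :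
  (forall z z' t, 0 <= t <= 1 -> G z -> G z' -> G (t *: z + (1 - t) *: z')) ->
  (forall z, feasible z -> vertex z -> G z) ->
  forall z, feasible z -> G z.
Proof.
move=> Gc Gv z; have [k] := ubnP #|[pred h | dot (a h) z != b h]|.
elim: k z => // k IH z; rewrite ltnS => zk fz.
have [zv|/existsNP[w /not_implyP[wP /eqP w0]]] := pselect (vertex z).
  exact: Gv.
have [t [t0 ft ct]] := feasible_step fz w0 wP.
have wN h : dot (a h) z = b h -> dot (a h) (- w) = 0.
  by move/wP; rewrite dotNr => ->; rewrite oppr0.
have wN0 : - w != 0 by rewrite oppr_eq0.
have [u [u0 fu cu]] := feasible_step fz wN0 wN.
have tu : 0 < t + u by rewrite addr_gt0.
have -> : z = u / (t + u) *: (z + t *: w) + (1 - u / (t + u)) *: (z + u *: - w).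
  apply/matrixP => i j; rewrite !mxE; field; exact: lt0r_neq0.
apply: Gc; first by rewrite divr_ge0 ?(ltW u0) ?(ltW tu)//= ler_pdivrMr// mul1r lerDr ltW.
  by apply: IH ft; apply: leq_trans zk.
by apply: IH fu; apply: leq_trans zk.
Qed.
End Vertices.

Lemma clear_den (F : fieldType) (a b c d e : F) : c != 0 ->
  (a / c * b + d / c * e) * c = a * b + d * e.
Proof. by move=> c0; field. Qed.

(** * Vectors supported on two indices *)

Section Pairs.
Variables (F : fieldType) (m n : nat) (D : data F m n).

Definition cross (i j : 'I_n) : F :=
  beta D i 0 * delta D j 0 - beta D j 0 * delta D i 0.

(* For [cross i j != 0], the vector supported on [{i, j}] whose products with
   [beta] and [delta] are [p] and [q]. *)
Definition pt (i j : 'I_n) (p q : F) : 'cV[F]_n :=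
  ((p * delta D j 0 - q * beta D j 0) / cross i j) *: delta_mx i 0 +
  ((q * beta D i 0 - p * delta D i 0) / cross i j) *: delta_mx j 0.

Definition minor (k l : 'I_m) : F :=
  alpha D k * gamma D l - alpha D l * gamma D k.

(** The left side of the constraint [k] at the matrix [x *m y^T], by [inner_Amx]. *)
Definition load_of (k : 'I_m) (x y : 'cV[F]_n) : F :=
  alpha D k * (dot (beta D) x * dot (beta D) y) +
  gamma D k * (dot (delta D) x * dot (delta D) y).

Lemma crossC i j : cross j i = - cross i j.
Proof. by rewrite /cross; ring. Qed.

(** The symmetry that lets two indices be ordered so that their cross product is positive. *)
Lemma ptC i j p q : pt j i p q = pt i j p q.
Proof.
rewrite /pt crossC invrN !mulrN -!mulNr addrC; congr (_ *: _ + _ *: _);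
  congr (_ / _); ring.
Qed.

Lemma dot_beta_pt i j p q : cross i j != 0 -> dot (beta D) (pt i j p q) = p.
Proof.
move=> cn; rewrite dotDr !dotZr !dot_delta; apply: (mulIf cn).
by rewrite clear_den// /cross; ring.
Qed.

Lemma dot_delta_pt i j p q : cross i j != 0 -> dot (delta D) (pt i j p q) = q.
Proof.
move=> cn; rewrite dotDr !dotZr !dot_delta; apply: (mulIf cn).
by rewrite clear_den// /cross; ring.
Qed.

Lemma pt_eq i j c d : cross i j != 0 ->
  c *: delta_mx i 0 + d *: delta_mx j 0 =
  let x := c *: delta_mx i 0 + d *: delta_mx j 0 in
  pt i j (dot (beta D) x) (dot (delta D) x).
Proof.
move=> cn /=; rewrite !(dotDr, dotZr, dot_delta) /pt.
congr (_ *: _ + _ *: _); apply: (mulIf cn); rewrite divfK// /cross; ring.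
Qed.

Lemma load_ofC k x y : load_of k x y = load_of k y x.
Proof. by rewrite /load_of ![dot _ x * _]mulrC. Qed.

End Pairs.

(** * Extreme feasible pairs *)

Section Classification.
Variables (R : realFieldType) (m n : nat) (D : data R m n).
Hypothesis alpha_ge0 : forall k, 0 <= alpha D k.
Hypothesis gamma_ge0 : forall k, 0 <= gamma D k.
Hypothesis beta_gt0 : forall i, 0 < beta D i 0.
Hypothesis delta_gt0 : forall i, 0 < delta D i 0.

(** The constraints on [y] for fixed [x]. The normals of the last [m] lie in the span of [beta] and
    [delta], which limits the support of a vertex to two indices. *)
Definition slice_lhs (x : 'cV[R]_n) (h : 'I_n + 'I_m) : 'cV[R]_n :=
  match h with
  | inl j => - delta_mx j 0
  | inr k => (alpha D k * dot (beta D) x) *: beta D +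
             (gamma D k * dot (delta D) x) *: delta D
  end.

Definition slice_rhs (h : 'I_n + 'I_m) : R :=
  if h is inr k then rhs D k else 0.

Lemma dot_slice_l x j y : dot (slice_lhs x (inl j)) y = - y j 0.
Proof. by rewrite dotC dotNr dot_delta. Qed.

Lemma dot_slice_r x k y : dot (slice_lhs x (inr k)) y = load_of D k x y.
Proof.
rewrite dotC dotDr !dotZr ![dot y _]dotC /load_of; ring.
Qed.

Definition nonneg (x : 'cV[R]_n) := forall i, 0 <= x i 0.

Lemma feasible_slice x y : feasible (slice_lhs x) slice_rhs y <->
  nonneg y /\ forall k, load_of D k x y <= rhs D k.
Proof.
split=> [fy|[y0 yk] [j|k]]; last 2 first.
- by rewrite dot_slice_l oppr_le0.
- by rewrite dot_slice_r.
split=> [j|k]; last by rewrite -dot_slice_r; exact: (fy (inr k)).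
by rewrite -oppr_le0 -(dot_slice_l x); exact: (fy (inl j)).
Qed.

Lemma slice_vertex x y : vertex (slice_lhs x) slice_rhs y ->
  forall w : 'cV[R]_n, (forall j, y j 0 = 0 -> w j 0 = 0) ->
    (forall k, load_of D k x y = rhs D k -> load_of D k x w = 0) -> w = 0.
Proof.
move=> vy w wj wk; apply: vy => -[j|k].
  by rewrite !dot_slice_l => /eqP; rewrite oppr_eq0 => /eqP/wj ->; rewrite oppr0.
by rewrite !dot_slice_r; exact: wk.
Qed.

Definition coef x k j := load_of D k x (delta_mx j 0).

(** The excluded cases are refuted by a nonzero direction supported where [y] is nonzero and
    annihilated by the tight rows. Such a direction exists for three support indices, for two whose
    columns in ([beta], [delta]) are parallel, and for two when all tight rows are proportional. *)
Lemma vertex_class x y :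
  0 < dot (beta D) x -> 0 < dot (delta D) x ->
  nonneg y -> vertex (slice_lhs x) slice_rhs y ->
  [\/ y = 0,
      exists j k, [/\ y = y j 0 *: delta_mx j 0, load_of D k x y = rhs D k &
                      0 < coef x k j] |
      exists i j k l, [/\ 0 < cross D i j,
        y = pt D i j (dot (beta D) y) (dot (delta D) y),
        load_of D k x y = rhs D k, load_of D l x y = rhs D l &
        minor D k l != 0]].
Proof.
move=> p0 q0 y0 /slice_vertex vy.
have coefE k w : load_of D k x w = alpha D k * dot (beta D) x * dot (beta D) w +
    gamma D k * dot (delta D) x * dot (delta D) w.
  by rewrite /load_of; ring.
have coef_ge0 k j : 0 <= coef x k j.
  by rewrite /coef coefE !dot_delta addr_ge0 ?mulr_ge0// ltW.
(* Otherwise the unit vector at [j] would be such a direction. *)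
have free j : y j 0 != 0 -> exists k, load_of D k x y = rhs D k /\ coef x k j != 0.
  move=> yj; apply: contrapT => /forallNP nk.
  have /matrixP/(_ j 0)/eqP : delta_mx j 0 = 0 :> 'cV[R]_n.
    apply: vy => [i|k kt]; first by rewrite mxE andbT; case: eqP => // -> /eqP; rewrite (negPf yj).
    by apply/eqP/negP => /negP kn; apply: (nk k).
  by rewrite !mxE !eqxx oner_eq0.
have [->|/eqP yn0] := eqVneq y 0; first exact: Or31.
have [i yi] : exists i, y i 0 != 0.
  apply: contrapT => /forallNP yi; apply: yn0; apply/matrixP => i j.
  by rewrite ord1 mxE; apply/eqP/negP => /negP; apply: yi.
have [k [kt ki]] := free _ yi.
have [ys|] := pselect (forall j, j != i -> y j 0 = 0).
  apply: Or32; exists i, k; split=> //; last by rewrite lt_neqAle eq_sym ki coef_ge0.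
  apply/matrixP => j j'; rewrite ord1 !mxE andbT.
  by have [->|/ys ->] := eqVneq j i; rewrite ?mulr1 ?mulr0.
move=> /existsNP[j /not_implyP[ji /eqP yj]]; apply: Or33.
have dE c d e j' l : (c *: delta_mx i 0 + d *: delta_mx j 0 + e *: delta_mx l 0 : 'cV[R]_n) j' 0
    = c * (j' == i)%:R + d * (j' == j)%:R + e * (j' == l)%:R.
  by rewrite !mxE !andbT.
have cr0 : cross D i j != 0.
  apply/negP => /eqP c0; pose w : 'cV[R]_n := beta D j 0 *: delta_mx i 0 - beta D i 0 *: delta_mx j 0.
  have /matrixP/(_ i 0)/eqP : w = 0.
    apply: vy => [l yl|l lt]; last first.
      rewrite coefE !(dotDr, dotNr, dotZr, dot_delta) -[X in _ + _ * X]opprK opprB.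
      rewrite [beta D j 0 * beta D i 0]mulrC subrr mulr0.
      by rewrite -/(cross D i j) c0 oppr0 mulr0 addr0.
    have li : (l == i) = false by apply: contraNF yi => /eqP <-; rewrite yl.
    have lj : (l == j) = false by apply: contraNF yj => /eqP <-; rewrite yl.
    by rewrite !mxE li lj !mulr0 subrr.
  rewrite !mxE eqxx [i == j]eq_sym (negPf ji) mulr0 subr0 mulr1.
  by rewrite gt_eqF.
have ys l : l != i -> l != j -> y l 0 = 0.
  move=> li lj; apply/eqP/negP => /negP yl.
  (* The coefficients are the minors of the matrix with rows [beta] and [delta] on these three
     columns, so [w] is orthogonal to both rows. *)
  pose w : 'cV[R]_n := cross D j l *: delta_mx i 0 + cross D l i *: delta_mx j 0
    + cross D i j *: delta_mx l 0.
  have /matrixP/(_ l 0)/eqP : w = 0.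
    apply: vy => [h yh|h ht].
      have hi : (h == i) = false by apply: contraNF yi => /eqP <-; rewrite yh.
      have hj : (h == j) = false by apply: contraNF yj => /eqP <-; rewrite yh.
      have hl : (h == l) = false by apply: contraNF yl => /eqP <-; rewrite yh.
      by rewrite dE hi hj hl !mulr0 !addr0.
    by rewrite coefE !(dotDr, dotZr, dot_delta) /cross; ring.
  by rewrite dE eqxx (negPf li) (negPf lj) !mulr0 !add0r mulr1 mxE (negPf cr0).
have yE : y = pt D i j (dot (beta D) y) (dot (delta D) y).
  have -> : y = y i 0 *: delta_mx i 0 + y j 0 *: delta_mx j 0.
    apply/matrixP => l l'; rewrite ord1 !mxE !andbT.
    have [->|li] := eqVneq l i; first by rewrite [i == j]eq_sym (negPf ji) mulr1 mulr0 addr0.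
    have [->|lj] := eqVneq l j; first by rewrite mulr1 mulr0 add0r.
    by rewrite ys// !mulr0 addr0.
  exact: pt_eq.
have [l lt kl] : exists2 l, load_of D l x y = rhs D l & minor D k l != 0.
  apply: contrapT => nl.
  (* [w] is orthogonal to the row of [k], and its product with the row of [l] is a multiple of
     [minor D k l]. *)
  pose w : 'cV[R]_n := coef x k j *: delta_mx i 0 - coef x k i *: delta_mx j 0.
  have loadw h : load_of D h x w = coef x k j * coef x h i - coef x k i * coef x h j.
    rewrite coefE /w !(dotDr, dotNr, dotZr, dot_delta) /coef !coefE !dot_delta; ring.
  have /matrixP/(_ j 0)/eqP : w = 0.
    apply: vy => [l yl|l lt].
      have li : (l == i) = false by apply: contraNF yi => /eqP <-; rewrite yl.
      have lj : (l == j) = false by apply: contraNF yj => /eqP <-; rewrite yl.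
      by rewrite !mxE li lj !mulr0 subrr.
    have /eqP : minor D k l = 0.
      by apply/eqP/negP => /negP kl; apply: nl; exists l.
    rewrite subr_eq0 => /eqP kl; rewrite loadw /coef !coefE !dot_delta.
    apply/eqP; set p := dot (beta D) x; set q := dot (delta D) x.
    rewrite (_ : _ - _ = - (cross D i j * p * q * minor D k l)); last by rewrite /cross /minor; ring.
    by rewrite /minor kl subrr mulr0 oppr0.
  rewrite !mxE !eqxx (negPf ji) mulr0 add0r mulr1 oppr_eq0.
  by rewrite (negPf ki).
have [c0|c0] := ltP 0 (cross D i j); first by exists i, j, k, l; split.
exists j, i, k, l; split=> //; last by rewrite ptC.
by rewrite crossC oppr_gt0 lt_neqAle cr0.
Qed.

Lemma dot_gt0 (c x : 'cV[R]_n) : (forall i, 0 < c i 0) -> nonneg x -> x != 0 ->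
  0 < dot c x.
Proof.
move=> c0 x0 /eqP xn0.
have [i xi] : exists i, x i 0 != 0.
  apply: contrapT => /forallNP xi; apply: xn0; apply/matrixP => i j.
  by rewrite ord1 mxE; apply/eqP/negP => /negP; apply: xi.
rewrite /dot (bigD1 i)//= ltr_pwDl//.
  by rewrite mulr_gt0// lt_neqAle eq_sym xi x0.
by apply: sumr_ge0 => j _; rewrite mulr_ge0// ltW.
Qed.

Definition feasible_pair (x y : 'cV[R]_n) :=
  [/\ nonneg x, nonneg y & forall k, load_of D k x y <= rhs D k].

Definition spans (i j : 'I_n) (x : 'cV[R]_n) :=
  0 < cross D i j /\ x = pt D i j (dot (beta D) x) (dot (delta D) x).

(* The properties of a set of pairs [(x, y)] which suffice for it to contain
   all the feasible ones; they are symmetric in [x] and [y]. *)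
Record absorbing (G : 'cV[R]_n -> 'cV[R]_n -> Prop) : Prop := Absorbing {
  absorb_l : forall x x' y t, 0 <= t <= 1 -> G x y -> G x' y ->
    G (t *: x + (1 - t) *: x') y;
  absorb_r : forall x y y' t, 0 <= t <= 1 -> G x y -> G x y' ->
    G x (t *: y + (1 - t) *: y');
  absorb0l : forall y, G 0 y;
  absorb0r : forall x, G x 0;
  absorb_ray : forall c d i j k, let x := c *: delta_mx i 0 in
    let y := d *: delta_mx j 0 in
    0 < c -> 0 < d -> feasible_pair x y -> load_of D k x y = rhs D k ->
    0 < load_of D k (delta_mx i 0) (delta_mx j 0) -> G x y;
  absorb_curve : forall x y i i' j j' k l, feasible_pair x y -> x != 0 -> y != 0 ->
    spans i i' x -> spans j j' y ->
    load_of D k x y = rhs D k -> load_of D l x y = rhs D l ->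
    minor D k l != 0 -> G x y }.

Lemma feasible_pairC x y : feasible_pair x y -> feasible_pair y x.
Proof. by case=> x0 y0 xy; split=> // k; rewrite load_ofC. Qed.

Lemma absorbingC G : absorbing G -> absorbing (fun x y => G y x).
Proof.
case=> Gl Gr G0l G0r Gray Gcurve; split=> //.
- by move=> x x' y t; exact: Gr.
- by move=> x y y' t; exact: Gl.
- move=> c d i j k x y c0 d0 /feasible_pairC fxy; rewrite load_ofC => e.
  by rewrite load_ofC => p; apply: (Gray d c j i k).
- move=> x y i i' j j' k l /feasible_pairC fxy x0 y0 sx sy.
  rewrite load_ofC => ek; rewrite load_ofC => el kl.
  exact: (Gcurve y x j j' i i' k l).
Qed.

Hypothesis nondegenerate : exists k, 0 < alpha D k \/ 0 < gamma D k.

Lemma load_ofZr k x y c : load_of D k x (c *: y) = c * load_of D k x y.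
Proof. by rewrite /load_of !dotZr; ring. Qed.

Lemma load_ofZl k x y c : load_of D k (c *: x) y = c * load_of D k x y.
Proof. by rewrite load_ofC load_ofZr load_ofC. Qed.

Lemma load_of_gt0 k x y : 0 < alpha D k \/ 0 < gamma D k ->
  nonneg x -> nonneg y -> x != 0 -> y != 0 -> 0 < load_of D k x y.
Proof.
move=> kP x0 y0 xn yn.
have ux := dot_gt0 beta_gt0 x0 xn; have vx := dot_gt0 delta_gt0 x0 xn.
have uy := dot_gt0 beta_gt0 y0 yn; have vy := dot_gt0 delta_gt0 y0 yn.
have u0 := mulr_gt0 ux uy; have v0 := mulr_gt0 vx vy.
rewrite /load_of; case: kP => h.
  by rewrite ltr_pwDl ?mulr_gt0// mulr_ge0// ltW.
by rewrite ltr_pwDr ?mulr_gt0// mulr_ge0// ltW.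
Qed.

(** A nonnegative direction increases a constraint with a positive coefficient; any other direction
    decreases some entry. *)
Lemma slice_bounded x : nonneg x -> x != 0 ->
  forall w, w != 0 -> exists h, 0 < dot (slice_lhs x h) w.
Proof.
move=> x0 xn w wn; have [w0|/existsNP[j /negP wj]] := pselect (nonneg w).
  have [k kP] := nondegenerate; exists (inr k).
  by rewrite dot_slice_r load_of_gt0.
by exists (inl j); rewrite dot_slice_l oppr_gt0 ltNge.
Qed.

Lemma slice_ind G x : absorbing G -> nonneg x -> x != 0 ->
  (forall y, feasible_pair x y -> vertex (slice_lhs x) slice_rhs y -> G x y) ->
  forall y, feasible_pair x y -> G x y.
Proof.
move=> aG x0 xn Gv y [_ y0 yk].
apply: (vertex_ind (slice_bounded x0 xn)) (proj2 (feasible_slice x y) (conj y0 yk)).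
  by move=> z z' t t01; exact: absorb_r.
by move=> z /feasible_slice[z0 zk]; exact: Gv.
Qed.

(** Only [y] has to be made extreme. If the vertex has two nonzero entries, [x] counts as a
    combination of two indices with one coefficient 0, so that the pair lies on a curve. *)
Lemma absorb_single G c i y : absorbing G -> 0 < c ->
  feasible_pair (c *: delta_mx i 0) y -> G (c *: delta_mx i 0) y.
Proof.
set x := c *: _ => aG c0 fxy; have [x0 _ _] := fxy.
have xn : x != 0.
  apply/eqP => /matrixP/(_ i 0)/eqP; rewrite !mxE !eqxx mulr1.
  by rewrite gt_eqF.
apply: slice_ind fxy => // {}y fxy yv; have [_ y0 _] := fxy.
have [->|[j [k [yj kt kj]]]|[j [j' [k [l [jj' yE kt lt kl]]]]]] :=
  vertex_class (dot_gt0 beta_gt0 x0 xn) (dot_gt0 delta_gt0 x0 xn) y0 yv.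
- exact: absorb0r.
- have [y00|yn] := eqVneq (y j 0) 0.
    by rewrite yj y00 scale0r; exact: absorb0r.
  rewrite yj; apply: (absorb_ray aG (k := k)) => //; rewrite -?yj//.
    by rewrite lt_neqAle eq_sym yn y0.
  by move: kj; rewrite /coef /x load_ofZl pmulr_rgt0.
- have [y00|yn] := eqVneq y 0; first by rewrite y00; exact: absorb0r.
  (* If every [cross D i _] vanished, [beta] and [delta] would also be parallel on [j] and [j']. *)
  have [i' ii'] : exists i', cross D i i' != 0.
    apply: contrapT => /forallNP ni.
    have /eqP h1 : cross D i j == 0 by apply/negP => /negP; apply: ni.
    have /eqP h2 : cross D i j' == 0 by apply/negP => /negP; apply: ni.
    have /eqP : beta D i 0 * cross D j j' = 0.
      rewrite (_ : _ * _ = beta D j 0 * cross D i j' - beta D j' 0 * cross D i j).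
        by rewrite h1 h2 !mulr0 subrr.
      by rewrite /cross; ring.
    by rewrite mulf_eq0 gt_eqF// gt_eqF.
  have xE : x = pt D i i' (dot (beta D) x) (dot (delta D) x).
    have <- : c *: delta_mx i 0 + 0 *: delta_mx i' 0 = x.
      by rewrite scale0r addr0.
    exact: pt_eq.
  have [c1|c1] := ltP 0 (cross D i i').
    by apply: (absorb_curve aG (i := i) (i' := i') (j := j) (j' := j') (k := k) (l := l)).
  apply: (absorb_curve aG (i := i') (i' := i) (j := j) (j' := j') (k := k) (l := l)) => //.
  by split; [rewrite crossC oppr_gt0 lt_neqAle ii'|rewrite ptC].
Qed.

(** First [y] is made extreme for [x], then [x] is replaced by a vertex [z] of the slice of [y].
    This leaves [y] and its two-index form untouched, and the tight constraints of the curve are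
    those found for [z]. *)
Lemma absorbing_feasible G x y : absorbing G -> feasible_pair x y -> G x y.
Proof.
move=> aG fxy; have [x00|xn] := eqVneq x 0.
  by rewrite x00; exact: absorb0l.
have [x0 _ _] := fxy.
apply: slice_ind fxy => // {}y fxy yv; have [_ y0 _] := fxy.
have [y00|yn] := eqVneq y 0; first by rewrite y00; exact: absorb0r.
have [y00|[j [k [yj kt kj]]]|[j [j' [k [l [jj' yE kt lt kl]]]]]] :=
  vertex_class (dot_gt0 beta_gt0 x0 xn) (dot_gt0 delta_gt0 x0 xn) y0 yv.
- by rewrite y00; exact: absorb0r.
- have yj0 : 0 < y j 0.
    rewrite lt_neqAle y0 andbT eq_sym; apply: contraNneq yn => y00.
    by rewrite yj y00 scale0r.
  rewrite yj; apply: (absorb_single (G := fun x y => G y x)) => //.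
    exact: absorbingC.
  by rewrite -yj; apply: feasible_pairC.
apply: (slice_ind (absorbingC aG)) (feasible_pairC fxy) => // z fz zv.
have [_ z0 _] := fz.
have [z00|zn] := eqVneq z 0; first by rewrite z00; exact: absorb0l.
have [z00|[i [k' [zi _ _]]]|[i [i' [k' [l' [ii' zE kt' lt' kl']]]]]] :=
  vertex_class (dot_gt0 beta_gt0 y0 yn) (dot_gt0 delta_gt0 y0 yn) z0 zv.
- by rewrite z00; exact: absorb0l.
- have zi0 : 0 < z i 0.
    rewrite lt_neqAle z0 andbT eq_sym; apply: contraNneq zn => z00.
    by rewrite zi z00 scale0r.
  by rewrite zi; apply: absorb_single => //; rewrite -zi; apply: feasible_pairC.
- apply: (absorb_curve aG (i := i) (i' := i') (j := j) (j' := j') (k := k') (l := l')) => //.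
  + exact: feasible_pairC.
  + by rewrite load_ofC.
  + by rewrite load_ofC.
Qed.

End Classification.

(** * The arcs spanning the convex hull *)

Section Curves.
Variables (F : fieldType) (m n : nat) (D : data F m n).

(* The common value [(u, v)] of the two products at which the constraints [k]
   and [l] are both tight. *)
Definition corner_u (k l : 'I_m) : F :=
  (rhs D k * gamma D l - rhs D l * gamma D k) / minor D k l.

Definition corner_v (k l : 'I_m) : F :=
  (alpha D k * rhs D l - alpha D l * rhs D k) / minor D k l.

Lemma corner_unique k l u v : minor D k l != 0 ->
  alpha D k * u + gamma D k * v = rhs D k ->
  alpha D l * u + gamma D l * v = rhs D l ->
  u = corner_u k l /\ v = corner_v k l.
Proof.
move=> kl ek el; rewrite /corner_u /corner_v -ek -el.
by split; apply: (mulIf kl); rewrite divfK// /minor; ring.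
Qed.

(** Scaling [x] against [y] does not change the product, which allows the product of [x] with [beta]
    to be 1; the corner then dictates the products of [y]. *)
Definition curve (i i' j j' : 'I_n) (k l : 'I_m) (s : F) : 'M[F]_n :=
  pt D i i' 1 s *m (pt D j j' (corner_u k l) (corner_v k l / s))^T.

Lemma pt_lin i j p q : pt D i j p q = p *: pt D i j 1 0 + q *: pt D i j 0 1.
Proof.
by apply/matrixP => h h'; rewrite !mxE; ring.
Qed.

Lemma pt_scale i j c p q : pt D i j (c * p) (c * q) = c *: pt D i j p q.
Proof. by apply/matrixP => h h'; rewrite !mxE; ring. Qed.

Definition curve_lin i i' j j' k l : 'M[F]_n :=
  corner_u k l *: (pt D i i' 0 1 *m (pt D j j' 1 0)^T).
Definition curve_cst i i' j j' k l : 'M[F]_n :=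
  corner_u k l *: (pt D i i' 1 0 *m (pt D j j' 1 0)^T) +
  corner_v k l *: (pt D i i' 0 1 *m (pt D j j' 0 1)^T).
Definition curve_inv i i' j j' k l : 'M[F]_n :=
  corner_v k l *: (pt D i i' 1 0 *m (pt D j j' 0 1)^T).

Lemma curveE i i' j j' k l s : s != 0 -> curve i i' j j' k l s =
  s *: curve_lin i i' j j' k l + curve_cst i i' j j' k l +
  s^-1 *: curve_inv i i' j j' k l.
Proof.
move=> s0; rewrite /curve (pt_lin i) (pt_lin j) /curve_lin /curve_cst /curve_inv.
move: (corner_u k l) (corner_v k l) => u v.
move: (pt D i i' 1 0) (pt D i i' 0 1) (pt D j j' 1 0) (pt D j j' 0 1) => a a' c c'.
by apply/matrixP => h h'; rewrite !mxE !big_ord1 !mxE; field.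
Qed.

End Curves.

(** * Nonnegative matrices of rank at most one *)

Section RankOne.
Variables (R : realType) (m n : nat) (D : data R m n).

Lemma inner_rank1 (U : 'M[R]_n) (x y : 'cV[R]_n) :
  inner U (x *m y^T) = \sum_i \sum_j U i j * (x i 0 * y j 0).
Proof.
apply: eq_bigr => i _; apply: eq_bigr => j _.
by rewrite !mxE big_ord1 !mxE.
Qed.

Lemma inner_Amx k (x y : 'cV[R]_n) :
  inner (Amx D k) (x *m y^T) = load_of D k x y.
Proof.
rewrite inner_rank1 /load_of /dot !big_distrlr/= !mulr_sumr -big_split/=.
apply: eq_bigr => i _; rewrite !mulr_sumr -big_split/=; apply: eq_bigr => j _.
by rewrite !mxE !big_ord1 !mxE; ring.
Qed.

Lemma rank1_nonneg (W : 'M[R]_n) : (forall i j, 0 <= W i j) -> (\rank W <= 1)%N ->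
  exists x y, [/\ nonneg x, nonneg y & W = x *m y^T].
Proof.
move=> W0 rW; have [->|/eqP Wn] := eqVneq W 0.
  exists 0, 0; split=> [i|i|]; rewrite ?mxE//.
  by rewrite mul0mx.
have [a [b Wab]] : exists a b, W a b != 0.
  apply: contrapT => /forallNP nW; apply: Wn; apply/matrixP => a b.
  rewrite mxE; apply/eqP/negP => /negP h.
  by have /forallNP/(_ b) := nW a; apply.
(* The minors of order two vanish, because [W] factors through a space of dimension at most one. *)
have prod i j : W i j * W a b = W i b * W a j.
  rewrite -(mulmx_base W) !mxE.
  move: (col_base W) (row_base W); case: (\rank W) rW => [|[|//]] _ C r.
    by rewrite !big_ord0 !mul0r.
  by rewrite !big_ord1; ring.
exists (col b W), ((W a b)^-1 *: (row a W)^T); split.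
- by move=> i; rewrite mxE.
- by move=> i; rewrite !mxE mulr_ge0 ?invr_ge0.
- apply/matrixP => i j; rewrite !mxE big_ord1 !mxE mulrCA -prod mulrC mulfK//.
Qed.

Lemma calU_pair W : calU D W <-> exists x y, W = x *m y^T /\ feasible_pair D x y.
Proof.
split=> [[W0 Wk rW]|[x [y [-> [x0 y0 xy]]]]].
  have [x [y [x0 y0 WE]]] := rank1_nonneg W0 rW.
  by exists x, y; split=> //; split=> // k; rewrite -inner_Amx -WE.
split=> [i j|k|]; first by rewrite mxE big_ord1 !mxE mulr_ge0.
  by rewrite inner_Amx.
by rewrite (leq_trans (mxrankM_maxl _ _))// rank_leq_col.
Qed.

End RankOne.

(** * The parameter interval of an arc *)

Section Ranges.
Variables (R : realFieldType) (m n : nat) (D : data R m n).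
Hypothesis beta_gt0 : forall i, 0 < beta D i 0.
Hypothesis delta_gt0 : forall i, 0 < delta D i 0.

Definition slope (i : 'I_n) : R := delta D i 0 / beta D i 0.

(** The value of [s] at which the entry [j'] of [pt D j j' u (v / s)] vanishes, for [(u, v)] the
    corner. *)
Definition dual_slope (j : 'I_n) (k l : 'I_m) : R :=
  corner_v D k l / (corner_u D k l * slope j).

(** With positive cross products, the lower bounds on [s] come from the signs of the entries [i'] of
    [x] and [j] of [y], the upper bounds from [i] and [j']. *)
Definition curve_lo (i j' : 'I_n) (k l : 'I_m) : R :=
  Num.max (slope i) (dual_slope j' k l).

Definition curve_hi (i' j : 'I_n) (k l : 'I_m) : R :=
  Num.min (slope i') (dual_slope j k l).

(** No mention of [s]: along a curve the two products stay constant, hence so do all the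
    constraints, and only the signs of the entries depend on [s]. *)
Definition valid (i i' j j' : 'I_n) (k l : 'I_m) : Prop :=
  [/\ 0 < cross D i i', 0 < cross D j j', minor D k l != 0,
      0 < corner_u D k l /\ 0 < corner_v D k l &
      forall h, alpha D h * corner_u D k l + gamma D h * corner_v D k l <= rhs D h].

Lemma slope_gt0 i : 0 < slope i. Proof. exact: divr_gt0. Qed.

Lemma cross_neq i j : 0 < cross D i j -> (i == j) = false.
Proof. by apply: contraTF => /eqP ->; rewrite /cross subrr ltxx. Qed.

Lemma nonneg_pt i j p q : 0 < cross D i j ->
  (nonneg (pt D i j p q) <->
   q * beta D j 0 <= p * delta D j 0 /\ p * delta D i 0 <= q * beta D i 0).
Proof.
move=> c0; have ij := cross_neq c0; split=> [pt0|[jP iP] h].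
  have := pt0 i; have := pt0 j; rewrite !mxE !eqxx ij [j == i]eq_sym ij !mulr0 !mulr1.
  by rewrite addr0 add0r !pmulr_lge0 ?invr_gt0// !subr_ge0.
by rewrite !mxE addr_ge0// mulr_ge0 ?ler0n// divr_ge0 ?(ltW c0)// subr_ge0.
Qed.

Lemma valid_range i i' j j' k l s : valid i i' j j' k l -> 0 < s ->
  (nonneg (pt D i i' 1 s) /\
   nonneg (pt D j j' (corner_u D k l) (corner_v D k l / s)) <->
   curve_lo i j' k l <= s <= curve_hi i' j k l).
Proof.
move=> [ii' jj' _ [u0 v0] _] s0.
have key h : (corner_v D k l / s * beta D h 0 <= corner_u D k l * delta D h 0) =
    (dual_slope h k l <= s).
  rewrite /dual_slope ler_pdivrMr ?(mulr_gt0 u0 (slope_gt0 h))// /slope.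
  rewrite mulrAC ler_pdivrMr// (_ : s * _ = corner_u D k l * delta D h 0 * s / beta D h 0).
    by rewrite ler_pdivlMr.
  by ring.
have key' h : (corner_u D k l * delta D h 0 <= corner_v D k l / s * beta D h 0) =
    (s <= dual_slope h k l).
  rewrite /dual_slope ler_pdivlMr ?(mulr_gt0 u0 (slope_gt0 h))// /slope.
  rewrite [X in _ <= X]mulrAC ler_pdivlMr//.
  rewrite (_ : s * _ = corner_u D k l * delta D h 0 * s / beta D h 0).
    by rewrite ler_pdivrMr.
  by ring.
rewrite !nonneg_pt// key key' !mul1r /curve_lo /curve_hi ge_max le_min.
rewrite (_ : (slope i <= s) = (delta D i 0 <= s * beta D i 0)); last exact: ler_pdivrMr.
rewrite (_ : (s <= slope i') = (s * beta D i' 0 <= delta D i' 0)); last exact: ler_pdivlMr.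
by split=> [[[-> ->] [-> ->]]|/andP[/andP[-> ->] /andP[-> ->]]].
Qed.

Lemma curve_lo_gt0 i j' k l : 0 < curve_lo i j' k l.
Proof. by rewrite lt_max slope_gt0. Qed.

End Ranges.

(** * Generators of the feasible set *)

Section Hull.
Variables (R : realType) (m n : nat) (D : data R m n).
Hypothesis alpha_ge0 : forall k, 0 <= alpha D k.
Hypothesis gamma_ge0 : forall k, 0 <= gamma D k.
Hypothesis beta_gt0 : forall i, 0 < beta D i 0.
Hypothesis delta_gt0 : forall i, 0 < delta D i 0.

Lemma load_of_pt k i i' j j' p q p' q' : cross D i i' != 0 -> cross D j j' != 0 ->
  load_of D k (pt D i i' p q) (pt D j j' p' q') =
  alpha D k * (p * p') + gamma D k * (q * q').
Proof. by move=> c c'; rewrite /load_of !dot_beta_pt// !dot_delta_pt. Qed.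

Lemma curve_calU i i' j j' k l s : valid D i i' j j' k l ->
  curve_lo D i j' k l <= s <= curve_hi D i' j k l ->
  calU D (curve D i i' j j' k l s).
Proof.
move=> V sP; have s0 : 0 < s.
  by case/andP: sP => + _; apply: lt_le_trans; apply: curve_lo_gt0.
have [x0 y0] := proj2 (valid_range beta_gt0 delta_gt0 V s0) sP.
case: V => ii' jj' _ _ P; apply/calU_pair; eexists; eexists; split; first by [].
split=> // h; rewrite load_of_pt ?gt_eqF// mul1r [s * _]mulrC divfK ?gt_eqF//.
Qed.

Hypothesis nondegenerate : exists k, 0 < alpha D k \/ 0 < gamma D k.

(** An induction principle for convex predicates, applied to membership in [arc_hull] and to an
    upper bound on a linear objective. *)
Lemma calU_sub (H : 'M[R]_n -> Prop) :
  (forall X Y t, 0 <= t <= 1 -> H X -> H Y -> H (t *: X + (1 - t) *: Y)) ->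
  H 0 ->
  (forall i j k, 0 < Amx D k i j ->
     calU D ((rhs D k / Amx D k i j) *: delta_mx i j) ->
     H ((rhs D k / Amx D k i j) *: delta_mx i j)) ->
  (forall i i' j j' k l s, valid D i i' j j' k l ->
     curve_lo D i j' k l <= s <= curve_hi D i' j k l ->
     H (curve D i i' j j' k l s)) ->
  forall W, calU D W -> H W.
Proof.
move=> Hc H0 HA HC W /calU_pair[x [y [-> fxy]]].
apply: (absorbing_feasible alpha_ge0 gamma_ge0 beta_gt0 delta_gt0 nondegenerate
  (G := fun x y => H (x *m y^T)) _ fxy).
move=> {x y fxy}; split.
- move=> x x' y t t01 h h'; rewrite mulmxDl -!scalemxAl; exact: Hc.
- move=> x y y' t t01 h h'; rewrite linearD/= !linearZ/= mulmxDr -!scalemxAr; exact: Hc.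
- by move=> y; rewrite mul0mx.
- by move=> x; rewrite trmx0 mulmx0.
- move=> c d i j k x y c0 d0 fxy kt kp.
  have A0 : Amx D k i j = load_of D k (delta_mx i 0) (delta_mx j 0).
    by rewrite /load_of !dot_delta !mxE !big_ord1 !mxE; ring.
  have xyE : x *m y^T = (rhs D k / Amx D k i j) *: delta_mx i j.
    rewrite /x /y linearZ/= -scalemxAl -scalemxAr scalerA trmx_delta mul_delta_mx.
    congr (_ *: _); rewrite A0 -kt /x /y load_ofZl load_ofZr; field.
    by rewrite gt_eqF.
  rewrite xyE; apply: HA; first by rewrite A0.
  by rewrite -xyE; apply/calU_pair; exists x, y.
- move=> x y i i' j j' k l [x0 y0 xy] xn yn [ii' xE] [jj' yE] kt lt kl.
  have ux := dot_gt0 beta_gt0 x0 xn; have vx := dot_gt0 delta_gt0 x0 xn.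
  have uy := dot_gt0 beta_gt0 y0 yn; have vy := dot_gt0 delta_gt0 y0 yn.
  have [eu ev] := corner_unique kl kt lt.
  set p := dot (beta D) x in ux eu xE *; set q := dot (delta D) x in vx ev xE *.
  set p' := dot (beta D) y in uy eu yE *; set q' := dot (delta D) y in vy ev yE *.
  (* The parameter is the ratio of the two products of [x]; the factor [p] moves from [x] to [y]. *)
  have s0 : 0 < q / p by rewrite divr_gt0.
  have xE' : x = p *: pt D i i' 1 (q / p).
    by rewrite -pt_scale mulr1 mulrC divfK ?gt_eqF// -xE.
  have yE' : pt D j j' (corner_u D k l) (corner_v D k l / (q / p)) = p *: y.
    by rewrite -eu -ev [in RHS]yE -pt_scale; congr pt; field; rewrite ?gt_eqF.
  have V : valid D i i' j j' k l.
    split=> //; first by rewrite -eu -ev !mulr_gt0.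
    by move=> h; have := xy h; rewrite /load_of -/p -/q -/p' -/q' eu ev.
  have -> : x *m y^T = curve D i i' j j' k l (q / p).
    by rewrite /curve yE' linearZ/= -scalemxAr scalemxAl -xE'.
  apply: HC => //; apply/(valid_range beta_gt0 delta_gt0 V s0); split.
    have -> : pt D i i' 1 (q / p) = p^-1 *: x.
      by rewrite xE' scalerA mulVf ?scale1r// gt_eqF.
    by move=> h; rewrite mxE mulr_ge0// invr_ge0 ltW.
  by rewrite yE' => h; rewrite mxE mulr_ge0// ltW.
Qed.

End Hull.

(** * Consequences of the assumptions on the data *)

Section Admissible.
Import numFieldNormedType.Exports.
Variables (R : realType) (m n : nat) (D : data R m n).

Lemma calU0 : (forall k, 0 <= rhs D k) -> calU D 0.
Proof.
move=> b0; apply/calU_pair; exists 0, 0; split; first by rewrite mul0mx.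
split=> [i|i|k]; rewrite ?mxE//.
by rewrite /load_of /dot !big1 ?mulr0 ?addr0// => i _; rewrite mxE mulr0.
Qed.

Lemma Amx_ge0 : admissible D -> forall k i j, 0 <= Amx D k i j.
Proof.
move=> [ag b0 d0 _] k i j; have [a0 g0] := ag k.
by rewrite !mxE !big_ord1 !mxE addr_ge0// mulr_ge0// mulr_ge0// ltW.
Qed.

Lemma calU_empty k : admissible D -> rhs D k < 0 -> calU D = set0.
Proof.
move=> aD bk; apply/seteqP; split=> // W [W0 /(_ k) Wk _].
have := le_lt_trans Wk bk; rewrite ltNge sumr_ge0// => i _.
by rewrite sumr_ge0// => j _; rewrite mulr_ge0// Amx_ge0.
Qed.

Lemma admissible_nondegenerate : (0 < n)%N -> (forall k, 0 <= rhs D k) -> admissible D ->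
  exists k, 0 < alpha D k \/ 0 < gamma D k.
Proof.
move=> n0 b0 [ag b1 d1 bnd]; apply: contrapT => /forallNP nk.
have z k : alpha D k = 0 /\ gamma D k = 0.
  have [a0 g0] := ag k; have /not_orP[na ng] := nk k.
  by split; apply/eqP; rewrite eq_le ?a0 ?g0 leNgt andbT; apply/negP.
pose E : 'M[R]_n := delta_mx (Ordinal n0) (Ordinal n0).
have En : 0 < `|E|.
  rewrite normr_gt0; apply/eqP => /matrixP/(_ (Ordinal n0) (Ordinal n0))/eqP.
  by rewrite !mxE !eqxx oner_eq0.
have [M M0 MP] := pinfty_ex_gt0 bnd.
(* If all the [A^k] vanish, every nonnegative multiple of [E] is feasible; this one has norm
   [M + 1]. *)
pose c := (M + 1) / `|E|.
have c0 : 0 <= c by rewrite divr_ge0 ?addr_ge0 ?ltW.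
have /MP : calU D (c *: E).
  split=> [i j|k|].
  - by rewrite !mxE mulr_ge0// ler0n.
  - rewrite (_ : Amx D k = 0); last by rewrite /Amx !(proj1 (z k), proj2 (z k)) !scale0r addr0.
    by rewrite /inner big1// => i _; rewrite big1// => j _; rewrite mxE mul0r.
  - by rewrite (leq_trans (mxrank_scale _ _))// mxrank_delta.
rewrite /= normrZ ger0_norm// /c divfK ?gt_eqF//.
by rewrite gerDl ler10.
Qed.

End Admissible.

(** * Second-order cone representability *)

Section SOC.
Variable R : realType.

(** The square of the right side exceeds the radicand by [4 * (s * t - l ^+ 2)]; a nonnegative sum
    and a nonnegative product make [s] and [t] nonnegative. *)
Lemma rotated_cone (s t l : R) :
  (Num.sqrt ((2 * l) ^+ 2 + (s - t) ^+ 2) <= s + t) <->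
  [/\ 0 <= s, 0 <= t & l ^+ 2 <= s * t].
Proof.
have n0 : 0 <= (2 * l) ^+ 2 + (s - t) ^+ 2 by rewrite addr_ge0 ?sqr_ge0.
split=> [h|[s0 t0 st]]; last first.
  rewrite -(ler_pXn2r (n := 2)) ?nnegrE ?sqrtr_ge0 ?addr_ge0// sqr_sqrtr//.
  by rewrite -subr_ge0 (_ : _ - _ = 4 * (s * t - l ^+ 2)) ?mulr_ge0 ?subr_ge0//; ring.
have st0 : 0 <= s + t by apply: le_trans h; exact: sqrtr_ge0.
have : (2 * l) ^+ 2 + (s - t) ^+ 2 <= (s + t) ^+ 2.
  by rewrite -(sqr_sqrtr n0) ler_pXn2r// nnegrE ?sqrtr_ge0.
rewrite -subr_ge0 (_ : _ - _ = 4 * (s * t - l ^+ 2)); last by ring.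
rewrite pmulr_rge0// subr_ge0 => st.
have stp : 0 <= s * t by apply: le_trans st; exact: sqr_ge0.
split=> //.
  have [//|s0] := leP 0 s; have t0 : 0 < t by rewrite -(ltrD2l s) addr0 (lt_le_trans s0).
  by move: stp; rewrite leNgt pmulr_llt0// s0.
have [//|t0] := leP 0 t; have s0 : 0 < s by rewrite -(ltrD2r t) add0r (lt_le_trans t0).
by move: stp; rewrite leNgt pmulr_rlt0// t0.
Qed.

(** A normal form with variables, inequalities and cones indexed by arbitrary finite types, so that
    the passage to matrices over ordinals is made once. *)
Lemma SOCr_rotated (N : nat) (T H K : finType) (a : H -> 'I_N -> R)
    (c : H -> T -> R) (g : H -> R) (s t l : K -> T) :
  SOCr [set x : 'cV[R]_N | exists y : T -> R,
    (forall h, \sum_i a h i * x i 0 + \sum_u c h u * y u <= g h) /\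
    (forall k, [/\ 0 <= y (s k), 0 <= y (t k) & y (l k) ^+ 2 <= y (s k) * y (t k)])].
Proof.
pose F : 'M[R]_(#|H|, N + #|T|) := row_mx (\matrix_(h, i) a (enum_val h) i)
  (\matrix_(h, u) c (enum_val h) (enum_val u)).
pose G : 'cV[R]_#|H| := \col_h g (enum_val h).
pose dl (k : T) (u : 'I_#|T|) : R := (enum_val u == k)%:R.
pose B (k : 'I_#|K|) : 'M[R]_(2, N + #|T|) := row_mx 0
  (\matrix_(r, u) if r == 0 then 2 * dl (l (enum_val k)) u
                  else dl (s (enum_val k)) u - dl (t (enum_val k)) u).
pose d (k : 'I_#|K|) : 'cV[R]_(N + #|T|) := col_mx 0
  (\col_u (dl (s (enum_val k)) u + dl (t (enum_val k)) u)).
exists #|T|, #|H|, #|K|, F, G, (fun k => SocConstraint (B k) 0 (d k) 0).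
have Fx x (y : 'cV[R]_#|T|) h : (F *m col_mx x y) (enum_rank h) 0 =
    \sum_i a h i * x i 0 + \sum_u c h u * y (enum_rank u) 0.
  rewrite mul_row_col !mxE; congr (_ + _).
    by apply: eq_bigr => i _; rewrite mxE enum_rankK.
  rewrite [RHS](reindex (@enum_val T predT)) /=; last by apply: onW_bij; exact: enum_val_bij.
  by apply: eq_bigr => u _; rewrite mxE enum_rankK enum_valK.
have dlE k (y : 'cV[R]_#|T|) : \sum_u dl k u * y u 0 = y (enum_rank k) 0.
  rewrite (bigD1 (enum_rank k))//= big1 ?addr0 /dl ?enum_rankK ?eqxx ?mul1r//.
  by move=> u uk; rewrite -(inj_eq enum_rank_inj) enum_valK (negPf uk) mul0r.
have Kx x (y : 'cV[R]_#|T|) k :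
    soc_holds (SocConstraint (B k) 0 (d k) 0) (col_mx x y) <->
    let e h := y (enum_rank h) 0 in let k := enum_val k in
    [/\ 0 <= e (s k), 0 <= e (t k) & e (l k) ^+ 2 <= e (s k) * e (t k)].
  rewrite /soc_holds /= addr0 /norm2 big_ord_recl big_ord1.
  rewrite !mul_row_col !mul0mx !add0r !addr0 tr_col_mx trmx0 mul_row_col mul0mx add0r.
  rewrite !mxE.
  rewrite (eq_bigr (fun u => 2 * (dl (l (enum_val k)) u * y u 0))); last first.
    by move=> u _; rewrite mxE /= mulrA.
  rewrite -mulr_sumr dlE.
  rewrite (eq_bigr (fun u => dl (s (enum_val k)) u * y u 0 - dl (t (enum_val k)) u * y u 0)); last first.
    by move=> u _; rewrite mxE /= mulrBl.
  rewrite sumrB !dlE.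
  rewrite (eq_bigr (fun u => dl (s (enum_val k)) u * y u 0 + dl (t (enum_val k)) u * y u 0)); last first.
    by move=> u _; rewrite !mxE /= mulrDl.
  rewrite big_split/= !dlE; exact: rotated_cone.
apply/seteqP; split=> x /=.
  move=> [y [Hy Ky]]; exists (\col_u y (enum_val u)); split=> [h|k].
    rewrite -(enum_valK h) Fx mxE enum_rankK.
    by under [X in _ + X]eq_bigr do rewrite mxE enum_rankK; exact: Hy.
  by apply/Kx; rewrite /= !mxE !enum_rankK; exact: Ky.
move=> [y [Hy Ky]]; exists (fun u => y (enum_rank u) 0); split=> [h|k].
  by have := Hy (enum_rank h); rewrite Fx mxE enum_rankK.
by have /Kx := Ky (enum_rank k); rewrite /= enum_rankK.
Qed.

Lemma SOCr0 (N : nat) : SOCr (set0 : set 'cV[R]_N).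
Proof.
exists 0%N, 1%N, 0%N, 0, (-1), (fun _ => SocConstraint (0 : 'M[R]_(0, N + 0)) 0 0 0).
apply/seteqP; split=> // x [y [/(_ 0)]].
by rewrite mul0mx !mxE/= oppr_ge0 ler10.
Qed.

End SOC.

(** * The convex hull of finitely many arcs *)

Section ArcHull.
Variables (R : realType) (J : finType) (lo hi : J -> R).
Hypothesis lo_gt0 : forall j, 0 < lo j.
Hypothesis lo_hi : forall j, lo j <= hi j.

(* The cone over the convex hull of [{(s, 1 / s) | lo <= s <= hi}]: the
   hyperbola bounds it from below and the chord from above. *)
Definition arc_cone (j : J) (s l t : R) : Prop :=
  [/\ 0 <= s, 0 <= t, 0 <= l, l ^+ 2 <= s * t &
      lo j * hi j * t + s <= (lo j + hi j) * l].

Lemma arc_coneD j s l t s' l' t' : arc_cone j s l t -> arc_cone j s' l' t' ->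
  arc_cone j (s + s') (l + l') (t + t').
Proof.
move=> [s0 t0 l0 st c] [s0' t0' l0' st' c']; split; rewrite ?addr_ge0//; last first.
  by rewrite mulrDr addrACA [X in _ <= X]mulrDr lerD.
(* The cross terms are compared by the inequality of arithmetic and geometric means, applied to
   [s * t'] and [s' * t]. *)
suff h : 2 * (l * l') <= s * t' + s' * t.
  rewrite (_ : (l + l') ^+ 2 = l ^+ 2 + l' ^+ 2 + 2 * (l * l')); last by ring.
  rewrite (_ : (s + s') * (t + t') = s * t + s' * t' + (s * t' + s' * t)); last by ring.
  by rewrite !lerD.
rewrite -(ler_pXn2r (n := 2)) ?nnegrE ?addr_ge0 ?mulr_ge0//.
apply: (@le_trans _ _ (4 * ((s * t) * (s' * t')))).
  rewrite (_ : (2 * (l * l')) ^+ 2 = 4 * (l ^+ 2 * l' ^+ 2)); last by ring.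
  by rewrite ler_pM2l// ler_pM// sqr_ge0.
rewrite -subr_ge0 (_ : _ - _ = (s * t' - s' * t) ^+ 2) ?sqr_ge0//; ring.
Qed.

Lemma arc_coneZ j c s l t : 0 <= c -> arc_cone j s l t ->
  arc_cone j (c * s) (c * l) (c * t).
Proof.
move=> c0 [s0 t0 l0 st h]; split; rewrite ?mulr_ge0//.
  rewrite exprMn (_ : c * s * (c * t) = c ^+ 2 * (s * t)); last by ring.
  by rewrite ler_wpM2l// sqr_ge0.
rewrite (_ : _ + _ = c * (lo j * hi j * t + s)); last by ring.
by rewrite (mulrCA _ c) ler_wpM2l.
Qed.

Lemma arc_cone0 j : arc_cone j 0 0 0.
Proof. by split=> //; rewrite ?expr0n ?mulr0 ?addr0. Qed.

Lemma arc_cone_arc j s : lo j <= s <= hi j -> arc_cone j s 1 s^-1.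
Proof.
move=> /andP[ls sh]; have s0 : 0 < s by apply: lt_le_trans ls.
split; rewrite ?invr_ge0 ?(ltW s0) ?expr1n ?divff ?gt_eqF//.
rewrite mulr1 -subr_ge0 (_ : _ - _ = (s - lo j) * (hi j - s) / s).
  by rewrite divr_ge0 ?mulr_ge0 ?subr_ge0 ?(ltW s0).
by field; rewrite gt_eqF.
Qed.

Section Span.
Variable V : lmodType R.
Variables P Q S : J -> V.

(** The perspective formula for the hull of a union: [l j] is the weight of the arc [j], while [s j]
    and [t j] are that weight times averages of the parameter and of its inverse. *)
Definition arc_hull : set V := [set x | exists s l t : J -> R,
  [/\ forall j, arc_cone j (s j) (l j) (t j), \sum_j l j = 1 &
      x = \sum_j (s j *: P j + l j *: Q j + t j *: S j)]].

Lemma arc_hull_convex x y c : 0 <= c <= 1 -> arc_hull x -> arc_hull y ->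
  arc_hull (c *: x + (1 - c) *: y).
Proof.
move=> /andP[c0 c1] [s [l [t [st l1 ->]]]] [s' [l' [t' [st' l1' ->]]]].
exists (fun j => c * s j + (1 - c) * s' j), (fun j => c * l j + (1 - c) * l' j),
  (fun j => c * t j + (1 - c) * t' j); split.
- by move=> j; apply: arc_coneD; apply: arc_coneZ; rewrite ?subr_ge0.
- by rewrite big_split/= -!mulr_sumr l1 l1' !mulr1 addrC subrK.
- rewrite !scaler_sumr -big_split/=; apply: eq_bigr => j _.
  rewrite !scalerDr !scalerA !scalerDl.
  by rewrite [RHS](AC (2*2*2) (1*3*5*(2*4*6)))/=.
Qed.

Lemma arc_hull_arc j s : lo j <= s <= hi j ->
  arc_hull (s *: P j + Q j + s^-1 *: S j).
Proof.
move=> sj; exists (fun i => if i == j then s else 0),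
  (fun i => if i == j then 1 else 0), (fun i => if i == j then s^-1 else 0).
split.
- by move=> i; case: eqP => [->|_]; [exact: arc_cone_arc|exact: arc_cone0].
- by rewrite -big_mkcond/= big_pred1_eq.
- rewrite (bigD1 j)//= !eqxx scale1r big1 ?addr0// => i /negPf ->.
  by rewrite !scale0r !addr0.
Qed.

Variable H : V -> Prop.
Hypothesis convH : forall x y c, 0 <= c <= 1 -> H x -> H y -> H (c *: x + (1 - c) *: y).

(** [H] is required only at positive weights, since the points used in [arc_hull_sub] are quotients
    by [l j]. *)
Lemma convex_sum (r : seq J) (l : J -> R) (z : J -> V) :
  (forall j, 0 <= l j) -> (forall j, 0 < l j -> H (z j)) ->
  0 < \sum_(j <- r) l j -> H ((\sum_(j <- r) l j)^-1 *: \sum_(j <- r) l j *: z j).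
Proof.
move=> l0 Hz; elim: r => [|j r IH]; first by rewrite big_nil ltxx.
rewrite !big_cons; set L := \sum_(i <- r) l i in IH *; set Z := \sum_(i <- r) _ in IH *.
have L0 : 0 <= L by apply: sumr_ge0.
have [lj|lj] := eqVneq (l j) 0; first by rewrite lj scale0r !add0r.
have lj0 : 0 < l j by rewrite lt_neqAle eq_sym lj l0.
have [LE|Ln] := eqVneq L 0.
  have -> : Z = 0.
    rewrite /Z big_seq big1// => i ir; rewrite (_ : l i = 0) ?scale0r//.
    by move/eqP: LE; rewrite psumr_eq0// => /allP/(_ _ ir)/eqP.
  by move=> _; rewrite LE !addr0 scalerA mulVf// scale1r; exact: Hz.
have L0' : 0 < L by rewrite lt_neqAle eq_sym Ln.
move=> sL; have -> : (l j + L)^-1 *: (l j *: z j + Z) =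
    (l j / (l j + L)) *: z j + (1 - l j / (l j + L)) *: (L^-1 *: Z).
  rewrite scalerDr !scalerA; congr (_ *: _ + _ *: _); first by rewrite mulrC.
  by field; rewrite !gt_eqF.
apply: convH; last exact: IH.
  by rewrite divr_ge0 ?l0 ?(ltW sL)//= ler_pdivrMr// mul1r lerDl.
exact: Hz.
Qed.

(** After division by its weight, each term lies vertically between the hyperbola and the chord, and
    the chord joins the two ends of the arc. *)
Lemma arc_hull_sub : (forall j s, lo j <= s <= hi j ->
    H (s *: P j + Q j + s^-1 *: S j)) -> forall x, arc_hull x -> H x.
Proof.
move=> Harc x [s [l [t [st l1 ->]]]].
pose z j := (s j / l j) *: P j + Q j + (t j / l j) *: S j.
have -> : \sum_j (s j *: P j + l j *: Q j + t j *: S j) =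
    (\sum_j l j)^-1 *: \sum_j l j *: z j.
  rewrite l1 invr1 scale1r; apply: eq_bigr => j _.
  have [s0 t0 l0 stl ch] := st j.
  have [lj|lj] := eqVneq (l j) 0; last first.
    by rewrite /z !scalerDr !scalerA ![l j * _]mulrC !divfK.
  (* At weight 0 the chord inequality forces [s j] and [t j] to vanish. *)
  move: ch; rewrite lj !scale0r mulr0 => ch.
  have lh : 0 < lo j * hi j by rewrite mulr_gt0// (lt_le_trans (lo_gt0 j)).
  have lt0 : 0 <= lo j * hi j * t j by rewrite mulr_ge0// ltW.
  have -> : s j = 0 by apply/eqP; rewrite eq_le s0 andbT (le_trans _ ch)// lerDr.
  have /eqP : lo j * hi j * t j = 0.
    by apply/eqP; rewrite eq_le lt0 andbT (le_trans _ ch)// lerDl.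
  by rewrite mulf_eq0 gt_eqF//= => /eqP ->; rewrite !scale0r !addr0.
apply: convex_sum; [by move=> j; have [] := st j| |by rewrite l1].
move=> j l0; have [s0 t0 _ stl ch] := st j.
rewrite /z; set a := s j / l j; set b := t j / l j.
have ab1 : 1 <= a * b.
  rewrite /a /b (_ : _ * _ = s j * t j / l j ^+ 2); last by field; rewrite gt_eqF.
  by rewrite ler_pdivlMr ?exprn_gt0// mul1r.
have ch' : lo j * hi j * b + a <= lo j + hi j.
  by rewrite /a /b mulrA -mulrDl ler_pdivrMr.
have h0 : 0 < hi j by apply: lt_le_trans (lo_hi j).
have a0 : 0 < a.
  rewrite lt_neqAle divr_ge0 ?(ltW l0)// andbT eq_sym.
  by apply: contraTneq ab1 => ->; rewrite mul0r ler10.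
have b1 : a^-1 <= b by rewrite -div1r ler_pdivrMr// mulrC.
have aP : lo j <= a <= hi j.
  (* The chord is above the hyperbola only between the ends of the arc. *)
  have : (a - lo j) * (a - hi j) <= 0.
    rewrite (_ : _ * _ = a * (lo j * hi j * a^-1 + a - (lo j + hi j))).
      rewrite pmulr_rle0// subr_le0 (le_trans _ ch')// lerD2r ler_pM2l//.
      by rewrite mulr_gt0.
    by field; rewrite gt_eqF.
  have := lo_hi j; nra.
(* The height of the chord over [a]. *)
pose c := (lo j + hi j - a) / (lo j * hi j).
have bc : b <= c by rewrite /c ler_pdivlMr ?mulr_gt0// lerBrDr mulrC.
have chord : H (a *: P j + Q j + c *: S j).
  have [e|ne] := eqVneq (lo j) (hi j).
    have -> : c = a^-1.
      have ea : a = lo j by apply/eqP; rewrite eq_le andbC; move: aP; rewrite -e.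
      by rewrite /c ea -e; field; rewrite gt_eqF.
    exact: Harc.
  have d0 : 0 < hi j - lo j by rewrite subr_gt0 lt_neqAle ne lo_hi.
  pose w := (hi j - a) / (hi j - lo j).
  have -> : a *: P j + Q j + c *: S j =
      w *: (lo j *: P j + Q j + (lo j)^-1 *: S j) +
      (1 - w) *: (hi j *: P j + Q j + (hi j)^-1 *: S j).
    rewrite !scalerDr !scalerA [RHS](AC (3*3) ((1*4)*(2*5)*(3*6)))/= -!scalerDl.
    congr (_ *: _ + _ + _ *: _).
    - by rewrite /w; field; rewrite gt_eqF.
    - by rewrite addrC subrK scale1r.
    - rewrite /c /w; field; rewrite ?gt_eqF//.
  case/andP: aP => la ah.
  apply: convH; [|by apply: Harc; rewrite lexx lo_hi..].
  by rewrite divr_ge0 ?subr_ge0 ?lo_hi//= ler_pdivrMr// mul1r lerD2l lerN2.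
have [e|ne] := eqVneq c a^-1.
  have -> : b = c by apply/eqP; rewrite eq_le bc e b1.
  by [].
have d0 : 0 < c - a^-1 by rewrite subr_gt0 lt_neqAle eq_sym ne (le_trans b1).
pose w := (b - a^-1) / (c - a^-1).
have -> : a *: P j + Q j + b *: S j =
    w *: (a *: P j + Q j + c *: S j) + (1 - w) *: (a *: P j + Q j + a^-1 *: S j).
  rewrite !scalerDr !scalerA [RHS](AC (3*3) ((1*4)*(2*5)*(3*6)))/= -!scalerDl.
  congr (_ *: _ + _ + _ *: _).
  - by rewrite addrC subrK scale1r.
  - by rewrite addrC subrK scale1r.
  - suff {1}-> : b = w * (c - a^-1) + a^-1 by ring.
    by rewrite /w divfK ?gt_eqF// subrK.
apply: convH => //; last exact: Harc.
by rewrite divr_ge0 ?subr_ge0 ?(le_trans b1 bc)//= ler_pdivrMr// mul1r lerD2r.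
Qed.

End Span.

Lemma arc_hull_linear (V W : lmodType R) (f : {linear V -> W}) (P Q S : J -> V) :
  f @` arc_hull P Q S = arc_hull (f \o P) (f \o Q) (f \o S).
Proof.
have fE s l t : f (\sum_j (s j *: P j + l j *: Q j + t j *: S j)) =
    \sum_j (s j *: f (P j) + l j *: f (Q j) + t j *: f (S j)).
  by rewrite linear_sum; apply: eq_bigr => j _; rewrite !linearD !linearZ.
apply/seteqP; split=> [_ [x [s [l [t [st l1 ->]]]] <-]|x [s [l [t [st l1 ->]]]]].
  by exists s, l, t; split.
exists (\sum_j (s j *: P j + l j *: Q j + t j *: S j)); last by rewrite fE.
by exists s, l, t; split.
Qed.

Lemma SOCr_arc_hull (N : nat) (P Q S : J -> 'cV[R]_N) : SOCr (arc_hull P Q S).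
Proof.
(* Each equation, for a coordinate or for the sum of the weights, becomes two inequalities of
   opposite signs [sg b]; the other rows are the chords and the signs of the weights. *)
pose sg (b : bool) : R := if b then 1 else -1.
pose a (h : 'I_N * bool + bool + J + J) (i : 'I_N) : R :=
  match h with inl (inl (inl (k, b))) => sg b * (i == k)%:R | _ => 0 end.
pose c (h : 'I_N * bool + bool + J + J) (u : J + J + J) : R :=
  match h with
  | inl (inl (inl (i, b))) => - sg b * match u with
      | inl (inl j) => P j i 0 | inl (inr j) => Q j i 0 | inr j => S j i 0 end
  | inl (inl (inr b)) => match u with inl (inr j) => sg b | _ => 0 end
  | inl (inr i) => match u with
      | inl (inl j) => (j == i)%:R | inl (inr j) => - (lo i + hi i) * (j == i)%:R
      | inr j => lo i * hi i * (j == i)%:R end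
  | inr i => match u with inl (inr j) => - (j == i)%:R | _ => 0 end
  end.
pose g (h : 'I_N * bool + bool + J + J) : R :=
  match h with inl (inl (inr b)) => sg b | _ => 0 end.
suff -> : arc_hull P Q S = [set x : 'cV[R]_N | exists y : (J + J + J)%type -> R,
    (forall h, \sum_i a h i * x i 0 + \sum_u c h u * y u <= g h) /\
    (forall k : J, [/\ 0 <= y (inl (inl k)), 0 <= y (inr k) &
       y (inl (inr k)) ^+ 2 <= y (inl (inl k)) * y (inr k)])].
  exact: SOCr_rotated.
pose row h (x : 'cV[R]_N) y := \sum_i a h i * x i 0 + \sum_u c h u * y u.
have rowE h x y : row h x y = \sum_i a h i * x i 0 +
    (\sum_j c h (inl (inl j)) * y (inl (inl j)) +
     \sum_j c h (inl (inr j)) * y (inl (inr j)) + \sum_j c h (inr j) * y (inr j)).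
  by rewrite /row big_sumType/= big_sumType.
have pick (z : 'I_N) (x : 'cV[R]_N) k : \sum_i k * (i == z)%:R * x i 0 = k * x z 0.
  rewrite (bigD1 z)//= eqxx mulr1 big1 ?addr0// => i /negPf ->.
  by rewrite mulr0 mul0r.
have pickJ (z : J) (y : J -> R) k : \sum_j k * (j == z)%:R * y j = k * y z.
  rewrite (bigD1 z)//= eqxx mulr1 big1 ?addr0// => i /negPf ->.
  by rewrite mulr0 mul0r.
have z0 (I : finType) (f : I -> R) : \sum_i 0 * f i = 0.
  by rewrite big1// => i _; rewrite mul0r.
have row_eq i b x y : row (inl (inl (inl (i, b)))) x y = sg b * (x i 0 -
   \sum_j (y (inl (inl j)) * P j i 0 + y (inl (inr j)) * Q j i 0 + y (inr j) * S j i 0)).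
  rewrite rowE pick mulrBr; congr (_ + _).
  rewrite !big_split/= !mulrDr !opprD -!mulNr !mulr_sumr.
  by congr (_ + _ + _); apply: eq_bigr => j _; rewrite mulrAC mulrA.
have row_sum b x y : row (inl (inl (inr b))) x y = sg b * \sum_j y (inl (inr j)).
  by rewrite rowE /a /c /= !z0 !add0r addr0 mulr_sumr.
have pick1 z k (y : J + J + J -> R) : \sum_j k * (j == z)%:R * y (inr j) = k * y (inr z).
  exact: (pickJ z (fun j => y (inr j))).
have pick2 z k (y : J + J + J -> R) :
    \sum_j k * (j == z)%:R * y (inl (inr j)) = k * y (inl (inr z)).
  exact: (pickJ z (fun j => y (inl (inr j)))).
have pick3 z k (y : J + J + J -> R) :
    \sum_j k * (j == z)%:R * y (inl (inl j)) = k * y (inl (inl z)).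
  exact: (pickJ z (fun j => y (inl (inl j)))).
have row_chord i x y : row (inl (inr i)) x y = lo i * hi i * y (inr i) + y (inl (inl i))
    - (lo i + hi i) * y (inl (inr i)).
  rewrite rowE /a /c /= z0 add0r pick1 pick2.
  rewrite (eq_bigr (fun j => 1 * (j == i)%:R * y (inl (inl j)))).
    by rewrite pick3; ring.
  by move=> j _; rewrite mul1r.
have row_pos i x y : row (inr i) x y = - y (inl (inr i)).
  rewrite rowE /a /c /= !z0 !add0r addr0.
  rewrite (eq_bigr (fun j => -1 * (j == i)%:R * y (inl (inr j)))).
    by rewrite pick2 mulN1r.
  by move=> j _; rewrite mulN1r.
apply/seteqP; split=> x /=.
  move=> [s [l [t [st l1 xE]]]].
  exists (fun u => match u with inl (inl j) => s j | inl (inr j) => l j | inr j => t j end).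
  split; last by move=> j; have [] := st j.
  move=> h; rewrite -[X in X <= _]/(row h x _).
  case: h => [[[[i b]|b]|i]|i].
  - rewrite row_eq xE summxE (eq_bigr (fun j => s j * P j i 0 + l j * Q j i 0 + t j * S j i 0)).
      by rewrite subrr mulr0.
    by move=> j _; rewrite !mxE.
  - by rewrite row_sum l1 mulr1.
  - by rewrite row_chord subr_le0; have [] := st i.
  - by rewrite row_pos oppr_le0; have [] := st i.
move=> [y [Hy Ky]]; exists (fun j => y (inl (inl j))), (fun j => y (inl (inr j))), (fun j => y (inr j)).
have {}Hy h : row h x y <= g h by exact: Hy.
split.
- move=> j; have [s0 t0 st] := Ky j; split=> //.
    by have := Hy (inr j); rewrite row_pos oppr_le0.
  by have := Hy (inl (inr j)); rewrite row_chord subr_le0.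
- have := Hy (inl (inl (inr true))); have := Hy (inl (inl (inr false))).
  rewrite !row_sum /= !mul1r !mulN1r lerN2 => h1 h2.
  by apply/eqP; rewrite eq_le h1 h2.
- apply/matrixP => i j; rewrite ord1 summxE.
  rewrite (eq_bigr (fun j => y (inl (inl j)) * P j i 0 + y (inl (inr j)) * Q j i 0 + y (inr j) * S j i 0)); last first.
    by move=> j' _; rewrite !mxE.
  have := Hy (inl (inl (inl (i, true)))); have := Hy (inl (inl (inl (i, false)))).
  rewrite !row_eq /= !mul1r !mulN1r oppr_le0 subr_ge0 subr_le0 => h1 h2.
  by apply/eqP; rewrite eq_le h1 h2.
Qed.

End ArcHull.

(** * The convex hull of the feasible set *)

Section ConvHull.
Variables (R : realType) (V : lmodType R).

Lemma convex_setP (A : set V) : @convex_set R V A <->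
  (forall x y c, 0 <= c <= 1 -> A x -> A y -> A (c *: x + (1 - c) *: y)).
Proof.
split=> [cA x y c /andP[c0 c1] Ax Ay|cA x y c /set_mem Ax /set_mem Ay].
  by apply: set_mem; apply: (cA x y (Itv01 c0 c1)); exact: mem_set.
by apply: mem_set; apply: cA => //; apply/andP; split.
Qed.

Lemma conv_hull_convex (S : set V) x y c : 0 <= c <= 1 ->
  conv_hull S x -> conv_hull S y -> conv_hull S (c *: x + (1 - c) *: y).
Proof.
move=> c01 Sx Sy A [cA SA]; move/convex_setP: (cA) => h.
by apply: h => //; [apply: Sx|apply: Sy].
Qed.

End ConvHull.

Section Representation.
Variables (R : realType) (m n : nat) (D : data R m n).
Hypothesis beta_gt0 : forall i, 0 < beta D i 0.
Hypothesis delta_gt0 : forall i, 0 < delta D i 0.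
Hypothesis rhs_ge0 : forall k, 0 <= rhs D k.

Definition arc_index : finType :=
  (unit + 'I_n * 'I_n * 'I_m + 'I_n * 'I_n * ('I_n * 'I_n) * ('I_m * 'I_m))%type.

(* Invalid indices stand for the constant arc at the point 0. *)
Definition arc_ok (c : arc_index) : Prop :=
  match c with
  | inl (inl _) => True
  | inl (inr (i, j, k)) => calU D ((rhs D k / Amx D k i j) *: delta_mx i j)
  | inr (i, i', (j, j'), (k, l)) =>
      valid D i i' j j' k l /\ curve_lo D i j' k l <= curve_hi D i' j k l
  end.

Definition arc_lin (c : arc_index) : 'M[R]_n :=
  if `[< arc_ok c >] then
    if c is inr (i, i', (j, j'), (k, l)) then curve_lin D i i' j j' k l else 0
  else 0.

Definition arc_cst (c : arc_index) : 'M[R]_n :=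
  if `[< arc_ok c >] then
    match c with
    | inl (inl _) => 0
    | inl (inr (i, j, k)) => (rhs D k / Amx D k i j) *: delta_mx i j
    | inr (i, i', (j, j'), (k, l)) => curve_cst D i i' j j' k l
    end
  else 0.

Definition arc_inv (c : arc_index) : 'M[R]_n :=
  if `[< arc_ok c >] then
    if c is inr (i, i', (j, j'), (k, l)) then curve_inv D i i' j j' k l else 0
  else 0.

Definition arc_lo (c : arc_index) : R :=
  if `[< arc_ok c >] then
    if c is inr (i, i', (j, j'), (k, l)) then curve_lo D i j' k l else 1
  else 1.

Definition arc_hi (c : arc_index) : R :=
  if `[< arc_ok c >] then
    if c is inr (i, i', (j, j'), (k, l)) then curve_hi D i' j k l else 1
  else 1.

Lemma arc_lo_gt0 c : 0 < arc_lo c.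
Proof.
rewrite /arc_lo; case: asboolP => // _.
by case: c => // -[[[i i'] [j j']] [k l]]; exact: curve_lo_gt0.
Qed.

Lemma arc_lo_hi c : arc_lo c <= arc_hi c.
Proof.
rewrite /arc_lo /arc_hi; case: asboolP => // cP.
by case: c cP => // -[[[i i'] [j j']] [k l]] [].
Qed.

Lemma arc_calU c s : arc_lo c <= s <= arc_hi c ->
  calU D (s *: arc_lin c + arc_cst c + s^-1 *: arc_inv c).
Proof.
rewrite /arc_lo /arc_hi /arc_lin /arc_cst /arc_inv.
case: asboolP => cP; last by rewrite !scaler0 !addr0 => _; exact: calU0.
case: c cP => [[_|[[i j] k]]|[[[i i'] [j j']] [k l]]] /=.
- by rewrite !scaler0 !addr0 => _ _; exact: calU0.
- by rewrite !scaler0 add0r addr0.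
- move=> [V lh] sP; rewrite -curveE; first exact: curve_calU.
  by rewrite gt_eqF//; case/andP: sP => + _; apply: lt_le_trans; exact: curve_lo_gt0.
Qed.

Hypothesis alpha_ge0 : forall k, 0 <= alpha D k.
Hypothesis gamma_ge0 : forall k, 0 <= gamma D k.
Hypothesis nondegenerate : exists k, 0 < alpha D k \/ 0 < gamma D k.

Lemma conv_hull_calU :
  conv_hull (calU D) = arc_hull arc_lo arc_hi arc_lin arc_cst arc_inv.
Proof.
apply/seteqP; split; last first.
  move=> W; apply: arc_hull_sub.
  - exact: arc_lo_gt0.
  - exact: arc_lo_hi.
  - exact: conv_hull_convex.
  - by move=> c s sP; apply: sub_gen_smallest; exact: arc_calU.
apply: smallest_sub.
  apply/convex_setP => x y c; exact: arc_hull_convex.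
move=> W; apply: calU_sub => //.
- by move=> X Y t; exact: arc_hull_convex.
- have := @arc_hull_arc _ _ arc_lo arc_hi arc_lo_gt0 _ arc_lin arc_cst arc_inv (inl (inl tt)) 1.
  rewrite /arc_lo /arc_hi /arc_lin /arc_cst /arc_inv asboolT//= lexx !scaler0 !addr0.
  exact.
- move=> i j k A0 UW.
  have := @arc_hull_arc _ _ arc_lo arc_hi arc_lo_gt0 _ arc_lin arc_cst arc_inv (inl (inr (i, j, k))) 1.
  by rewrite /arc_lo /arc_hi /arc_lin /arc_cst /arc_inv asboolT//= lexx !scaler0 add0r addr0; exact.
- move=> i i' j j' k l s V sP; rewrite curveE; last first.
    by rewrite gt_eqF//; case/andP: sP => + _; apply: lt_le_trans; exact: curve_lo_gt0.
  have := @arc_hull_arc _ _ arc_lo arc_hi arc_lo_gt0 _ arc_lin arc_cst arc_inv (inr (i, i', (j, j'), (k, l))) s.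
  rewrite /arc_lo /arc_hi /arc_lin /arc_cst /arc_inv asboolT/=; first exact.
  by split=> //; case/andP: sP => h1 h2; apply: le_trans h2.
Qed.

End Representation.

Lemma SOCr_conv_calU (R : realType) (m n : nat) (D : data R m n) :
  (0 < n)%N -> admissible D -> SOCr (@vec R n @` conv_hull (calU D)).
Proof.
move=> n0 aD; have [ag b0 d0 _] := aD.
have [rhs_ge0|/existsNP[k /negP]] := pselect (forall k, 0 <= rhs D k); last first.
  rewrite -ltNge => bk; rewrite (calU_empty aD bk).
  rewrite (_ : conv_hull set0 = set0) ?image_set0; first exact: SOCr0.
  by apply/seteqP; split=> // x; apply; split=> //; apply/convex_setP.
have nd := admissible_nondegenerate n0 rhs_ge0 aD.
rewrite conv_hull_calU //; last first.
- by move=> k; have [] := ag k.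
- by move=> k; have [] := ag k.
rewrite (_ : vec (n := n) = (trmx \o mxvec : {linear 'M[R]_n -> 'cV[R]_(n * n)}))//.
rewrite arc_hull_linear; exact: SOCr_arc_hull.
Qed.

(** * Cost of expressions *)

Section Expressions.
Local Open Scope nat_scope.

Lemma bitlen_le (z : int) k : `|z|%N <= 2 ^ k -> bitlen z <= k.+1.
Proof.
move=> zk; rewrite /bitlen ltnS.
have [->|z0] := posnP `|z|%N; first by rewrite trunc_log0.
by rewrite -(leq_exp2l (m := 2))// (leq_trans _ zk)// trunc_logP.
Qed.

Lemma absz_lt_bitlen (z : int) : `|z|%N <= 2 ^ bitlen z.
Proof. by rewrite ltnW// /bitlen trunc_log_ltn. Qed.

Lemma absz_divz_le (x y : int) : `|(x %/ y)%Z|%N <= `|x|%N.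
Proof.
have [->|y0] := eqVneq y 0%R; first by rewrite divz0.
have h (a b : int) : (0 < b)%R -> `|(a %/ b)%Z|%N <= `|a|%N.
  move=> b0; have := divz_eq a b.
  have := modz_ge0 a (lt0r_neq0 b0); have := ltz_pmod a b0; nia.
have [yp|yn|ye] := ltgtP 0%R y; [exact: h| |by rewrite ye eqxx in y0].
by rewrite -[y]opprK divzN abszN h// oppr_gt0.
Qed.

(* A bound on both the logarithm and the cost of the value, relative to the
   logarithm of the cells. *)
Fixpoint expr_size (e : expr) : nat :=
  match e with
  | Cst z => `|z|%N.+1
  | Get _ i => (expr_size i).+1
  | Bin _ e1 e2 => (expr_size e1 + expr_size e2).+1
  end.

Definition bounded_by (L : nat) (s : state) := forall a i, `|s a i|%N <= 2 ^ L.

Lemma expr_size_gt0 e : 0 < expr_size e. Proof. by case: e. Qed.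

(** Products add exponents, sums need one more bit, and a quotient is no larger than its dividend;
    [L > 0] pays for the extra bit. *)
Lemma expr_val_le L s e : 0 < L -> bounded_by L s ->
  `|expr_val s e|%N <= 2 ^ (L * expr_size e).
Proof.
move=> L0 bs; elim: e => [z|a i _|o e1 h1 e2 h2] /=.
- by rewrite (@leq_trans (2 ^ `|z|%N)) ?(ltnW (ltn_expl _ _))// leq_exp2l//; nia.
- by rewrite (leq_trans (bs _ _))// leq_exp2l//; nia.
- have g1 := expr_size_gt0 e1; have g2 := expr_size_gt0 e2.
  have l1 : 2 ^ (L * expr_size e1) <= 2 ^ (L * (expr_size e1 + expr_size e2)).
    by rewrite leq_exp2l//; nia.
  have l2 : 2 ^ (L * expr_size e2) <= 2 ^ (L * (expr_size e1 + expr_size e2)).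
    by rewrite leq_exp2l//; nia.
  have l3 : 2 * 2 ^ (L * (expr_size e1 + expr_size e2)) <=
      2 ^ (L * (expr_size e1 + expr_size e2).+1).
    by rewrite -expnS leq_exp2l//; nia.
  case: o => /=.
  + by lia.
  + by lia.
  + rewrite abszM (leq_trans (leq_mul h1 h2))// -expnD -mulnDr leq_exp2l//; nia.
  + by rewrite (leq_trans (absz_divz_le _ _))//; lia.
Qed.

Lemma expr_cost_le L s e : 0 < L -> bounded_by L s ->
  expr_cost s e <= 2 * L * expr_size e ^ 2.
Proof.
move=> L0 bs; have vl e' := bitlen_le (expr_val_le e' L0 bs).
elim: e => [z|a i hi|o e1 h1 e2 h2].
- have := vl (Cst z); rewrite /= addn0; nia.
- have := bitlen_le (bs a `|expr_val s i|%N); rewrite /=; nia.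
- have := vl (Bin o e1 e2); rewrite /=; nia.
Qed.

End Expressions.

(** * Bounded loops over rational registers *)

Inductive nexp :=
  | NReg of nat
  | NSize
  | NCst of nat
  | NAdd of nexp & nexp
  | NMul of nexp & nexp.

Inductive qexp :=
  | QReg of nat
  | QIn of nexp
  | QCst of int
  | QEq of nexp & nexp
  | QAdd of qexp & qexp
  | QMul of qexp & qexp
  | QDiv of qexp & qexp.

(* [CFor true v c] runs [c] for [v] ranging over the size read from the input,
   [CFor false v c] for [v] ranging over [0, m). *)
Inductive cmd :=
  | CSkip
  | CNat of nat & nat
  | CRat of nat & qexp
  | CSqrt of nat & nat
  | CIf of qexp & cmd & cmd
  | CFor of bool & nat & cmd
  | COut of nexp & qexp
  | CSeq of cmd & cmd.

(** [out] is partial, so that correctness concerns only the positions already written. *)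
Record hstate := HState {
  nr : nat -> nat;
  qr : nat -> rat;
  out : nat -> option rat }.

Definition upd (T : Type) (f : nat -> T) (k : nat) (x : T) : nat -> T :=
  fun j => if j == k then x else f j.

Definition set_nr st v k := HState (upd (nr st) v k) (qr st) (out st).
Definition set_qr st r q := HState (nr st) (upd (qr st) r q) (out st).
Definition set_out st p q := HState (nr st) (qr st) (upd (out st) p (Some q)).

Definition floor_sqrt (q : rat) : nat := Nat.sqrt `|(Num.max 0 (Num.floor q))%R|%N.

Section Denotation.
Variables (m n : nat) (inp : nat -> rat).

Fixpoint neval (st : hstate) (e : nexp) : nat :=
  match e with
  | NReg v => nr st v
  | NSize => n
  | NCst k => k
  | NAdd a b => (neval st a + neval st b)%N
  | NMul a b => (neval st a * neval st b)%N
  end.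

Fixpoint qeval (st : hstate) (e : qexp) : rat :=
  match e with
  | QReg r => qr st r
  | QIn p => inp (neval st p)
  | QCst z => z%:~R
  | QEq a b => (neval st a == neval st b)%:R
  | QAdd a b => qeval st a + qeval st b
  | QMul a b => qeval st a * qeval st b
  | QDiv a b => qeval st a / qeval st b
  end.

Definition iterate (k v : nat) (f : hstate -> hstate) (st : hstate) : hstate :=
  foldl (fun st i => f (set_nr st v i)) st (iota 0 k).

Lemma iterateS k v f st :
  iterate k.+1 v f st = f (set_nr (iterate k v f st) v k).
Proof. by rewrite /iterate -addn1 iotaD foldl_cat. Qed.

Fixpoint denot (c : cmd) (st : hstate) : hstate :=
  match c with
  | CSkip => st
  | CNat v w => set_nr st v (nr st w)
  | CRat r e => set_qr st r (qeval st e)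
  | CSqrt r r' => set_qr st r (floor_sqrt (qr st r'))%:R
  | CIf e c1 c2 => if 0 < qeval st e then denot c1 st else denot c2 st
  | CFor b v c => iterate (if b then n else m) v (denot c) st
  | COut p e => set_out st (neval st p) (qeval st e)
  | CSeq c1 c2 => denot c2 (denot c1 st)
  end.

End Denotation.

(** * Compilation to the machine *)

Section Compilation.
Variable m : nat.

Local Notation cst k := (Cst (Posz k)).
Local Notation add := (Bin Add).
Local Notation mul := (Bin Mul).
Local Notation sub := (Bin Defs.Sub).

(** Memory layout: array 0 holds the input, 1 the output, 2 the index registers, 3 and 4 the
    numerators and denominators of the rational registers, 5 the loop counters; 7 and 8 are
    scratch. *)
Fixpoint comp_n (e : nexp) : expr :=
  match e with
  | NReg v => Get 2 (cst v)
  | NSize => Get 0 (cst 0)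
  | NCst k => cst k
  | NAdd a b => add (comp_n a) (comp_n b)
  | NMul a b => mul (comp_n a) (comp_n b)
  end.

(** The integer quotient of 1 by [1 + e * e] is 1 when [e] is 0, and 0 otherwise. *)
Definition is_zero (e : expr) : expr := Bin Div (cst 1) (add (cst 1) (mul e e)).

(* A rational is represented by a numerator and a nonnegative denominator; both
   are [0] in cells not yet written, so a denominator [0] is read as [1]. *)
Definition fix_den (e : expr) : expr := add e (is_zero e).

(** A quotient carries an extra factor [z] above and below: the denominator stays nonnegative, and
    division by 0 yields the pair 0, 0, corrected to 0 / 1 as in the field of rationals. *)
Fixpoint comp_q (e : qexp) : expr * expr :=
  match e with
  | QReg r => (Get 3 (cst r), fix_den (Get 4 (cst r)))
  | QIn p => (Get 0 (add (cst 1) (mul (cst 2) (comp_n p))),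
              fix_den (Get 0 (add (cst 2) (mul (cst 2) (comp_n p)))))
  | QCst z => (Cst z, cst 1)
  | QEq a b => (is_zero (sub (comp_n a) (comp_n b)), cst 1)
  | QAdd a b => let: (x, y) := comp_q a in let: (z, t) := comp_q b in
      (add (mul x t) (mul z y), mul y t)
  | QMul a b => let: (x, y) := comp_q a in let: (z, t) := comp_q b in
      (mul x z, mul y t)
  | QDiv a b => let: (x, y) := comp_q a in let: (z, t) := comp_q b in
      (mul x (mul z t), fix_den (mul y (mul z z)))
  end.

(* With the radicand in cell 0 of array 7: the least power of 2 exceeding the
   root is computed in cell 1, then the root bit by bit in cell 2. *)
Definition sqrt_prog : prog :=
  let N := Get 7 (cst 0) in let d := Get 7 (cst 1) in let x := Get 7 (cst 2) in
  let test y := sub (add N (cst 1)) (mul y y) in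
  Seq (Assign 7 (cst 1) (cst 1))
 (Seq (While (test d) (Assign 7 (cst 1) (mul (cst 2) d)))
 (Seq (Assign 7 (cst 2) (cst 0))
      (While d (Seq (If (test (add x d)) (Assign 7 (cst 2) (add x d)) Skip)
                    (Assign 7 (cst 1) (Bin Div d (cst 2))))))).

(* Array 5 holds the loop counters, indexed by nesting depth. *)
Fixpoint comp (depth : nat) (c : cmd) : prog :=
  match c with
  | CSkip => Skip
  | CNat v w => Assign 2 (cst v) (Get 2 (cst w))
  | CRat r e => let: (x, y) := comp_q e in
      Seq (Assign 8 (cst 0) x) (Seq (Assign 8 (cst 1) y)
     (Seq (Assign 3 (cst r) (Get 8 (cst 0))) (Assign 4 (cst r) (Get 8 (cst 1)))))
  | CSqrt r r' => let: (x, y) := comp_q (QReg r') in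
      Seq (Assign 7 (cst 0) (Bin Div x y))
     (Seq sqrt_prog
     (Seq (Assign 3 (cst r) (Get 7 (cst 2))) (Assign 4 (cst r) (cst 1))))
  | CIf e c1 c2 => If (comp_q e).1 (comp depth c1) (comp depth c2)
  | CFor b v c => let i := Get 5 (cst depth) in
      Seq (Assign 5 (cst depth) (cst 0))
     (While (sub (if b then Get 0 (cst 0) else cst m) i)
        (Seq (Assign 2 (cst v) i)
        (Seq (comp depth.+1 c) (Assign 5 (cst depth) (add i (cst 1))))))
  | COut p e => let: (x, y) := comp_q e in
      Seq (Assign 1 (add (cst 1) (mul (cst 2) (comp_n p))) x)
          (Assign 1 (add (cst 2) (mul (cst 2) (comp_n p))) y)
  | CSeq c1 c2 => Seq (comp depth c1) (comp depth c2)
  end.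

Variables (d : nat -> nat) (dmax : nat).

(** Numerator and denominator are at most [2 ^ (Z * degree e)]. The successor for sums pays for the
    carry, and the doubling for quotients pays for the extra factor in [comp_q]. *)
Fixpoint degree (e : qexp) : nat :=
  match e with
  | QReg r => d r
  | QIn _ => 1
  | QCst z => `|z|%N
  | QEq _ _ => 0
  | QAdd a b => (degree a + degree b).+1
  | QMul a b => degree a + degree b
  | QDiv a b => degree a + (degree b).*2
  end.

(** One degree per register must be valid at all times, so nothing can grow from one iteration to
    the next. The two spare units for [CSqrt] make room for the powers of 2 used by [sqrt_prog]. *)
Fixpoint degree_ok (c : cmd) : bool :=
  match c with
  | CSkip | CNat _ _ => true
  | CRat r e => (degree e <= d r)%N
  | CSqrt r r' => (d r' <= d r)%N && (d r' + 2 <= dmax)%N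
  | CIf _ c1 c2 | CSeq c1 c2 => degree_ok c1 && degree_ok c2
  | CFor _ _ c => degree_ok c
  | COut _ e => (degree e <= dmax)%N
  end.

Variables (n : nat) (inp : nat -> rat) (Z : nat).

Definition represents (q : rat) (a b : int) : Prop :=
  [/\ 0 <= b, (b = 0 -> a = 0) & q = a%:~R / b%:~R].

Definition small (k : nat) (a : int) := (`|a| <= 2 ^ (Z * k))%N.

Record simulates (st : hstate) (s : state) : Prop := Simulates {
  sim_size : s 0%N 0%N = n%:Z;
  sim_inp : forall p, [/\ represents (inp p) (s 0%N (1 + 2 * p)%N) (s 0%N (2 + 2 * p)%N),
     small 1 (s 0%N (1 + 2 * p)%N) & small 1 (s 0%N (2 + 2 * p)%N)];
  sim_nat : forall v, s 2%N v = (nr st v)%:Z;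
  sim_rat : forall r, [/\ represents (qr st r) (s 3%N r) (s 4%N r),
     small (d r) (s 3%N r) & small (d r) (s 4%N r)];
  sim_out : forall p q, out st p = Some q ->
     0 < s 1%N (2 + 2 * p)%N /\ q = (s 1%N (1 + 2 * p)%N)%:~R / (s 1%N (2 + 2 * p)%N)%:~R;
  sim_bound : bounded_by (Z * dmax) s }.

Lemma is_zeroE s e : expr_val s (is_zero e) = (expr_val s e == 0)%:R.
Proof.
rewrite /is_zero /=; set x := expr_val s e; have [->|x0] := eqVneq x 0.
  by rewrite mulr0 addr0 divzz.
by rewrite divz_small//; apply/andP; split=> //; nia.
Qed.

Lemma fix_den_val s e :
  expr_val s (fix_den e) = expr_val s e + (expr_val s e == 0)%:R.
Proof. by rewrite -is_zeroE. Qed.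

Lemma fix_denE s e q a : represents q a (expr_val s e) ->
  0 < expr_val s (fix_den e) /\ q = a%:~R / (expr_val s (fix_den e))%:~R.
Proof.
move=> [b0 ab ->]; rewrite fix_den_val.
have [be|bn] := eqVneq (expr_val s e) 0; last first.
  by rewrite addr0; split=> //; rewrite lt_neqAle eq_sym bn.
by rewrite (ab be) be add0r; split=> //; rewrite !mul0r.
Qed.

Lemma fix_den_small k s e : 0 <= expr_val s e -> small k (expr_val s e) ->
  small k (expr_val s (fix_den e)).
Proof.
rewrite /small fix_den_val.
have [-> _ _|_ _] := eqVneq (expr_val s e) 0; last by rewrite addr0.
by rewrite add0r expn_gt0.
Qed.

Lemma comp_nE st s e : simulates st s -> expr_val s (comp_n e) = (neval n st e)%:Z.
Proof.
move=> sim; elim: e => [v|//|//|a ha b hb|a ha b hb] /=.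
- exact: sim_nat.
- exact: (sim_size sim).
- by rewrite ha hb PoszD.
- by rewrite ha hb PoszM.
Qed.

Hypothesis Z_gt0 : (0 < Z)%N.

Lemma smallM j k a b : small j a -> small k b -> small (j + k) (a * b).
Proof.
by rewrite /small abszM mulnDr expnD => ha hb; apply: leq_mul.
Qed.

Lemma smallD k a b : small k a -> small k b -> small k.+1 (a + b).
Proof.
rewrite /small mulnS expnD => ha hb.
have : (2 ^ 1 <= 2 ^ Z)%N by rewrite leq_exp2l.
move: (2 ^ Z)%N (2 ^ (Z * k))%N ha hb => x y; nia.
Qed.

Lemma small_le j k a : (j <= k)%N -> small j a -> small k a.
Proof. by move=> jk /leq_trans; apply; rewrite leq_exp2l// leq_mul2l jk orbT. Qed.

Lemma comp_qE st s e : simulates st s ->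
  let: (x, y) := comp_q e in
  [/\ 0 < expr_val s y, qeval n inp st e = (expr_val s x)%:~R / (expr_val s y)%:~R,
      small (degree e) (expr_val s x) & small (degree e) (expr_val s y)].
Proof.
move=> sim; elim: e => [r|p|z|a b|a ha b hb|a ha b hb|a ha b hb].
- rewrite /comp_q; have [rep ha hb] := sim_rat sim r; have [b0 _ _] := rep.
  have [] := @fix_denE s (Get 4 (cst r)) _ _ rep; split=> //.
  exact: fix_den_small.
- rewrite /comp_q; have [rep ha hb] := sim_inp sim (neval n st p).
  set x := add (cst 1) _; set y := add (cst 2) _.
  have xE : `|expr_val s x|%N = (1 + 2 * neval n st p)%N.
    by rewrite /x /= (comp_nE _ sim) -PoszM -PoszD.
  have yE : `|expr_val s y|%N = (2 + 2 * neval n st p)%N.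
    by rewrite /y /= (comp_nE _ sim) -PoszM -PoszD.
  rewrite -xE -yE in rep ha hb; have [b0 _ _] := rep.
  have [] := @fix_denE s (Get 0 y) _ _ rep; split=> //.
  exact: fix_den_small.
- split=> //=; first by rewrite divr1.
    by rewrite /small (leq_trans (ltnW (ltn_expl `|z|%N (isT : (1 < 2)%N))))// leq_exp2l//= leq_pmull.
  by rewrite /small expn_gt0.
- rewrite /comp_q; split=> //; rewrite ?is_zeroE /= ?(comp_nE _ sim).
  + by rewrite subr_eq0 eqz_nat divr1; case: eqP.
  + by rewrite /small; case: eqP => _; rewrite ?expn_gt0.
  + by rewrite /small expn_gt0.
- rewrite /=; case: (comp_q a) ha => x y [y0 -> sx sy].
  case: (comp_q b) hb => z t [t0 -> sz st'] /=; split.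
  + exact: mulr_gt0.
  + rewrite rmorphD !rmorphM /=; field.
    by rewrite !intr_eq0 !gt_eqF.
  + by apply: smallD; [exact: smallM|rewrite addnC; exact: smallM].
  + by apply: (@small_le (degree a + degree b)) => //; exact: smallM.
- rewrite /=; case: (comp_q a) ha => x y [y0 -> sx sy].
  case: (comp_q b) hb => z t [t0 -> sz st'] /=; split.
  + exact: mulr_gt0.
  + by rewrite !rmorphM /= mulf_div.
  + exact: smallM.
  + exact: smallM.
- rewrite /=; case: (comp_q a) ha => x y [y0 -> sx sy].
  case: (comp_q b) hb => z t [t0 -> sz st'] /=.
  have rep : represents ((expr_val s x)%:~R / (expr_val s y)%:~R /
      ((expr_val s z)%:~R / (expr_val s t)%:~R)) (expr_val s (mul x (mul z t)))
      (expr_val s (mul y (mul z z))).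
    rewrite /=; have [z0|z0] := eqVneq (expr_val s z) 0.
      rewrite z0 !mul0r !mulr0; split=> //.
      by rewrite !mulr0z !mul0r invr0 mulr0.
    split.
    - by rewrite mulr_ge0 ?(ltW y0)//; nia.
    - by move/eqP; rewrite !mulf_eq0 (negPf z0) gt_eqF.
    - rewrite !rmorphM /=; field.
      by rewrite !intr_eq0 z0 !gt_eqF.
  have [b0 _ _] := rep; have [] := fix_denE rep; split=> //.
  + by rewrite /= -addnn; apply: smallM => //; exact: smallM.
  + apply: (fix_den_small b0); rewrite /= -addnn; apply: smallM => //; exact: smallM.
Qed.

End Compilation.

(** * Correctness and cost of the compiler *)

Section Execution.
Variables (d : nat -> nat) (dmax : nat).
Hypothesis d_le : forall r, (d r <= dmax)%N.

Lemma update_eq s a i z : update s a i z a i = z.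
Proof. by rewrite /update !eqxx. Qed.

Lemma update_neq s a i z b j : (b == a) && (j == i) = false -> update s a i z b j = s b j.
Proof. by rewrite /update => ->. Qed.

Lemma update_array s a i z b j : b != a -> update s a i z b j = s b j.
Proof. by move=> ba; rewrite update_neq// (negPf ba). Qed.

Lemma bounded_update L s a i z : bounded_by L s -> (`|z| <= 2 ^ L)%N ->
  bounded_by L (update s a i z).
Proof. by move=> bs zL b j; rewrite /update; case: ifP. Qed.

Lemma comp_n_ext s s' e : (forall a i, a \in [:: 0; 2; 3; 4]%N -> s a i = s' a i) ->
  expr_val s (comp_n e) = expr_val s' (comp_n e).
Proof.
by move=> ss; elim: e => [v|//|//|a ha b hb|a ha b hb] /=; rewrite ?ss// ha hb.
Qed.

Lemma is_zero_ext s s' e : expr_val s e = expr_val s' e ->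
  expr_val s (is_zero e) = expr_val s' (is_zero e).
Proof. by rewrite !is_zeroE => ->. Qed.

(** Compiled expressions read neither output nor scratch arrays, so a write there does not disturb a
    denominator still to be evaluated. *)
Lemma comp_q_ext s s' e : (forall a i, a \in [:: 0; 2; 3; 4]%N -> s a i = s' a i) ->
  expr_val s (comp_q e).1 = expr_val s' (comp_q e).1 /\
  expr_val s (comp_q e).2 = expr_val s' (comp_q e).2.
Proof.
move=> ss; elim: e => [r|p|z|a b|a ha b hb|a ha b hb|a ha b hb].
- by rewrite /= !ss.
- by rewrite !fix_den_val /= !(comp_n_ext _ ss) !ss.
- by [].
- by split=> //; apply: is_zero_ext; rewrite /= !(comp_n_ext _ ss).
- rewrite /=; case: (comp_q a) ha => x y [hx hy].
  by case: (comp_q b) hb => z t [hz ht] /=; rewrite /= in hx hy hz ht; rewrite hx hy hz ht.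
- rewrite /=; case: (comp_q a) ha => x y [hx hy].
  by case: (comp_q b) hb => z t [hz ht] /=; rewrite /= in hx hy hz ht; rewrite hx hy hz ht.
- rewrite /=; case: (comp_q a) ha => x y [hx hy].
  case: (comp_q b) hb => z t [hz ht]; rewrite !fix_den_val /= in hx hy hz ht *.
  by rewrite hx hy hz ht.
Qed.

Definition assign_cost (i e : expr) : nat :=
  (1 + 2 * dmax * (expr_size i ^ 2 + expr_size e ^ 2))%N.

Definition test_cost (e : expr) : nat := (1 + 2 * dmax * expr_size e ^ 2)%N.

Section Run.
Variables (n : nat) (inp : nat -> rat) (Z : nat).
Local Notation L := (Z * dmax)%N.
Local Notation sim := (simulates d dmax n inp Z).

Lemma sim_scratch st s a i z : sim st s -> (4 < a)%N -> (`|z| <= 2 ^ L)%N ->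
  sim st (update s a i z).
Proof.
move=> ss a4 zL; have e b j : (b <= 4)%N -> update s a i z b j = s b j.
  by move=> b4; rewrite update_array//; lia.
split.
- by rewrite e//; exact: (sim_size ss).
- by move=> p; rewrite !e//; exact: (sim_inp ss).
- by move=> v; rewrite e//; exact: (sim_nat ss).
- by move=> r; rewrite !e//; exact: (sim_rat ss).
- by move=> p q; rewrite !e//; exact: (sim_out ss).
- by apply: bounded_update => //; exact: (sim_bound ss).
Qed.

Lemma sim_set_nr st s v k : sim st s -> (k <= 2 ^ L)%N ->
  sim (set_nr st v k) (update s 2%N v k%:Z).
Proof.
move=> ss kL; have e b j : b != 2%N -> update s 2%N v k%:Z b j = s b j.
  by move=> b2; rewrite update_array.
split.
- by rewrite e//; exact: (sim_size ss).
- by move=> p; rewrite !e//; exact: (sim_inp ss).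
- move=> w; rewrite /update /set_nr /upd /=; case: eqP => // _; exact: (sim_nat ss).
- by move=> r; rewrite !e//; exact: (sim_rat ss).
- by move=> p q; rewrite !e//; exact: (sim_out ss).
- by apply: bounded_update => //; exact: (sim_bound ss).
Qed.

Lemma sim_set_qr st s r q x y : sim st s -> 0 < y -> q = x%:~R / y%:~R ->
  small Z (d r) x -> small Z (d r) y ->
  sim (set_qr st r q) (update (update s 3%N r x) 4 r y).
Proof.
move=> ss y0 qE sx sy.
have e b j : b != 3%N -> b != 4%N -> update (update s 3%N r x) 4 r y b j = s b j.
  by move=> b3 b4; rewrite !update_array.
have bd z : small Z (d r) z -> (`|z| <= 2 ^ L)%N.
  by move=> /leq_trans; apply; rewrite leq_exp2l// leq_mul2l d_le orbT.
split.
- by rewrite e//; exact: (sim_size ss).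
- by move=> p; rewrite !e//; exact: (sim_inp ss).
- by move=> w; rewrite e//; exact: (sim_nat ss).
- move=> r'; rewrite /update /set_qr /upd /=.
  case: eqP => [->|_]; last exact: (sim_rat ss).
  by split=> //; split=> //; [exact: ltW|move=> y00; rewrite y00 ltxx in y0].
- by move=> p q'; rewrite !e//; exact: (sim_out ss).
- apply: bounded_update; last exact: bd.
  by apply: bounded_update; [exact: (sim_bound ss)|exact: bd].
Qed.

Lemma sim_set_out st s p q x y : sim st s -> 0 < y -> q = x%:~R / y%:~R ->
  (`|x| <= 2 ^ L)%N -> (`|y| <= 2 ^ L)%N ->
  sim (set_out st p q) (update (update s 1%N (1 + 2 * p)%N x) 1 (2 + 2 * p)%N y).
Proof.
move=> ss y0 qE sx sy; set s' := update _ _ _ _.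
have e b j : b != 1%N -> s' b j = s b j by move=> b1; rewrite /s' !update_array.
split.
- by rewrite e//; exact: (sim_size ss).
- by move=> p'; rewrite !e//; exact: (sim_inp ss).
- by move=> w; rewrite e//; exact: (sim_nat ss).
- by move=> r; rewrite !e//; exact: (sim_rat ss).
- move=> p' q'; rewrite /set_out /upd /s' /update /=.
  rewrite (_ : (1 + 2 * p' == 2 + 2 * p)%N = false); last by apply/eqP; lia.
  rewrite (_ : (2 + 2 * p' == 1 + 2 * p)%N = false); last by apply/eqP; lia.
  rewrite eqn_add2l eqn_pmul2l// eqn_add2l eqn_pmul2l//.
  by case: eqP => [_ [<-]//|_]; exact: (sim_out ss).
- by do 2?[apply: bounded_update => //]; exact: (sim_bound ss).
Qed.

Hypotheses (dmax_gt0 : (0 < dmax)%N) (Z_gt0 : (0 < Z)%N).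

Lemma L_gt0 : (0 < L)%N. Proof. by rewrite muln_gt0 Z_gt0. Qed.

Lemma exec_assign a i e s : bounded_by L s ->
  exists2 t, exec (Assign a i e) s t (update s a `|expr_val s i|%N (expr_val s e)) &
    (t <= assign_cost i e * Z)%N.
Proof.
move=> bs; eexists; first exact: ExAssign.
have := expr_cost_le i L_gt0 bs; have := expr_cost_le e L_gt0 bs.
by rewrite /assign_cost; nia.
Qed.

Lemma test_cost_le e s : bounded_by L s -> (1 + expr_cost s e <= test_cost e * Z)%N.
Proof.
by move=> bs; have := expr_cost_le e L_gt0 bs; rewrite /test_cost; nia.
Qed.

End Run.
End Execution.

Lemma nat_sqrt_unique (M x : nat) : (x * x <= M < (x.+1) * (x.+1))%N -> Nat.sqrt M = x.
Proof. by move=> h; apply: PeanoNat.Nat.sqrt_unique; lia. Qed.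

(** * Integer square roots *)

Section Sqrt.
Variables (dmax Z k : nat).
Hypotheses (Z_gt0 : (0 < Z)%N) (dmax_gt0 : (0 < dmax)%N) (k_le : (k + 2 <= dmax)%N).

Local Notation L := (Z * dmax)%N.
Local Notation cst k := (Cst (Posz k)).
Local Notation add := (Bin Add).
Local Notation mul := (Bin Mul).
Local Notation sub := (Bin Defs.Sub).
Local Notation N := (Get 7 (cst 0)).
Local Notation r := (Get 7 (cst 1)).
Local Notation x := (Get 7 (cst 2)).
Local Notation test y := (sub (add N (cst 1)) (mul y y)).

Let double_cost := (test_cost dmax (test r) + assign_cost dmax (cst 1) (mul (cst 2) r))%N.

(** [f] bounds the doublings left: the radicand is below [2 ^ (j + f)], and the loop stops once it
    is below the square of the current power. *)
Lemma exec_doubling f j s : bounded_by L s -> s 7%N 1%N = (2 ^ j)%N%:Z ->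
  s 7%N 0%N < (2 ^ (j + f))%N%:Z -> (j + f <= L)%N ->
  exists t s' j', [/\ exec (While (test r) (Assign 7 (cst 1) (mul (cst 2) r))) s t s',
    (t <= f.+1 * (double_cost * Z))%N, bounded_by L s', (j' <= j + f)%N &
    [/\ s' 7%N 1%N = (2 ^ j')%N%:Z, s 7%N 0%N < (2 ^ j' * 2 ^ j')%N%:Z &
        forall a i, a != 7%N \/ i != 1%N -> s' a i = s a i]].
Proof.
elim: f j s => [|f IH] j s bs sj Nj jL; have p0 : (0 < 2 ^ j)%N by rewrite expn_gt0.
  have := test_cost_le dmax_gt0 Z_gt0 (test r) bs => tc.
  exists (1 + expr_cost s (test r))%N, s, j; split=> //.
  - by apply: ExWhileF; rewrite /= sj; move: Nj p0; rewrite addn0; move: (2 ^ j)%N; nia.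
  - by rewrite mul1n /double_cost; nia.
  - by rewrite addn0.
  - by split=> //; move: Nj p0; rewrite addn0; move: (2 ^ j)%N; nia.
have tc := test_cost_le dmax_gt0 Z_gt0 (test r) bs.
have [pos|neg] := ltP 0 (expr_val s (test r)); last first.
  exists (1 + expr_cost s (test r))%N, s, j; split=> //.
  - exact: ExWhileF.
  - by rewrite /double_cost; nia.
  - by rewrite leq_addr.
  - by split=> //; move: neg; rewrite /= sj; lia.
have [t1 e1 t1c] := exec_assign dmax_gt0 Z_gt0 7 (cst 1) (mul (cst 2) r) bs.
rewrite /= sj in e1.
set s1 := update _ _ _ _ in e1.
have s1E : s1 7%N 1%N = (2 ^ j.+1)%N%:Z by rewrite /s1 update_eq expnS PoszM.
have s10 a i : a != 7%N \/ i != 1%N -> s1 a i = s a i.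
  by move=> ai; rewrite /s1 update_neq//; case: ai => /negPf ->; rewrite ?andbF.
have bs1 : bounded_by L s1.
  apply: bounded_update => //; rewrite -PoszM -expnS /= leq_exp2l//; lia.
have [||t [s' [j' [ex tc' bs' jj' [s'j N' s'E]]]]] := IH j.+1 s1 bs1 s1E.
- by rewrite s10 ?addSnnS//; right.
- by rewrite addSnnS.
exists (1 + expr_cost s (test r) + t1 + t)%N, s', j'; split=> //.
- exact: (ExWhileT pos e1 ex).
- by move: tc' tc t1c; rewrite /double_cost mulSn; nia.
- by rewrite -addSnnS.
- by split=> // a i ai; rewrite s'E// s10.
Qed.

Let body := Seq (If (test (add x r)) (Assign 7 (cst 2) (add x r)) Skip)
                (Assign 7 (cst 1) (Bin Div r (cst 2))).
Let body_cost := (test_cost dmax r + test_cost dmax (test (add x r)) +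
  assign_cost dmax (cst 2) (add x r) + assign_cost dmax (cst 1) (Bin Div r (cst 2)) + 1)%N.

(** The root lies in [[y, y + 2 ^ j)] and cell 1 holds half that length, the next bit to test; at
    [j = 0] this is 0, which ends the loop. *)
Lemma exec_bits j s (y M : nat) : bounded_by L s -> s 7%N 1%N = ((2 ^ j)%N./2)%:Z ->
  s 7%N 2%N = y%:Z -> M%:Z = Num.max 0 (s 7%N 0%N) -> (y * y <= M < (y + 2 ^ j) * (y + 2 ^ j))%N ->
  (y + 2 ^ j <= 2 ^ L)%N ->
  exists t s', [/\ exec (While r body) s t s', (t <= j.+1 * (body_cost * Z))%N,
    bounded_by L s', s' 7%N 2%N = (Nat.sqrt M)%:Z &
    forall a i, a != 7%N -> s' a i = s a i].
Proof.
elim: j s y => [|j IH] s y bs sr sx ME yM yL.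
  have tc := test_cost_le dmax_gt0 Z_gt0 r bs.
  exists (1 + expr_cost s r)%N, s; split=> //.
  - by apply: ExWhileF; rewrite /= sr.
  - by rewrite /body_cost; nia.
  - by rewrite sx (nat_sqrt_unique (x := y))//; move: yM; rewrite addn1.
have hj : ((2 ^ j.+1)./2 = 2 ^ j)%N by rewrite expnS mul2n doubleK.
rewrite hj in sr; have p0 : (0 < 2 ^ j)%N by rewrite expn_gt0.
have pos : 0 < expr_val s r by rewrite /= sr.
have tc := test_cost_le dmax_gt0 Z_gt0 r bs.
have tc2 := test_cost_le dmax_gt0 Z_gt0 (test (add x r)) bs.
have pL : (2 ^ j.+1 = 2 * 2 ^ j)%N by rewrite expnS.
have [t1 [s1 [y1 [e1 t1c bs1 [s1x y1M s1E]]]]] : exists t1 s1 y1,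
    [/\ exec (If (test (add x r)) (Assign 7 (cst 2) (add x r)) Skip) s t1 s1,
     (t1 <= (test_cost dmax (test (add x r)) + assign_cost dmax (cst 2) (add x r) + 1) * Z)%N,
     bounded_by L s1 & [/\ s1 7%N 2%N = y1%:Z,
       (y1 * y1 <= M < (y1 + 2 ^ j) * (y1 + 2 ^ j))%N /\ (y1 + 2 ^ j <= y + 2 ^ j.+1)%N &
       forall a i, a != 7%N \/ i != 2%N -> s1 a i = s a i]].
  have [tp|tn] := ltP 0 (expr_val s (test (add x r))).
    have [t e tcc] := exec_assign dmax_gt0 Z_gt0 7 (cst 2) (add x r) bs.
    eexists; eexists; exists (y + 2 ^ j)%N; split; first exact: (ExIfT _ tp e).
    - by nia.
    - apply: bounded_update => //=; rewrite sx sr; lia.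
    - rewrite update_eq /= sx sr; split=> //.
        move: tp; rewrite /= sx sr; split; first by nia.
        by lia.
      by move=> a i ai; rewrite update_neq//; case: ai => /negPf ->; rewrite ?andbF.
  eexists; exists s, y; split; first exact: (ExIfF _ tn (ExSkip _)).
  - by nia.
  - by [].
  - split=> //; split; last by lia.
    by move: tn; rewrite /= sx sr; nia.
have [t2 e2 t2c] := exec_assign dmax_gt0 Z_gt0 7 (cst 1) (Bin Div r (cst 2)) bs1.
rewrite /= s1E in e2; last by right.
rewrite sr in e2; set s2 := update _ _ _ _ in e2.
have s2E a i : a != 7%N \/ i != 1%N -> s2 a i = s1 a i.
  by move=> ai; rewrite /s2 update_neq//; case: ai => /negPf ->; rewrite ?andbF.
have s2r : s2 7%N 1%N = ((2 ^ j)%N./2)%:Z.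
  by rewrite /s2 update_eq -divn2 divz_nat.
have bs2 : bounded_by L s2.
  apply: bounded_update => //; rewrite (leq_trans (absz_divz_le _ _))//=; lia.
have [||||t3 [s3 [e3 t3c bs3 s3x s3E]]] := IH s2 y1 bs2 s2r.
- by rewrite s2E//; right.
- by rewrite s2E ?s1E//; right.
- by case: y1M.
- by case: y1M => _ /leq_trans; apply.
exists (1 + expr_cost s r + (t1 + t2) + t3)%N, s3; split=> //.
- exact: (ExWhileT pos (ExSeq e1 e2) e3).
- by move: t3c t2c t1c tc; rewrite /body_cost mulSn; nia.
- by move=> a i a7; rewrite s3E// s2E ?s1E//; left.
Qed.

Definition sqrt_cost : nat :=
  (assign_cost dmax (cst 1) (cst 1) + assign_cost dmax (cst 2) (cst 0) +
   (2 * dmax + 4) * (double_cost + body_cost))%N.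

Lemma exec_sqrt s : bounded_by L s -> (`|s 7%N 0%N| <= 2 ^ (Z * k))%N ->
  exists t s', [/\ exec sqrt_prog s t s', (t <= sqrt_cost * Z ^ 2)%N, bounded_by L s',
    s' 7%N 2%N = (Nat.sqrt `|(Num.max 0 (s 7%N 0%N))%R|%N)%:Z &
    forall a i, a != 7%N -> s' a i = s a i].
Proof.
move=> bs sN.
have [t1 e1 t1c] := exec_assign dmax_gt0 Z_gt0 7 (cst 1) (cst 1) bs.
rewrite /= in e1; set s1 := update _ _ _ _ in e1.
have bs1 : bounded_by L s1 by apply: bounded_update => //=; rewrite expn_gt0.
have s1N : s1 7%N 0%N = s 7%N 0%N by [].
have [//|||t2 [s2 [j [e2 t2c bs2 jL [s2r s2N s2E]]]]] :=
    @exec_doubling (Z * k).+1 0 s1 bs1 _.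
- rewrite s1N add0n expnS; have := expn_gt0 2 (Z * k)%N; lia.
- by nia.
have [t3 e3 t3c] := exec_assign dmax_gt0 Z_gt0 7 (cst 2) (cst 0) bs2.
rewrite /= in e3; set s3 := update _ _ _ _ in e3.
have bs3 : bounded_by L s3 by apply: bounded_update.
have s30 : s3 7%N 0%N = s 7%N 0%N.
  by rewrite /s3 update_neq// s2E//; right.
have ME : `|(Num.max 0 (s 7%N 0%N))%R|%N%:Z = Num.max 0 (s3 7%N 0%N).
  by rewrite s30 gez0_abs// le_max lexx.
have jL1 : (j.+1 <= L)%N by nia.
(* The exponent is [j.+1] because cell 1, which holds [2 ^ j], must be half the length of the
   interval. *)
have [||||t4 [s4 [e4 t4c bs4 s4x s4E]]] := @exec_bits j.+1 s3 0%N _ bs3 _ _ ME.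
- by rewrite /s3 update_neq// s2r expnS mul2n doubleK.
- by rewrite /s3 update_eq.
- have := expn_gt0 2 j; rewrite expnS add0n mul0n leq0n /=.
  by move: s2N; rewrite s1N; move: (2 ^ j)%N => p; nia.
- by rewrite add0n leq_exp2l.
exists (t1 + (t2 + (t3 + t4)))%N, s4; split=> //.
- exact: (ExSeq e1 (ExSeq e2 (ExSeq e3 e4))).
- have h2 : (t2 <= (dmax + 2) * (double_cost * Z ^ 2))%N.
    by apply: (leq_trans t2c); rewrite -mulnn; nia.
  have h4 : (t4 <= (dmax + 2) * (body_cost * Z ^ 2))%N.
    by apply: (leq_trans t4c); rewrite -mulnn; nia.
  have hZ : (Z <= Z ^ 2)%N by rewrite -mulnn leq_pmulr.
  by rewrite /sqrt_cost; nia.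
- move=> a i a7; rewrite s4E// /s3 update_array// s2E; last by left.
  by rewrite /s1 update_array.
Qed.

End Sqrt.

Lemma floor_ratio (a b : int) : 0 < b -> Num.floor (a%:~R / b%:~R : rat) = (a %/ b)%Z.
Proof.
move=> b0; apply: floor_def; have b0' : (0 : rat) < b%:~R by rewrite ltr0z.
rewrite ler_pdivlMr// ltr_pdivrMr// -!intrM ler_int ltr_int.
have := divz_eq a b; have := modz_ge0 a (lt0r_neq0 b0); have := ltz_pmod a b0.
by rewrite !mulrDl; lia.
Qed.

Lemma poly_cost2 (K1 E1 K2 E2 Z : nat) : (0 < Z)%N ->
  (K1 * Z ^ E1 + K2 * Z ^ E2 <= (K1 + K2) * Z ^ (E1 + E2))%N.
Proof.
move=> Z0; rewrite mulnDl leq_add// leq_mul2l leq_pexp2l ?orbT//.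
  exact: leq_addr.
exact: leq_addl.
Qed.

Lemma cost2 (t1 t2 a1 a2 Z : nat) : (t1 <= a1 * Z -> t2 <= a2 * Z ->
  t1 + t2 <= (a1 + a2) * Z)%N.
Proof. by move=> h1 h2; rewrite mulnDl leq_add. Qed.

Lemma cost4 (t1 t2 t3 t4 a1 a2 a3 a4 Z : nat) :
  (t1 <= a1 * Z -> t2 <= a2 * Z -> t3 <= a3 * Z -> t4 <= a4 * Z ->
  t1 + (t2 + (t3 + t4)) <= (a1 + a2 + a3 + a4) * Z)%N.
Proof. by move=> h1 h2 h3 h4; rewrite !addnA !cost2. Qed.

(** * Compilation of commands *)

Section Compiler.
Variables (m : nat) (d : nat -> nat) (dmax : nat).
Hypothesis d_le : forall r, (d r <= dmax)%N.
Hypothesis dmax_gt0 : (0 < dmax)%N.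

(** [K] and [E] are fixed before the instance, while [Z] dominates the lengths of the input numbers
    and both loop bounds. The last clause protects the counters of the enclosing loops. *)
Definition compiles (depth : nat) (c : cmd) : Prop :=
  exists K E, forall n inp Z st s, (0 < Z)%N -> (n <= Z)%N -> (m <= Z)%N ->
    simulates d dmax n inp Z st s ->
    exists t s', [/\ exec (comp m depth c) s t s', (t <= K * Z ^ E)%N,
      simulates d dmax n inp Z (denot m n inp c st) s' &
      forall i, (i < depth)%N -> s' 5%N i = s 5%N i].

Lemma leL Z : (0 < Z)%N -> (Z <= 2 ^ (Z * dmax))%N.
Proof.
move=> Z0; apply: (leq_trans (ltnW (ltn_expl Z (isT : (1 < 2)%N)))).
by rewrite leq_exp2l// leq_pmulr.
Qed.

Lemma small_bound Z k a : (k <= dmax)%N -> small Z k a -> (`|a| <= 2 ^ (Z * dmax))%N.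
Proof. by move=> kd /leq_trans; apply; rewrite leq_exp2l// leq_mul2l kd orbT. Qed.

(** Both parts pass through array 8 because [r] may occur in [e]: the denominator has to be
    evaluated before the numerator of [r] is overwritten. *)
Lemma compiles_rat depth r e : (degree d e <= d r)%N -> compiles depth (CRat r e).
Proof.
move=> de; rewrite /compiles /=; case cE : (comp_q e) => [x y].
pose C i f := assign_cost dmax i f.
exists (C (Cst 0%N%:Z) x + C (Cst 1%N%:Z) y + C (Cst r%:Z) (Get 8 (Cst 0%N%:Z))
  + C (Cst r%:Z) (Get 8 (Cst 1%N%:Z)))%N, 1%N.
move=> n inp Z st s Z0 nZ mZ ss.
have := comp_qE Z0 e ss; rewrite cE => -[y0 qE sx sy].
have dd : (degree d e <= dmax)%N by apply: leq_trans (d_le r).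
have [t1 e1 c1] := exec_assign dmax_gt0 Z0 8 (Cst 0%N%:Z) x (sim_bound ss).
set s1 := update _ _ _ _ in e1.
have ss1 : simulates d dmax n inp Z st s1.
  by apply: sim_scratch => //; exact: small_bound sx.
have yE : expr_val s1 y = expr_val s y.
  have [] := @comp_q_ext s1 s e _; last by rewrite cE.
  by move=> a i a4; rewrite /s1 update_array//; move: a4; rewrite !inE; lia.
have [t2 e2 c2] := exec_assign dmax_gt0 Z0 8 (Cst 1%N%:Z) y (sim_bound ss1).
rewrite yE in e2; set s2 := update _ _ _ _ in e2.
have ss2 : simulates d dmax n inp Z st s2.
  by apply: sim_scratch => //; exact: small_bound sy.
have [t3 e3 c3] := exec_assign dmax_gt0 Z0 3 (Cst r%:Z) (Get 8 (Cst 0%N%:Z)) (sim_bound ss2).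
rewrite /= (_ : s2 8 0%N = expr_val s x) in e3; last by [].
set s3 := update _ _ _ _ in e3.
have bs3 : bounded_by (Z * dmax) s3.
  by apply: bounded_update; [exact: (sim_bound ss2)|exact: small_bound sx].
have [t4 e4 c4] := exec_assign dmax_gt0 Z0 4 (Cst r%:Z) (Get 8 (Cst 1%N%:Z)) bs3.
rewrite /= (_ : s3 8 1%N = expr_val s y) in e4; last by [].
eexists; eexists; split.
- exact: (ExSeq e1 (ExSeq e2 (ExSeq e3 e4))).
- by rewrite expn1; exact: cost4.
- by apply: sim_set_qr => //; apply: small_le de _.
- by [].
Qed.

Lemma compiles_sqrt depth r r' : (d r' <= d r)%N -> (d r' + 2 <= dmax)%N ->
  compiles depth (CSqrt r r').
Proof.
move=> dr dm; rewrite /compiles /=.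
set x := Get 3 _; set y := fix_den _.
exists (assign_cost dmax (Cst 0%N%:Z) (Bin Div x y) + sqrt_cost dmax +
  (assign_cost dmax (Cst r%:Z) (Get 7 (Cst 2%N%:Z)) +
   assign_cost dmax (Cst r%:Z) (Cst 1%N%:Z)))%N, 2%N.
move=> n inp Z st s Z0 nZ mZ ss.
have [y0 qE sx sy] : [/\ 0 < expr_val s y, qr st r' = (expr_val s x)%:~R / (expr_val s y)%:~R,
      small Z (d r') (expr_val s x) & small Z (d r') (expr_val s y)].
  exact: (comp_qE Z0 (QReg r') ss).
have [t1 e1 c1] := exec_assign dmax_gt0 Z0 7 (Cst 0%N%:Z) (Bin Div x y) (sim_bound ss).
rewrite [expr_val s (Bin _ _ _)]/= -(floor_ratio (expr_val s x) y0) -qE in e1.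
set q := Num.floor _ in e1.
have sq : small Z (d r') q.
  by rewrite /q qE floor_ratio// /small (leq_trans (absz_divz_le _ _)).
set s1 := update _ _ _ _ in e1.
have ss1 : simulates d dmax n inp Z st s1.
  by apply: sim_scratch => //; exact: small_bound sq.
have [//|t2 [s2 [e2 c2 bs2 s2x s2E]]] :=
  @exec_sqrt dmax Z (d r') Z0 dmax_gt0 dm s1 (sim_bound ss1) _.
rewrite (_ : s1 7%N 0%N = q) in s2x; last by [].
have [t3 e3 c3] := exec_assign dmax_gt0 Z0 3 (Cst r%:Z) (Get 7 (Cst 2%N%:Z)) bs2.
rewrite /= s2x in e3; set s3 := update _ _ _ _ in e3.
have sz : small Z (d r) (floor_sqrt (qr st r'))%:Z.
  apply: small_le dr _; rewrite /small /floor_sqrt -/q /=.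
  apply: leq_trans sq; set M := `|_|%N; have : (M <= `|q|%N)%N by rewrite /M; lia.
  by apply: leq_trans; have := PeanoNat.Nat.sqrt_le_lin M; lia.
have ss2 : simulates d dmax n inp Z st s2.
  have e b j : (b <= 4)%N -> s2 b j = s b j.
    by move=> b4; rewrite s2E ?/s1 ?update_array//; lia.
  split=> //; case: (ss) => h1 h2 h3 h4 h5 _.
  - by rewrite e.
  - by move=> p; rewrite !e.
  - by move=> v; rewrite e.
  - by move=> p; rewrite !e.
  - by move=> p q'; rewrite !e//; exact: h5.
have bs3 : bounded_by (Z * dmax) s3.
  by apply: bounded_update => //; exact: small_bound sz.
have [t4 e4 c4] := exec_assign dmax_gt0 Z0 4 (Cst r%:Z) (Cst 1%N%:Z) bs3.
eexists; eexists; split.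
- exact: (ExSeq e1 (ExSeq e2 (ExSeq e3 e4))).
- have hZ : (Z <= Z ^ 2)%N by rewrite -mulnn leq_pmulr.
  by move: c1 c2 c3 c4; nia.
- apply: sim_set_qr => //; first by rewrite divr1.
  by rewrite /small expn_gt0.
- by move=> i _; rewrite update_array// /s3 update_array// s2E.
Qed.

Lemma compiles_out depth p e : (degree d e <= dmax)%N -> compiles depth (COut p e).
Proof.
move=> de; rewrite /compiles /=; case cE : (comp_q e) => [x y].
set i1 := Bin Add (Cst 1) _; set i2 := Bin Add (Cst 2) _.
exists (assign_cost dmax i1 x + assign_cost dmax i2 y)%N, 1%N.
move=> n inp Z st s Z0 nZ mZ ss.
have := comp_qE Z0 e ss; rewrite cE => -[y0 qE sx sy].
have i1E : `|expr_val s i1|%N = (1 + 2 * neval n st p)%N.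
  by rewrite /i1 /= (comp_nE _ ss) -PoszM -PoszD.
have [t1 e1 c1] := exec_assign dmax_gt0 Z0 1 i1 x (sim_bound ss).
rewrite i1E in e1; set s1 := update _ _ _ _ in e1.
have bs1 : bounded_by (Z * dmax) s1.
  by apply: bounded_update; [exact: (sim_bound ss)|exact: small_bound sx].
have ext a i : a \in [:: 0; 2; 3; 4]%N -> s1 a i = s a i.
  by move=> a4; rewrite /s1 update_array//; move: a4; rewrite !inE; lia.
have yE : expr_val s1 y = expr_val s y.
  by have [] := @comp_q_ext s1 s e ext; rewrite cE.
have i2E : `|expr_val s1 i2|%N = (2 + 2 * neval n st p)%N.
  by rewrite /i2 /= (comp_n_ext _ ext) (comp_nE _ ss) -PoszM -PoszD.
have [t2 e2 c2] := exec_assign dmax_gt0 Z0 1 i2 y bs1.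
rewrite yE i2E in e2.
eexists; eexists; split.
- exact: (ExSeq e1 e2).
- by rewrite expn1; exact: cost2.
- by apply: sim_set_out => //; [exact: small_bound sx|exact: small_bound sy].
- by [].
Qed.

Lemma compiles_if depth e c1 c2 : compiles depth c1 -> compiles depth c2 ->
  compiles depth (CIf e c1 c2).
Proof.
move=> [K1 [E1 H1]] [K2 [E2 H2]].
exists (test_cost dmax (comp_q e).1 + (K1 + K2))%N, (1 + (E1 + E2))%N.
move=> n inp Z st s Z0 nZ mZ ss.
have cost t K E : (t <= K * Z ^ E)%N -> (K * Z ^ E <= (K1 + K2) * Z ^ (E1 + E2))%N ->
    (1 + expr_cost s (comp_q e).1 + t <=
     (test_cost dmax (comp_q e).1 + (K1 + K2)) * Z ^ (1 + (E1 + E2)))%N.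
  move=> tK KK; apply: leq_trans (poly_cost2 _ _ _ _ Z0).
  apply: leq_add; last exact: leq_trans KK.
  by rewrite expn1; apply: test_cost_le => //; exact: (sim_bound ss).
have le12 := poly_cost2 K1 E1 K2 E2 Z0.
have tE : (0 < qeval n inp st e) = (0 < expr_val s (comp_q e).1).
  have := comp_qE Z0 e ss; case: (comp_q e) => x y [y0 -> _ _] /=.
  by rewrite pmulr_lgt0 ?invr_gt0 ?ltr0z.
rewrite /denot -/denot tE; have [pos|neg] := ltP 0 (expr_val s (comp_q e).1).
  have [t [s' [ex tc ss' s5]]] := H1 _ _ _ _ _ Z0 nZ mZ ss.
  exists (1 + expr_cost s (comp_q e).1 + t)%N, s'; split=> //.
    exact: ExIfT.
  by apply: (cost _ _ _ tc); apply: leq_trans le12; rewrite leq_addr.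
have [t [s' [ex tc ss' s5]]] := H2 _ _ _ _ _ Z0 nZ mZ ss.
exists (1 + expr_cost s (comp_q e).1 + t)%N, s'; split=> //.
  exact: ExIfF.
by apply: (cost _ _ _ tc); apply: leq_trans le12; rewrite leq_addl.
Qed.

(** There are at most [Z] iterations, so a loop raises the exponent by a constant. *)
Lemma compiles_for depth b v c : compiles depth.+1 c -> compiles depth (CFor b v c).
Proof.
move=> [K [E H]]; rewrite /compiles /=.
set i := Get 5 _; set bnd := if b then Get 0 (Cst 0) else Cst m.
set test := Bin Defs.Sub bnd i.
set body := Seq (Assign 2 _ i) _.
pose C0 := assign_cost dmax (Cst depth) (Cst 0%N).
pose C := (test_cost dmax test + assign_cost dmax (Cst v) i +
  assign_cost dmax (Cst depth) (Bin Add i (Cst 1%N)))%N.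
exists (C0 + 2 * (C + K))%N, (2 + (E + 1))%N => n inp Z st s Z0 nZ mZ ss.
set N := if b then n else m; have NZ : (N <= Z)%N by rewrite /N; case: (b).
have testE k s' st' : simulates d dmax n inp Z st' s' -> s' 5%N depth = k%:Z ->
    expr_val s' test = N%:Z - k%:Z.
  move=> ss' s5; rewrite /test /= s5; congr (_ - _).
  by rewrite /bnd /N; case: (b) => //=; exact: (sim_size ss').
have loop j k s1 : (k + j = N)%N -> s1 5%N depth = k%:Z ->
    simulates d dmax n inp Z (iterate k v (denot m n inp c) st) s1 ->
    exists t s', [/\ exec (While test body) s1 t s',
      (t <= j.+1 * (C * Z + K * Z ^ E))%N,
      simulates d dmax n inp Z (iterate N v (denot m n inp c) st) s' &
      forall h, (h < depth)%N -> s' 5%N h = s1 5%N h].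
  elim: j k s1 => [|j IH] k s1 kj s5 ss1.
    rewrite addn0 in kj; rewrite -kj; exists (1 + expr_cost s1 test)%N, s1; split=> //.
      by apply: ExWhileF; rewrite (testE _ _ _ ss1 s5) kj subrr.
    have := test_cost_le dmax_gt0 Z0 test (sim_bound ss1); rewrite /C; nia.
  have tc := test_cost_le dmax_gt0 Z0 test (sim_bound ss1).
  have pos : 0 < expr_val s1 test by rewrite (testE _ _ _ ss1 s5); lia.
  have kL : (k < 2 ^ (Z * dmax))%N by apply: leq_trans (leL Z0); lia.
  have [t1 e1 c1] := exec_assign dmax_gt0 Z0 2 (Cst v%:Z) i (sim_bound ss1).
  rewrite /= s5 in e1; have ss2 := sim_set_nr v ss1 (ltnW kL).
  set s2 := update _ _ _ _ in e1 ss2.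
  have [t2 [s3 [e2 c2 ss3 s35]]] := H _ _ _ _ _ Z0 nZ mZ ss2.
  rewrite -iterateS in ss3.
  have [t3 e3 c3] := exec_assign dmax_gt0 Z0 5 (Cst depth%:Z) (Bin Add i (Cst 1%N%:Z)) (sim_bound ss3).
  rewrite /= s35// (_ : s2 5%N depth = k%:Z) ?s5// -PoszD addn1 in e3.
  have ss4 : simulates d dmax n inp Z (iterate k.+1 v (denot m n inp c) st)
      (update s3 5 depth k.+1%:Z) by exact: sim_scratch.
  have [||t4 [s4 [e4 c4 ss5 s45]]] := IH k.+1 _ _ _ ss4.
  - by rewrite addSnnS.
  - by rewrite update_eq.
  exists (1 + expr_cost s1 test + (t1 + (t2 + t3)) + t4)%N, s4; split=> //.
  - exact: (ExWhileT pos (ExSeq e1 (ExSeq e2 e3)) e4).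
  - by move: c1 c2 c3 tc c4; rewrite /C mulSn; nia.
  - move=> h hd; rewrite s45// update_neq; last by rewrite eqxx (ltn_eqF hd).
    by rewrite s35 // ltnW.
have [t0 e0 c0] := exec_assign dmax_gt0 Z0 5 (Cst depth%:Z) (Cst 0%N%:Z) (sim_bound ss).
have ss0 : simulates d dmax n inp Z st (update s 5 depth 0%N%:Z) by exact: sim_scratch.
have [||t [s' [ex tc ss' s5]]] := loop N 0%N _ _ _ ss0.
- by [].
- by rewrite update_eq.
exists (t0 + t)%N, s'; split=> //.
- exact: (ExSeq e0 ex).
- apply: (@leq_trans (C0 * Z ^ 2 + 2 * (C + K) * Z ^ (E + 1).+1)).
    apply: leq_add.
      by apply: (leq_trans c0); rewrite leq_mul2l -mulnn leq_pmulr ?orbT.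
    apply: (leq_trans tc); have h1 : (N.+1 <= 2 * Z)%N by lia.
    apply: (leq_trans (leq_mul h1 (leqnn _))); rewrite expnS addn1 expnS.
    have ZE : (0 < Z ^ E)%N by rewrite expn_gt0 Z0.
    by move: (Z ^ E)%N ZE => W W0; nia.
  rewrite mulnDl leq_add// leq_mul2l leq_pexp2l ?orbT//; lia.
- by move=> h hd; rewrite s5// update_neq// eqxx (ltn_eqF hd).
Qed.

Lemma comp_exec c depth : degree_ok d dmax c -> compiles depth c.
Proof.
elim: c depth => [|v w|r e|r r'|e c1 h1 c2 h2|b v c h|p e|c1 h1 c2 h2] depth /=.
- exists 1%N, 0%N => n inp Z st s Z0 nZ mZ ss; exists 1%N, s; split=> //.
  exact: ExSkip.
- exists (assign_cost dmax (Cst v%:Z) (Get 2 (Cst w%:Z))), 1%N.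
  move=> n inp Z st s Z0 nZ mZ ss.
  have [t ex tc] := exec_assign dmax_gt0 Z0 2 (Cst v%:Z) (Get 2 (Cst w%:Z)) (sim_bound ss).
  exists t, (update s 2 v (s 2%N w)); split=> //.
    by rewrite (sim_nat ss) /=; apply: sim_set_nr => //; have := sim_bound ss 2 w; rewrite (sim_nat ss).
- exact: compiles_rat.
- by case/andP; exact: compiles_sqrt.
- by case/andP=> ok1 ok2; apply: compiles_if; [exact: h1|exact: h2].
- by move=> ok; apply: compiles_for; exact: h.
- exact: compiles_out.
- case/andP=> ok1 ok2; have [K1 [E1 H1]] := h1 depth ok1.
  have [K2 [E2 H2]] := h2 depth ok2.
  exists (K1 + K2)%N, (E1 + E2)%N => n inp Z st s Z0 nZ mZ ss.
  have [t1 [s1 [ex1 tc1 ss1 s15]]] := H1 _ _ _ _ _ Z0 nZ mZ ss.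
  have [t2 [s2 [ex2 tc2 ss2 s25]]] := H2 _ _ _ _ _ Z0 nZ mZ ss1.
  exists (t1 + t2)%N, s2; split=> //.
  + exact: (ExSeq ex1 ex2).
  + by apply: leq_trans (poly_cost2 _ _ _ _ Z0); exact: leq_add.
  + by move=> i id; rewrite s25// s15.
Qed.

End Compiler.

(** * Loading the input and reading the output *)

Section Loading.
Local Open Scope nat_scope.

Lemma size_bitsize w : size w <= bitsize w.
Proof.
rewrite /bitsize; elim: w => [|z w IH]; first by rewrite big_nil.
by rewrite big_cons /= -add1n leq_add.
Qed.

Lemma nth_bitsize w i : `|nth 0%R w i|%N <= 2 ^ bitsize w.
Proof.
have [iw|iw] := ltnP i (size w); last by rewrite nth_default ?expn_gt0.
rewrite (leq_trans (absz_lt_bitlen _))// leq_exp2l// /bitsize.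
by rewrite (big_nth 0%R) big_mkord (bigD1 (Ordinal iw))//= leq_addr.
Qed.

Lemma size_enc_rats qs : size (enc_rats qs) = (size qs).*2.
Proof. by elim: qs => //= q qs; rewrite /enc_rats /= => ->. Qed.

Lemma nth_enc_rats qs p : p < size qs ->
  nth 0%R (enc_rats qs) (2 * p) = numq (nth 0%R qs p) /\
  nth 0%R (enc_rats qs) (2 * p).+1 = denq (nth 0%R qs p).
Proof.
elim: qs p => [|q qs IH] [|p] // pq.
by rewrite mulnS; exact: (IH p pq).
Qed.

End Loading.

Definition hstate0 : hstate := HState (fun _ => 0%N) (fun _ => 0) (fun _ => None).

Lemma load_simulates (d : nat -> nat) (dmax n Z : nat) (qs : seq rat) :
  let w := n%:Z :: enc_rats qs in (0 < dmax)%N -> (bitsize w <= Z)%N ->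
  simulates d dmax n (nth 0 qs) Z hstate0 (load w).
Proof.
move=> w d0 wZ.
have bw i : (`|load w 0 i| <= 2 ^ Z)%N.
  by rewrite (leq_trans (nth_bitsize w i))// leq_exp2l.
have off a i : a != 0%N -> load w a i = 0 by rewrite /load => /negPf ->.
split=> //.
- move=> p; split; rewrite /small ?muln1//.
  rewrite (_ : load w 0 (1 + 2 * p) = nth 0 (enc_rats qs) (2 * p))//.
  rewrite (_ : load w 0 (2 + 2 * p) = nth 0 (enc_rats qs) (2 * p).+1)//.
  have [pq|pq] := ltnP p (size qs).
    have [-> ->] := nth_enc_rats pq.
    by split=> [||]; [exact: ltW|move/eqP; rewrite denq_eq0|rewrite divq_num_den].
  by rewrite !nth_default ?size_enc_rats//=; lia.
- move=> a i; case: (eqVneq a 0%N) => [->|a0]; last by rewrite off ?expn_gt0.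
  by rewrite (leq_trans (bw i))// leq_exp2l// leq_pmulr.
Qed.

Section Polytime.
Variables (m : nat) (d : nat -> nat) (dmax : nat) (c : cmd) (flag : nat).
Hypothesis d_le : forall r, (d r <= dmax)%N.
Hypothesis dmax_gt0 : (0 < dmax)%N.
Hypothesis c_ok : degree_ok d dmax c.

(** [COut] writes from cell 1 of the output array on; cell 0 receives the status at the very end, as
    an integer quotient. *)
Lemma polytime_denot (I : Type) (size_of : I -> nat) (rats : I -> seq rat)
    (pr : I -> Prop) (correct : I -> (nat -> int) -> Prop) :
  (forall x, size_of x <= size (rats x))%N ->
  (forall x o, pr x ->
     let st := denot m (size_of x) (nth 0 (rats x)) c hstate0 in
     o 0%N = Num.floor (qr st flag) ->
     (forall p q, out st p = Some q ->
        0 < o (2 + 2 * p)%N /\ q = (o (1 + 2 * p)%N)%:~R / (o (2 + 2 * p)%N)%:~R) ->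
     correct x o) ->
  polytime_solvable (fun x => (size_of x)%:Z :: enc_rats (rats x)) pr correct.
Proof.
move=> nx cx; have [K [E H]] := comp_exec m d_le dmax_gt0 0%N c_ok.
set num := Get 3 (Cst flag%:Z); set den := fix_den (Get 4 (Cst flag%:Z)).
pose A := assign_cost dmax (Cst 0%N%:Z) (Bin Div num den).
pose Y : {poly nat} := 'X + (m.+1)%:P.
exists (Seq (comp m 0 c) (Assign 1 (Cst 0%N%:Z) (Bin Div num den))).
exists (K%:P * Y ^+ E + A%:P * Y) => x px.
set w := _ :: _; pose Z := (bitsize w + m.+1)%N.
have Z0 : (0 < Z)%N by rewrite /Z addnS.
have sw : (size w <= bitsize w)%N := size_bitsize w.
have nZ : (size_of x <= Z)%N.
  by have := nx x; move: sw; rewrite /Z /= size_enc_rats; lia.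
have mZ : (m <= Z)%N by rewrite /Z; lia.
have ss : simulates d dmax (size_of x) (nth 0 (rats x)) Z hstate0 (load w).
  by apply: load_simulates => //; rewrite /Z leq_addr.
have [t1 [s1 [e1 c1 ss1 _]]] := H _ _ _ _ _ Z0 nZ mZ ss.
have [t2 e2 c2] := exec_assign dmax_gt0 Z0 1 (Cst 0%N%:Z) (Bin Div num den) (sim_bound ss1).
have [den0 flagE _ _] : [/\ 0 < expr_val s1 den,
    qr (denot m (size_of x) (nth 0 (rats x)) c hstate0) flag =
      (expr_val s1 num)%:~R / (expr_val s1 den)%:~R,
    small Z (d flag) (expr_val s1 num) & small Z (d flag) (expr_val s1 den)].
  exact: (comp_qE Z0 (QReg flag) ss1).
eexists; eexists; split; first exact: (ExSeq e1 e2).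
  have YE : Y.[bitsize w] = Z by rewrite /Y hornerD hornerX hornerC.
  rewrite hornerD !hornerM horner_exp !hornerC YE.
  by apply: leq_add.
apply: cx => //; first by rewrite update_eq flagE floor_ratio.
by move=> p q /(sim_out ss1); rewrite !update_neq.
Qed.

End Polytime.

(** * The optimization algorithm *)

Section Program.
Variable m : nat.

Local Notation R := QReg.
Local Notation "a '+q' b" := (QAdd a b) (at level 50, left associativity).
Local Notation "a '*q' b" := (QMul a b) (at level 40, left associativity).
Local Notation "a '/q' b" := (QDiv a b) (at level 40, left associativity).
Local Notation "a '-q' b" := (QAdd a (QMul (QCst (-1)) b)) (at level 50, left associativity).
Local Notation "c1 ;; c2" := (CSeq c1 c2) (at level 80, right associativity).

(** The offsets follow the order of [enc_instance]; [m] is a constant of the program, while the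
    dimension is read from the input. *)
Definition q_alpha k := QIn (NReg k).
Definition q_gamma k := QIn (NAdd (NCst m) (NReg k)).
Definition q_rhs k := QIn (NAdd (NCst (2 * m)) (NReg k)).
Definition q_beta i := QIn (NAdd (NCst (3 * m)) (NReg i)).
Definition q_delta i := QIn (NAdd (NAdd (NCst (3 * m)) NSize) (NReg i)).
Definition q_obj i j := QIn (NAdd (NAdd (NCst (3 * m)) (NMul (NCst 2) NSize))
  (NAdd (NMul (NReg i) NSize) (NReg j))).
Definition q_eps := QIn (NAdd (NAdd (NCst (3 * m)) (NMul (NCst 2) NSize))
  (NMul NSize NSize)).

(* Index registers: 1 to 4 hold the rows [i], [i'] and columns [j], [j'] of the
   current candidate, 5 and 6 the constraints [k], [l], and 8 to 11 the rows and
   columns of the best candidate so far. Rational registers: 0 status, 1 test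
   flag, 2 best value, 3 to 6 best entries [x_i, x_i', y_j, y_j'], 7 to 10
   current entries, 11 to 14 their products with beta and delta, 15 current
   value, 16 and 17 [cross i i'], [cross j j'], 18 [minor k l], 19 and 20 the
   corner, 21 the parameter [s] of the curve, 22 [corner_v / s], 23 and 24 the
   coefficients of [s] and [1 / s] in the objective, 25 to 27 the scaled
   approximation of the critical point. *)

Definition record_best : cmd :=
  CRat 2 (R 15) ;; CRat 3 (R 7) ;; CRat 4 (R 8) ;; CRat 5 (R 9) ;; CRat 6 (R 10) ;;
  CNat 8 1 ;; CNat 9 2 ;; CNat 10 3 ;; CNat 11 4.

Definition check_all (r : nat) (e : qexp) : cmd :=
  CRat r (QCst 1) ;; CFor false 7 (CIf e (CRat r (QCst 0)) CSkip).

Definition candidate_values : cmd :=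
  CRat 11 (q_beta 1 *q R 7 +q q_beta 2 *q R 8) ;;
  CRat 12 (q_delta 1 *q R 7 +q q_delta 2 *q R 8) ;;
  CRat 13 (q_beta 3 *q R 9 +q q_beta 4 *q R 10) ;;
  CRat 14 (q_delta 3 *q R 9 +q q_delta 4 *q R 10) ;;
  CRat 15 (q_obj 1 3 *q (R 7 *q R 9) +q q_obj 1 4 *q (R 7 *q R 10) +q
           q_obj 2 3 *q (R 8 *q R 9) +q q_obj 2 4 *q (R 8 *q R 10)).

Definition test_feasible : cmd :=
  check_all 1 (q_alpha 7 *q (R 11 *q R 13) +q q_gamma 7 *q (R 12 *q R 14) -q q_rhs 7).

Definition unless_neg (r : nat) (c : cmd) : cmd := CIf (QCst (-1) *q R r) CSkip c.

Definition try : cmd :=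
  unless_neg 7 (unless_neg 8 (unless_neg 9 (unless_neg 10
    (candidate_values ;; test_feasible ;;
     CIf (R 1) (CIf (R 15 -q R 2) record_best CSkip) CSkip)))).

(** The factors [QCst 1] make the entries agree literally with those of [pt D i i' 1 s]. *)
Definition curve_values (s : qexp) : cmd :=
  CRat 21 s ;;
  CRat 7 ((QCst 1 *q q_delta 2 -q R 21 *q q_beta 2) /q R 16) ;;
  CRat 8 ((R 21 *q q_beta 1 -q QCst 1 *q q_delta 1) /q R 16) ;;
  CRat 22 (R 20 /q R 21) ;;
  CRat 9 ((R 19 *q q_delta 4 -q R 22 *q q_beta 4) /q R 17) ;;
  CRat 10 ((R 22 *q q_beta 3 -q R 19 *q q_delta 3) /q R 17).

Definition try_curve (s : qexp) : cmd := curve_values s ;; try.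

Definition curve_setup : cmd :=
  CRat 16 (q_beta 1 *q q_delta 2 -q q_beta 2 *q q_delta 1) ;;
  CRat 17 (q_beta 3 *q q_delta 4 -q q_beta 4 *q q_delta 3) ;;
  CRat 18 (q_alpha 5 *q q_gamma 6 -q q_alpha 6 *q q_gamma 5) ;;
  CRat 19 ((q_rhs 5 *q q_gamma 6 -q q_rhs 6 *q q_gamma 5) /q R 18) ;;
  CRat 20 ((q_alpha 5 *q q_rhs 6 -q q_alpha 6 *q q_rhs 5) /q R 18) ;;
  CRat 23 (R 19 *q (q_obj 2 4 *q (q_beta 1 *q (QCst (-1) *q q_delta 3)) +q
                    q_obj 2 3 *q (q_beta 1 *q q_delta 4) +q
                    q_obj 1 4 *q (q_beta 2 *q q_delta 3) -q
                    q_obj 1 3 *q (q_beta 2 *q q_delta 4)) /q (R 16 *q R 17)) ;;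
  CRat 24 (R 20 *q (q_obj 1 4 *q (q_delta 2 *q q_beta 3) +q
                    q_obj 2 3 *q (q_delta 1 *q q_beta 4) -q
                    q_obj 1 3 *q (q_delta 2 *q q_beta 4) -q
                    q_obj 2 4 *q (q_delta 1 *q q_beta 3)) /q (R 16 *q R 17)) ;;
  CRat 25 (QCst 1 -q R 23 /q (q_delta 1 /q q_beta 1 *q q_eps)) ;;
  CRat 26 (R 24 /q R 23 *q (R 25 *q R 25)) ;;
  CSqrt 27 26.

Definition dual_slope_q j := R 20 /q (R 19 *q (q_delta j /q q_beta j)).

(** The ends of an arc are a maximum and a minimum among the first four values. Trying all four
    avoids comparing them, since [try] rejects the infeasible ones. *)
Definition curve_body : cmd :=
  curve_setup ;;
  try_curve (q_delta 1 /q q_beta 1) ;;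
  try_curve (q_delta 2 /q q_beta 2) ;;
  try_curve (dual_slope_q 3) ;;
  try_curve (dual_slope_q 4) ;;
  try_curve (R 27 /q R 25).

(** A single entry is treated as a candidate with equal rows and equal columns whose second entries
    are 0, so that the same [try] applies. *)
Definition entry_body : cmd :=
  CNat 2 1 ;; CNat 4 3 ;;
  CRat 7 (QCst 1) ;; CRat 8 (QCst 0) ;; CRat 10 (QCst 0) ;;
  CRat 9 (q_rhs 5 /q (q_alpha 5 *q (q_beta 1 *q q_beta 3) +q
                      q_gamma 5 *q (q_delta 1 *q q_delta 3))) ;;
  try.

(** The indicators are summed rather than selected, so that coinciding indices add up as in
    [pair_vec]. *)
Definition output_body : cmd :=
  COut (NAdd (NMul (NReg 12) NSize) (NReg 13))
    ((QEq (NReg 12) (NReg 8) *q R 3 +q QEq (NReg 12) (NReg 9) *q R 4) *q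
     (QEq (NReg 13) (NReg 10) *q R 5 +q QEq (NReg 13) (NReg 11) *q R 6)).

Definition entry_loops : cmd :=
  CFor true 1 (CFor true 3 (CFor false 5 entry_body)).

Definition curve_loops : cmd :=
  CFor true 1 (CFor true 2 (CFor true 3 (CFor true 4
    (CFor false 5 (CFor false 6 curve_body))))).

Definition output_loops : cmd := CFor true 12 (CFor true 13 output_body).

Definition algorithm : cmd :=
  check_all 0 (QCst (-1) *q q_rhs 7) ;;
  CIf (R 0) (entry_loops ;; curve_loops ;; output_loops) CSkip.

End Program.

(** Takes maxima in one pass in program order, without looking for a fixed point; [degree_ok] checks
    afterwards that the outcome is consistent. *)
Fixpoint infer_degrees (c : cmd) (d : nat -> nat) : nat -> nat :=
  match c with
  | CRat r e => upd d r (maxn (d r) (degree d e))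
  | CSqrt r r' => upd d r (maxn (d r) (d r'))
  | CIf _ c1 c2 | CSeq c1 c2 => infer_degrees c2 (infer_degrees c1 d)
  | CFor _ _ c => infer_degrees c d
  | _ => d
  end.

Fixpoint nmod (c : cmd) : seq nat :=
  match c with
  | CNat v _ => [:: v]
  | CIf _ c1 c2 | CSeq c1 c2 => nmod c1 ++ nmod c2
  | CFor _ v c => v :: nmod c
  | _ => [::]
  end.

Fixpoint qmod (c : cmd) : seq nat :=
  match c with
  | CRat r _ | CSqrt r _ => [:: r]
  | CIf _ c1 c2 | CSeq c1 c2 => qmod c1 ++ qmod c2
  | CFor _ _ c => qmod c
  | _ => [::]
  end.

Fixpoint qreads (e : qexp) : seq nat :=
  match e with
  | QReg r => [:: r]
  | QAdd a b | QMul a b | QDiv a b => qreads a ++ qreads b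
  | _ => [::]
  end.

Fixpoint qregs (c : cmd) : seq nat :=
  match c with
  | CRat r e => r :: qreads e
  | CSqrt r r' => [:: r; r']
  | CSeq c1 c2 => qregs c1 ++ qregs c2
  | _ => [::]
  end.

(* Sequences of assignments to rational registers, none of which is modified
   once read or written: their effect is described by the equations below on
   the final state. *)
Fixpoint single_assignment (c : cmd) : bool :=
  match c with
  | CRat r e => r \notin qreads e
  | CSqrt r r' => r != r'
  | CSeq c1 c2 => [&& single_assignment c1, single_assignment c2 &
                     all (fun r => r \notin qmod c2) (qregs c1)]
  | _ => false
  end.

(** * Frame properties of programs *)

Section Frames.
Variables (m n : nat) (inp : nat -> rat).

Lemma iterate_ind (P : nat -> hstate -> Prop) k v f st : P 0%N st ->
  (forall i st, (i < k)%N -> P i st -> P i.+1 (f (set_nr st v i))) ->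
  P k (iterate k v f st).
Proof.
elim: k => [//|k IH] P0 PS; rewrite iterateS; apply: (PS) => //.
by apply: IH => // i st' ik; apply: PS; rewrite ltnS ltnW.
Qed.

Lemma frame_nr c st v : v \notin nmod c -> nr (denot m n inp c st) v = nr st v.
Proof.
elim: c st => [//|w w'|//|//|e c1 h1 c2 h2|b w c h|//|c1 h1 c2 h2] st /=.
- by rewrite inE /upd => /negPf ->.
- by rewrite mem_cat negb_or => /andP[v1 v2]; case: ifP => _; [exact: h1|exact: h2].
- rewrite inE negb_or => /andP[vw vc].
  apply: (iterate_ind (P := fun _ s => nr s v = nr st v)) => // i s _ <-.
  by rewrite h //= /upd (negPf vw).
- by rewrite mem_cat negb_or => /andP[v1 v2]; rewrite h2// h1.
Qed.

Lemma frame_qr c st r : r \notin qmod c -> qr (denot m n inp c st) r = qr st r.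
Proof.
elim: c st => [//|//|w e|w w'|e c1 h1 c2 h2|b w c h|//|c1 h1 c2 h2] st /=.
- by rewrite inE /upd => /negPf ->.
- by rewrite inE /upd => /negPf ->.
- by rewrite mem_cat negb_or => /andP[v1 v2]; case: ifP => _; [exact: h1|exact: h2].
- move=> vc; apply: (iterate_ind (P := fun _ s => qr s r = qr st r)) => // i s _ <-.
  by rewrite h.
- by rewrite mem_cat negb_or => /andP[v1 v2]; rewrite h2// h1.
Qed.

Fixpoint equations (st : hstate) (c : cmd) : Prop :=
  match c with
  | CRat r e => qr st r = qeval n inp st e
  | CSqrt r r' => qr st r = (floor_sqrt (qr st r'))%:R
  | CSeq c1 c2 => equations st c1 /\ equations st c2
  | _ => True
  end.

(** Rewriting with these equations stops at the input readings such as [q_beta], which have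
    evaluation lemmas of their own. *)
Lemma qevalE :
  (forall st r, qeval n inp st (QReg r) = qr st r) *
  (forall st z, qeval n inp st (QCst z) = z%:~R) *
  (forall st a b, qeval n inp st (QAdd a b) = qeval n inp st a + qeval n inp st b) *
  (forall st a b, qeval n inp st (QMul a b) = qeval n inp st a * qeval n inp st b) *
  (forall st a b, qeval n inp st (QDiv a b) = qeval n inp st a / qeval n inp st b).
Proof. by []. Qed.

Lemma denot_seq c1 c2 st : denot m n inp (CSeq c1 c2) st =
  denot m n inp c2 (denot m n inp c1 st).
Proof. by []. Qed.

Lemma denot_if e c1 c2 st : denot m n inp (CIf e c1 c2) st =
  if 0 < qeval n inp st e then denot m n inp c1 st else denot m n inp c2 st.
Proof. by []. Qed.

Lemma denot_seq6 c1 c2 c3 c4 c5 c6 st :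
  let run := denot m n inp in
  run (CSeq c1 (CSeq c2 (CSeq c3 (CSeq c4 (CSeq c5 c6))))) st =
  run c6 (run c5 (run c4 (run c3 (run c2 (run c1 st))))).
Proof. by []. Qed.

Lemma neval_ext s s' e : nr s =1 nr s' -> neval n s e = neval n s' e.
Proof. by move=> ss; elim: e => [v|//|//|a ha b hb|a ha b hb] /=; rewrite ?ss// ha hb. Qed.

Lemma qeval_ext s s' e : nr s =1 nr s' ->
  (forall r, r \in qreads e -> qr s r = qr s' r) ->
  qeval n inp s e = qeval n inp s' e.
Proof.
move=> ss; elim: e => [r|p|z|a b|a ha b hb|a ha b hb|a ha b hb] /= qs.
- by apply: qs; rewrite inE.
- by rewrite (neval_ext _ ss).
- by [].
- by rewrite !(neval_ext _ ss).
- by rewrite ha ?hb// => r rr; apply: qs; rewrite mem_cat rr ?orbT.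
- by rewrite ha ?hb// => r rr; apply: qs; rewrite mem_cat rr ?orbT.
- by rewrite ha ?hb// => r rr; apply: qs; rewrite mem_cat rr ?orbT.
Qed.

Lemma equations_ext s s' c : nr s =1 nr s' ->
  (forall r, r \in qregs c -> qr s r = qr s' r) -> equations s c -> equations s' c.
Proof.
move=> ss; elim: c => [//|//|r e|r r'|//|//|//|c1 h1 c2 h2] /= qs.
- rewrite -qs ?mem_head// => ->; apply: qeval_ext => // r' rr.
  by apply: qs; rewrite inE rr orbT.
- by rewrite -(qs r) ?mem_head// -(qs r')// !inE eqxx orbT.
- by case=> /h1 e1 /h2 e2; split; [apply: e1|apply: e2] => r rr; apply: qs;
    rewrite mem_cat rr ?orbT.
Qed.

Lemma single_assignment_nr c st : single_assignment c -> nr (denot m n inp c st) = nr st.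
Proof.
elim: c st => [|v w|r e|r r'|e c1 h1 c2 h2|b v c h|p e|c1 h1 c2 h2] st //=.
by case/and3P => s1 s2 _; rewrite h2// h1.
Qed.

Lemma single_assignmentP c st : single_assignment c -> equations (denot m n inp c st) c.
Proof.
elim: c st => [|v w|r e|r r'|e c1 h1 c2 h2|b v c h|p e|c1 h1 c2 h2] st //=.
- move=> re; rewrite /upd eqxx; apply: qeval_ext => // r' r'e.
  by rewrite /= /upd; case: eqP => // rr; rewrite -rr r'e in re.
- by rewrite /upd eqxx eq_sym => /negPf ->.
- case/and3P => s1 s2 /allP fr; split; last exact: h2.
  apply: equations_ext (h1 st s1).
    by move=> v; rewrite (single_assignment_nr _ s2).
  by move=> r /fr r2; apply/esym/frame_qr.
Qed.

(** The states met in the loop differ from [st] only in the flag [r] and the counter 7, hence the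
    form of the hypothesis on [e]. *)
Lemma check_allE r e st (F : nat -> rat) :
  (forall s, (forall r', r' != r -> qr s r' = qr st r') ->
     (forall v, v != 7%N -> nr s v = nr st v) ->
     qeval n inp s e = F (nr s 7%N)) ->
  qr (denot m n inp (check_all r e) st) r = (all (fun h => F h <= 0) (iota 0 m))%:R.
Proof.
move=> eF.
pose P k s := [/\ forall r', r' != r -> qr s r' = qr st r',
   forall v, v != 7%N -> nr s v = nr st v &
   qr s r = (all (fun h => F h <= 0) (iota 0 k))%:R].
suff [] : P m (denot m n inp (check_all r e) st) by [].
apply: (iterate_ind (P := P)) => [|i s im [s1 s2 s3]].
  by split=> //= [r' rr'|]; rewrite /upd ?eqxx// (negPf rr').
set s' := set_nr s 7 i.
have e' : qeval n inp s' e = F i.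
  by rewrite eF// => v v7; rewrite /s' /= /upd (negPf v7) s2.
rewrite /P (_ : iota 0 i.+1 = iota 0 i ++ [:: i]); last by rewrite -addn1 iotaD.
rewrite all_cat /= andbT e'; have [Fi|Fi] := ltP 0 (F i); last first.
  split=> [r' rr'|v v7|]; [exact: s1| |by rewrite andbT].
  by rewrite /= /upd (negPf v7) s2.
split=> [r' rr'|v v7|].
- by rewrite /= /upd (negPf rr') s1.
- by rewrite /= /upd (negPf v7) s2.
- by rewrite /= /upd eqxx andbF.
Qed.

End Frames.

(** * The search keeps the best candidate *)

Section Candidates.
Variables (m n : nat) (inp : nat -> rat) (D : data rat m n) (C : 'M[rat]_n) (eps : rat).
Hypothesis inp_alpha : forall k : 'I_m, inp k = alpha D k.
Hypothesis inp_gamma : forall k : 'I_m, inp (m + k)%N = gamma D k.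
Hypothesis inp_rhs : forall k : 'I_m, inp (2 * m + k)%N = rhs D k.
Hypothesis inp_beta : forall i : 'I_n, inp (3 * m + i)%N = beta D i 0.
Hypothesis inp_delta : forall i : 'I_n, inp (3 * m + n + i)%N = delta D i 0.
Hypothesis inp_obj : forall i j : 'I_n,
  inp (3 * m + 2 * n + (i * n + j))%N = C i j.
Hypothesis inp_eps : inp (3 * m + 2 * n + n * n)%N = eps.

Local Notation run := (denot m n inp).
Local Notation ev := (qeval n inp).

Lemma q_alphaE st h (k : 'I_m) : nr st h = k -> ev st (q_alpha h) = alpha D k.
Proof. by move=> hk; rewrite -inp_alpha /= hk. Qed.

Lemma q_gammaE st h (k : 'I_m) : nr st h = k -> ev st (q_gamma m h) = gamma D k.
Proof. by move=> hk; rewrite -inp_gamma /= hk. Qed.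

Lemma q_rhsE st h (k : 'I_m) : nr st h = k -> ev st (q_rhs m h) = rhs D k.
Proof. by move=> hk; rewrite -inp_rhs -hk. Qed.

Lemma q_betaE st h (i : 'I_n) : nr st h = i -> ev st (q_beta m h) = beta D i 0.
Proof. by move=> hi; rewrite -inp_beta -hi. Qed.

Lemma q_deltaE st h (i : 'I_n) : nr st h = i -> ev st (q_delta m h) = delta D i 0.
Proof. by move=> hi; rewrite -inp_delta -hi. Qed.

Lemma q_objE st h h' (i j : 'I_n) : nr st h = i -> nr st h' = j ->
  ev st (q_obj m h h') = C i j.
Proof. by move=> hi hj; rewrite -inp_obj -hi -hj. Qed.

Lemma q_epsE st : ev st (q_eps m) = eps.
Proof. by rewrite -inp_eps. Qed.

Definition value (x y : 'cV[rat]_n) : rat := dot (C *m y) x.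

Definition pair_vec (i i' : 'I_n) (a b : rat) : 'cV[rat]_n :=
  a *: delta_mx i 0 + b *: delta_mx i' 0.

Definition candidate_ok (i i' j j' : 'I_n) (a b c e : rat) : Prop :=
  [/\ 0 <= a, 0 <= b, 0 <= c, 0 <= e &
      forall h, load_of D h (pair_vec i i' a b) (pair_vec j j' c e) <= rhs D h].

Lemma value_pair i i' j j' a b c e :
  value (pair_vec i i' a b) (pair_vec j j' c e) =
  C i j * (a * c) + C i j' * (a * e) + C i' j * (b * c) + C i' j' * (b * e).
Proof.
have Cy h : (C *m pair_vec j j' c e) h 0 = C h j * c + C h j' * e.
  by rewrite /pair_vec mulmxDr -!scalemxAr -!colE !mxE; ring.
rewrite /value {2}/pair_vec !(dotDr, dotZr) !dot_delta !Cy; ring.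
Qed.

Definition sound (st : hstate) : Prop := exists i i' j j' : 'I_n,
  [/\ nr st 8 = i, nr st 9 = i', nr st 10 = j & nr st 11 = j'] /\
  (candidate_ok i i' j j' (qr st 3) (qr st 4) (qr st 5) (qr st 6) /\
   qr st 2 = value (pair_vec i i' (qr st 3) (qr st 4)) (pair_vec j j' (qr st 5) (qr st 6))).

(** What has been examined is expressed through all upper bounds [B] of the best value, so that it
    survives later improvements. *)
Definition improves (st st' : hstate) (P : rat -> Prop) : Prop :=
  [/\ sound st', qr st 2 <= qr st' 2 & forall B, qr st' 2 <= B -> P B].

Lemma candidate_valuesE st (i i' j j' : 'I_n) :
  nr st 1 = i -> nr st 2 = i' -> nr st 3 = j -> nr st 4 = j' ->
  let x := pair_vec i i' (qr st 7) (qr st 8) in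
  let y := pair_vec j j' (qr st 9) (qr st 10) in
  let s := run (candidate_values m) st in
  [/\ qr s 11 = dot (beta D) x, qr s 12 = dot (delta D) x,
      qr s 13 = dot (beta D) y, qr s 14 = dot (delta D) y &
      qr s 15 = value x y].
Proof.
move=> e1 e2 e3 e4 x y s.
have [e11 [e12 [e13 [e14 e15]]]] : equations n inp s (candidate_values m).
  exact: single_assignmentP.
have nE v : nr s v = nr st v by rewrite /s single_assignment_nr.
have qE r : r \notin qmod (candidate_values m) -> qr s r = qr st r by exact: frame_qr.
rewrite -!nE in e1 e2 e3 e4; move: e11 e12 e13 e14 e15; clearbody s.
rewrite !qevalE !(q_betaE e1, q_betaE e2, q_betaE e3, q_betaE e4).
rewrite !(q_deltaE e1, q_deltaE e2, q_deltaE e3, q_deltaE e4).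
rewrite !(q_objE e1 e3, q_objE e1 e4, q_objE e2 e3, q_objE e2 e4).
rewrite !(qE 7, qE 8, qE 9, qE 10)//.
move=> -> -> -> -> ->; split; last by rewrite value_pair.
all: by rewrite dotDr !dotZr !dot_delta; ring.
Qed.

Lemma test_feasibleE s (x y : 'cV[rat]_n) :
  qr s 11 = dot (beta D) x -> qr s 12 = dot (delta D) x ->
  qr s 13 = dot (beta D) y -> qr s 14 = dot (delta D) y ->
  0 < qr (run (test_feasible m) s) 1 <-> forall h, load_of D h x y <= rhs D h.
Proof.
move=> e11 e12 e13 e14.
pose F h := inp h * (qr s 11 * qr s 13) + inp (m + h)%N * (qr s 12 * qr s 14)
  + (-1) * inp (2 * m + h)%N.
rewrite /test_feasible (@check_allE m n inp _ _ s F); last first.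
  by move=> s' qE _; rewrite /F /= !qE.
have FE (h : 'I_m) : (F h <= 0) = (load_of D h x y <= rhs D h).
  rewrite /F inp_alpha inp_gamma inp_rhs e11 e12 e13 e14 mulN1r subr_le0.
  by rewrite /load_of.
rewrite ltr0n lt0b; split=> [/allP H h|H]; first by rewrite -FE H// mem_iota /=.
by apply/allP => h; rewrite mem_iota /= add0n => hm; rewrite (FE (Ordinal hm)).
Qed.

Lemma try_improves st (i i' j j' : 'I_n) :
  nr st 1 = i -> nr st 2 = i' -> nr st 3 = j -> nr st 4 = j' -> sound st ->
  improves st (run (try m) st) (fun B =>
    candidate_ok i i' j j' (qr st 7) (qr st 8) (qr st 9) (qr st 10) ->
    value (pair_vec i i' (qr st 7) (qr st 8)) (pair_vec j j' (qr st 9) (qr st 10)) <= B).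
Proof.
move=> e1 e2 e3 e4 snd.
suff [h1 h2 h3] : [/\ sound (run (try m) st), qr st 2 <= qr (run (try m) st) 2 &
    candidate_ok i i' j j' (qr st 7) (qr st 8) (qr st 9) (qr st 10) ->
    value (pair_vec i i' (qr st 7) (qr st 8)) (pair_vec j j' (qr st 9) (qr st 10))
      <= qr (run (try m) st) 2].
  by split=> // B B2 /h3 /le_trans; apply.
have stay (P : Prop) : ~ P -> [/\ sound st, qr st 2 <= qr st 2 & P ->
    value (pair_vec i i' (qr st 7) (qr st 8)) (pair_vec j j' (qr st 9) (qr st 10))
      <= qr st 2].
  by move=> nP; split.
have negE r c : run (unless_neg r c) st = if qr st r < 0 then st else run c st.
  by rewrite /= mulN1r oppr_gt0.
rewrite /try negE; case: ltP => q7; first by apply: stay => -[]; rewrite leNgt q7.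
rewrite negE; case: ltP => q8; first by apply: stay => -[_]; rewrite leNgt q8.
rewrite negE; case: ltP => q9; first by apply: stay => -[_ _]; rewrite leNgt q9.
rewrite negE; case: ltP => q10; first by apply: stay => -[_ _ _]; rewrite leNgt q10.
have [e11 e12 e13 e14 e15] := candidate_valuesE e1 e2 e3 e4.
have := test_feasibleE e11 e12 e13 e14.
set s1 := run (candidate_values m) st in e15 *; set s2 := run (test_feasible m) s1 => s2ok.
have nE v : v != 7%N -> nr s2 v = nr st v.
  move=> v7; transitivity (nr s1 v); last exact: frame_nr.
  by apply: frame_nr; rewrite /= !inE.
have qE r : r \notin qmod (candidate_values m) -> r != 1%N -> qr s2 r = qr st r.
  move=> rc r1; transitivity (qr s1 r); last exact: frame_qr.
  by apply: frame_qr; rewrite /= !inE (negPf r1).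
have s215 : qr s2 15 = qr s1 15 by apply: frame_qr.
rewrite (_ : run _ _ = run (CIf (QReg 1) (CIf (QAdd (QReg 15) (QMul (QCst (-1)) (QReg 2)))
  record_best CSkip) CSkip) s2)//.
have same : sound s2.
  by move: snd; rewrite /sound !nE// !qE.
clearbody s2; rewrite [run _ _]/=; case: ifPn => ok; last first.
  split=> //; first by rewrite qE.
  by case=> _ _ _ _ /s2ok; rewrite (negPf ok).
rewrite mulN1r subr_gt0 s215 e15 qE//; case: ltP => better; last first.
  by split=> //; rewrite qE.
split; last 2 first.
- by rewrite /= /upd /=; exact: ltW.
- by rewrite /= /upd /=.
exists i, i', j, j'; rewrite /= /upd /= !nE// !qE//; split=> //.
by split=> //; split=> //; apply/s2ok.
Qed.

Lemma sound_frame c st :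
  all (fun v => v \notin nmod c) [:: 8; 9; 10; 11]%N ->
  all (fun r => r \notin qmod c) [:: 2; 3; 4; 5; 6]%N ->
  sound st -> sound (run c st) /\ qr (run c st) 2 = qr st 2.
Proof.
move=> /allP fn /allP fq snd; have nE v : v \in [:: 8; 9; 10; 11]%N -> nr (run c st) v = nr st v.
  by move=> /fn; exact: frame_nr.
have qE r : r \in [:: 2; 3; 4; 5; 6]%N -> qr (run c st) r = qr st r.
  by move=> /fq; exact: frame_qr.
by split; [move: snd; rewrite /sound !nE// !qE|rewrite qE].
Qed.

Lemma improves_seq st s s' P Q : improves st s P -> improves s s' Q ->
  improves st s' (fun B => P B /\ Q B).
Proof.
move=> [s1 le1 p] [s2 le2 q]; split=> //; first exact: le_trans le2.
by move=> B h; split; [apply: p; apply: le_trans h|exact: q].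
Qed.

Lemma improves_frame c st s' P :
  all (fun v => v \notin nmod c) [:: 8; 9; 10; 11]%N ->
  all (fun r => r \notin qmod c) [:: 2; 3; 4; 5; 6]%N -> sound st ->
  (sound (run c st) -> improves (run c st) s' P) -> improves st s' P.
Proof.
by move=> fn fq /(sound_frame fn fq)[s1 e] /(_ s1)[s2 le p]; split=> //; rewrite -e.
Qed.

Definition at_indices (i i' j j' : 'I_n) (st : hstate) : Prop :=
  [/\ nr st 1 = i, nr st 2 = i', nr st 3 = j & nr st 4 = j'].

Lemma at_indices_frame c st i i' j j' :
  all (fun v => v \notin nmod c) [:: 1; 2; 3; 4]%N ->
  at_indices i i' j j' st -> at_indices i i' j j' (run c st).
Proof. by case/and5P=> *; rewrite /at_indices !frame_nr. Qed.

(** For distinct indices the two coefficients of [pt] are entries of the vector, so nonnegativity of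
    the vector gives the sign tests of [try]. *)
Definition curve_covered (i i' j j' : 'I_n) (u v s B : rat) : Prop :=
  i != i' -> j != j' -> nonneg (pt D i i' 1 s) -> nonneg (pt D j j' u (v / s)) ->
  (forall h, load_of D h (pt D i i' 1 s) (pt D j j' u (v / s)) <= rhs D h) ->
  value (pt D i i' 1 s) (pt D j j' u (v / s)) <= B.

Lemma try_curve_improves st e (i i' j j' : 'I_n) u v s :
  at_indices i i' j j' st -> sound st ->
  single_assignment (curve_values m e) ->
  qr st 16 = cross D i i' -> qr st 17 = cross D j j' -> qr st 19 = u ->
  qr st 20 = v ->
  (forall s1, nr s1 = nr st ->
    (forall r, r \notin [:: 21; 7; 8; 22; 9; 10]%N -> qr s1 r = qr st r) ->
    qeval n inp s1 e = s) ->
  improves st (run (try_curve m e) st) (curve_covered i i' j j' u v s).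
Proof.
move=> ind snd sa q16 q17 q19 q20 es.
apply: (improves_frame (c := curve_values m e)) => // snd1.
have := single_assignmentP m n inp st sa.
have ind1 : at_indices i i' j j' (run (curve_values m e) st) by exact: at_indices_frame.
have qE r : r \notin [:: 21; 7; 8; 22; 9; 10]%N -> qr (run (curve_values m e) st) r = qr st r.
  by move=> rr; apply: frame_qr.
have := es _ (single_assignment_nr m n inp st sa) qE.
rewrite /try_curve denot_seq.
set s1 := run (curve_values m e) st in snd1 ind1 qE *; clearbody s1 => {}es.
move=> [e21 [e7 [e8 [e22 [e9 e10]]]]]; have [n1 n2 n3 n4] := ind1.
move: e7 e8 e22 e9 e10; rewrite !qevalE e21 es.
rewrite !(q_betaE n1, q_betaE n2, q_betaE n3, q_betaE n4).
rewrite !(q_deltaE n1, q_deltaE n2, q_deltaE n3, q_deltaE n4).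
rewrite !(qE 16, qE 17, qE 19, qE 20)// q16 q17 q19 q20 => e7 e8 e22.
rewrite e22 !mulN1r in e7 e8 * => e9 e10.
have [h1 h2 h3] := try_improves n1 n2 n3 n4 snd1; split=> // B /h3 {}h3.
rewrite /curve_covered.
have xE : pair_vec i i' (qr s1 7) (qr s1 8) = pt D i i' 1 s by rewrite e7 e8.
have yE : pair_vec j j' (qr s1 9) (qr s1 10) = pt D j j' u (v / s) by rewrite e9 e10.
rewrite -xE -yE => ii' jj' x0 y0 xy; apply: h3; split=> //.
- by have := x0 i; rewrite !mxE !eqxx (negPf ii') mulr1 mulr0 addr0.
- by have := x0 i'; rewrite !mxE !eqxx eq_sym (negPf ii') mulr1 mulr0 add0r.
- by have := y0 j; rewrite !mxE !eqxx (negPf jj') mulr1 mulr0 addr0.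
- by have := y0 j'; rewrite !mxE !eqxx eq_sym (negPf jj') mulr1 mulr0 add0r.
Qed.

(* The objective along a curve is [crit_lin * s + crit_cst + crit_inv / s]. *)
Definition crit_lin i i' j j' k l : rat :=
  value (pt D i i' 0 1) (pt D j j' (corner_u D k l) 0).
Definition crit_inv i i' j j' k l : rat :=
  value (pt D i i' 1 0) (pt D j j' 0 (corner_v D k l)).

(** For a negative linear coefficient [a], this [K] satisfies [K >= 1] and
    [K * (slope D i * eps) >= - a], the two inequalities behind the error bound in
    [curve_critical]. *)
Definition crit_scale i i' j j' k l : rat :=
  1 - crit_lin i i' j j' k l / (slope D i * eps).

(** When both coefficients are negative, this lies below the critical point by at most [1 / K], by
    [floor_sqrtP]. *)
Definition crit_approx i i' j j' k l : rat :=
  let K := crit_scale i i' j j' k l in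
  (floor_sqrt (crit_inv i i' j j' k l / crit_lin i i' j j' k l * (K * K)))%:R / K.

Definition curve_points i i' j j' k l : seq rat :=
  [:: slope D i; slope D i'; dual_slope D j k l; dual_slope D j' k l;
      crit_approx i i' j j' k l].

Lemma curve_setupE st (i i' j j' : 'I_n) (k l : 'I_m) :
  at_indices i i' j j' st -> nr st 5 = k -> nr st 6 = l ->
  let s := run (curve_setup m) st in
  [/\ qr s 16 = cross D i i', qr s 17 = cross D j j',
      qr s 19 = corner_u D k l, qr s 20 = corner_v D k l &
      qr s 27 / qr s 25 = crit_approx i i' j j' k l].
Proof.
move=> [n1 n2 n3 n4] n5 n6 s.
have sa : single_assignment (curve_setup m) by [].
have := single_assignmentP m n inp st sa.
have nE := single_assignment_nr m n inp st sa.
rewrite -/s in nE *; clearbody s.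
move=> [e16 [e17 [e18 [e19 [e20 [e23 [e24 [e25 [e26 e27]]]]]]]]].
move: e16 e17 e18 e19 e20 e23 e24 e25 e26 e27; rewrite -nE in n1 n2 n3 n4 n5 n6.
rewrite !qevalE !(q_betaE n1, q_betaE n2, q_betaE n3, q_betaE n4).
rewrite !(q_deltaE n1, q_deltaE n2, q_deltaE n3, q_deltaE n4).
rewrite !(q_objE n1 n3, q_objE n1 n4, q_objE n2 n3, q_objE n2 n4).
rewrite !(q_alphaE n5, q_alphaE n6, q_gammaE n5, q_gammaE n6, q_rhsE n5, q_rhsE n6).
rewrite q_epsE !mulN1r.
rewrite -!/(cross _ _ _) -!/(minor _ _ _) => e16 e17 e18.
rewrite e16 e17 e18 -/(corner_u D k l) -/(corner_v D k l) => e19 e20.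
rewrite e19 e20 => e23 e24 e25 e26 e27; split=> //.
have aE : qr s 23 = crit_lin i i' j j' k l.
  rewrite e23 /crit_lin /pt value_pair invfM; ring.
have cE : qr s 24 = crit_inv i i' j j' k l.
  rewrite e24 /crit_inv /pt value_pair invfM; ring.
by rewrite e27 e26 e25 aE cE.
Qed.

Lemma improves_weaken st s (P Q : rat -> Prop) :
  (forall B, P B -> Q B) -> improves st s P -> improves st s Q.
Proof. by move=> PQ [h1 h2 h3]; split=> // B /h3/PQ. Qed.

Lemma curve_body_improves st (i i' j j' : 'I_n) (k l : 'I_m) :
  at_indices i i' j j' st -> nr st 5 = k -> nr st 6 = l -> sound st ->
  improves st (run (curve_body m) st) (fun B =>
    forall s, s \in curve_points i i' j j' k l ->
    curve_covered i i' j j' (corner_u D k l) (corner_v D k l) s B).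
Proof.
move=> ind n5 n6 snd.
apply: (improves_frame (c := curve_setup m)) => // {}snd.
have {n5 n6} := curve_setupE ind n5 n6.
have {}ind := at_indices_frame (c := curve_setup m) isT ind.
rewrite /curve_body denot_seq6.
move: (run (curve_setup m) st) ind snd => {}st.
set u := corner_u D k l; set v := corner_v D k l; set s5 := crit_approx _ _ _ _ _ _.
(* Preserved by each [try_curve], so that the five calls can be chained. *)
pose ready st := at_indices i i' j j' st /\ [/\ qr st 16 = cross D i i',
  qr st 17 = cross D j j', qr st 19 = u, qr st 20 = v & qr st 27 / qr st 25 = s5].
have step e s st' : ready st' -> sound st' -> single_assignment (curve_values m e) ->
    (forall s1, ready s1 -> qeval n inp s1 e = s) ->
    improves st' (run (try_curve m e) st') (curve_covered i i' j j' u v s) /\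
    ready (run (try_curve m e) st').
  move=> [ind q] snd sa es; have [q16 q17 q19 q20 q27] := q.
  have frq r : r \notin qmod (try_curve m (QReg 0)) -> qr (run (try_curve m e) st') r = qr st' r.
    by move=> rn; apply: frame_qr.
  split; last first.
    by split; [exact: at_indices_frame|rewrite !frq].
  apply: try_curve_improves => // s1 ns qs; apply: es; split.
    by rewrite /at_indices ns.
  by rewrite !qs.
have slopeE h (h' : 'I_n) s1 : nr s1 h = h' ->
    qeval n inp s1 (QDiv (q_delta m h) (q_beta m h)) = slope D h'.
  by move=> hE; rewrite qevalE (q_deltaE hE) (q_betaE hE).
have dualE h (h' : 'I_n) s1 : ready s1 -> nr s1 h = h' ->
    qeval n inp s1 (dual_slope_q m h) = dual_slope D h' k l.
  move=> [_ [_ _ q19 q20 _]] hE.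
  by rewrite !qevalE (q_deltaE hE) (q_betaE hE) q19 q20.
move=> ind snd q; have rd : ready st by [].
have [|im1 rd1] := step (QDiv (q_delta m 1) (q_beta m 1)) (slope D i) st rd snd isT.
  by move=> s1 [[n1 _ _ _] _]; exact: slopeE.
have [snd1 _ _] := im1.
have [|im2 rd2] := step (QDiv (q_delta m 2) (q_beta m 2)) (slope D i') _ rd1 snd1 isT.
  by move=> s1 [[_ n2 _ _] _]; exact: slopeE.
have [snd2 _ _] := im2.
have [|im3 rd3] := step (dual_slope_q m 3) (dual_slope D j k l) _ rd2 snd2 isT.
  by move=> s1 rs; apply: dualE => //; case: rs => -[].
have [snd3 _ _] := im3.
have [|im4 rd4] := step (dual_slope_q m 4) (dual_slope D j' k l) _ rd3 snd3 isT.
  by move=> s1 rs; apply: dualE => //; case: rs => -[].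
have [snd4 _ _] := im4.
have [|im5 _] := step (QDiv (QReg 27) (QReg 25)) s5 _ rd4 snd4 isT.
  by move=> s1 [_ []].
apply: improves_weaken (improves_seq (improves_seq (improves_seq (improves_seq im1 im2) im3) im4) im5).
move=> B [[[[h1 h2] h3] h4] h5] s; rewrite !inE.
by case/or4P => [/eqP->|/eqP->|/eqP->|/orP[/eqP->|/eqP->]].
Qed.

Definition fixes (env : seq (nat * nat)) (st : hstate) : Prop :=
  all (fun p => nr st p.1 == p.2) env.

(** [env] records the counters of the enclosing loops, which the body must not modify; the counter
    itself must avoid the indices of the best candidate. *)
Lemma loop_improves b v c env P st :
  v \notin [:: 8; 9; 10; 11]%N ->
  all (fun p => (p.1 != v) && (p.1 \notin nmod c)) env ->
  (forall st i, (i < if b then n else m)%N -> sound st -> fixes ((v, i) :: env) st ->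
     improves st (run c st) (P i)) ->
  sound st -> fixes env st ->
  improves st (run (CFor b v c) st)
    (fun B => forall i, (i < if b then n else m)%N -> P i B).
Proof.
move=> v8 ev body snd fix0; set N := if b then n else m.
pose Q k s := [/\ sound s, fixes env s, qr st 2 <= qr s 2 &
  forall i, (i < k)%N -> forall B, qr s 2 <= B -> P i B].
suff [h1 _ h2 h3] : Q N (run (CFor b v c) st).
  by split=> // B hB i iN; exact: (h3 i iN).
apply: (iterate_ind (P := Q)) => // k s kN [s1 f1 le1 p1].
have s2 : sound (set_nr s v k).
  move: s1 v8; rewrite /sound /= /upd !inE !negb_or => s1 /and4P[v1 v2 v3 v4].
  by rewrite ![_ == v]eq_sym (negPf v1) (negPf v2) (negPf v3) (negPf v4).
have f2 : fixes env (set_nr s v k).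
  apply/allP => p pe; have /andP[pv _] := allP ev _ pe.
  by rewrite /= /upd (negPf pv); exact: (allP f1).
have [s3 le3 p3] : improves (set_nr s v k) (run c (set_nr s v k)) (P k).
  by apply: body => //; rewrite /fixes /= /upd eqxx eqxx.
split=> //.
- apply/allP => p pe; have /andP[_ pc] := allP ev _ pe.
  by rewrite frame_nr//; exact: (allP f2).
- exact: le_trans le3.
- move=> i; rewrite ltnS leq_eqVlt => /orP[/eqP -> //|ik] B hB.
  by apply: (p1 i ik); apply: le_trans hB.
Qed.

Lemma curve_loops_improves st : sound st ->
  improves st (run (curve_loops m) st) (fun B =>
    forall (i i' j j' : 'I_n) (k l : 'I_m) s, s \in curve_points i i' j j' k l ->
    curve_covered i i' j j' (corner_u D k l) (corner_v D k l) s B).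
Proof.
move=> snd; pose P i i' j j' k l B := forall (a a' b b' : 'I_n) (c e : 'I_m) s,
  a = i :> nat -> a' = i' :> nat -> b = j :> nat -> b' = j' :> nat ->
  c = k :> nat -> e = l :> nat -> s \in curve_points a a' b b' c e ->
  curve_covered a a' b b' (corner_u D c e) (corner_v D c e) s B.
suff : improves st (run (curve_loops m) st) (fun B => forall i, (i < n)%N ->
    forall i', (i' < n)%N -> forall j, (j < n)%N -> forall j', (j' < n)%N ->
    forall k, (k < m)%N -> forall l, (l < m)%N -> P i i' j j' k l B).
  apply: improves_weaken => B H i i' j j' k l s.
  by apply: (H i _ i' _ j _ j' _ k _ l) => //; exact: ltn_ord.
apply: (loop_improves (env := [::])) => // {snd}st i iN snd f1.
apply: (loop_improves (env := [:: (1%N, i)])) => // {f1 snd}st i' iN' snd f1.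
apply: (loop_improves (env := [:: (2%N, i'); (1%N, i)])) => // {f1 snd}st j jN snd f1.
apply: (loop_improves (env := [:: (3%N, j); (2%N, i'); (1%N, i)])) => // {f1 snd}st j' jN' snd f1.
apply: (loop_improves (env := [:: (4%N, j'); (3%N, j); (2%N, i'); (1%N, i)])) => // {f1 snd}st k kN snd f1.
apply: (loop_improves (env := [:: (5%N, k); (4%N, j'); (3%N, j); (2%N, i'); (1%N, i)])) => // {f1 snd}st l lN snd f1.
rewrite /fixes /= andbT in f1.
have /and5P[/eqP n6 /eqP n5 /eqP n4 /eqP n3 /andP[/eqP n2 /eqP n1]] := f1.
have := @curve_body_improves st (Ordinal iN) (Ordinal iN') (Ordinal jN) (Ordinal jN')
  (Ordinal kN) (Ordinal lN) _ n5 n6 snd.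
move=> /(_ (And4 n1 n2 n3 n4)); apply: improves_weaken => B H a a' b b' c e s ea ea' eb eb' ec ee.
have -> : a = Ordinal iN by exact: val_inj.
have -> : a' = Ordinal iN' by exact: val_inj.
have -> : b = Ordinal jN by exact: val_inj.
have -> : b' = Ordinal jN' by exact: val_inj.
have -> : c = Ordinal kN by exact: val_inj.
have -> : e = Ordinal lN by exact: val_inj.
exact: H.
Qed.

Definition tight_weight (i j : 'I_n) (k : 'I_m) : rat :=
  rhs D k / load_of D k (delta_mx i 0) (delta_mx j 0).

Definition entry_covered (i j : 'I_n) (k : 'I_m) (B : rat) : Prop :=
  let y := tight_weight i j k *: delta_mx j 0 in
  nonneg y -> (forall h, load_of D h (delta_mx i 0) y <= rhs D h) ->
  value (delta_mx i 0) y <= B.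

Lemma entry_body_improves st (i j : 'I_n) (k : 'I_m) :
  nr st 1 = i -> nr st 3 = j -> nr st 5 = k -> sound st ->
  improves st (run (entry_body m) st) (entry_covered i j k).
Proof.
move=> n1 n3 n5 snd.
pose c1 := CSeq (CNat 2 1) (CNat 4 3).
pose c2 := CSeq (CRat 7 (QCst 1)) (CSeq (CRat 8 (QCst 0)) (CSeq (CRat 10 (QCst 0))
  (CRat 9 (QDiv (q_rhs m 5) (QAdd (QMul (q_alpha 5) (QMul (q_beta m 1) (q_beta m 3)))
                      (QMul (q_gamma m 5) (QMul (q_delta m 1) (q_delta m 3)))))))).
have -> : run (entry_body m) st = run (try m) (run c2 (run c1 st)) by [].
have [m1 m2 m3 m4 m5] : [/\ nr (run c1 st) 1 = i, nr (run c1 st) 2 = i,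
   nr (run c1 st) 3 = j, nr (run c1 st) 4 = j & nr (run c1 st) 5 = k].
  by rewrite /= /upd /=.
apply: (improves_frame (c := c1)) => //; move: (run c1 st) m1 m2 m3 m4 m5.
move=> {n1 n3 n5 snd}st n1 n2 n3 n4 n5 snd.
apply: (improves_frame (c := c2)) => // snd2.
have sa : single_assignment c2 by [].
have := single_assignmentP m n inp st sa.
have := single_assignment_nr m n inp st sa.
move: (run c2 st) snd2 => s snd2 nE [e7 [e8 [e10 e9]]].
rewrite -nE in n1 n2 n3 n4 n5; move: e7 e8 e10 e9.
rewrite !qevalE !(q_betaE n1, q_betaE n3, q_deltaE n1, q_deltaE n3).
rewrite (q_rhsE n5) (q_alphaE n5) (q_gammaE n5) => e7 e8 e10 e9.
have [h1 h2 h3] := try_improves n1 n2 n3 n4 snd2; split=> // B /h3.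
rewrite e7 e8 e10 e9 (_ : _ + _ = load_of D k (delta_mx i 0) (delta_mx j 0)); last first.
  by rewrite /load_of !dot_delta.
rewrite -/(tight_weight i j k) => H y y0 ck.
have xE : pair_vec i i 1%:~R 0%:~R = delta_mx i 0 by rewrite /pair_vec scale1r scale0r addr0.
have yE : pair_vec j j (tight_weight i j k) 0%:~R = y by rewrite /pair_vec scale0r addr0.
rewrite -xE -yE; apply: H; split=> //; last by rewrite xE yE.
by have := y0 j; rewrite !mxE !eqxx mulr1.
Qed.

Lemma entry_loops_improves st : sound st ->
  improves st (run (entry_loops m) st) (fun B => forall i j k, entry_covered i j k B).
Proof.
move=> snd; pose P i j k B := forall (a b : 'I_n) (c : 'I_m),
  a = i :> nat -> b = j :> nat -> c = k :> nat -> entry_covered a b c B.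
suff : improves st (run (entry_loops m) st) (fun B => forall i, (i < n)%N ->
    forall j, (j < n)%N -> forall k, (k < m)%N -> P i j k B).
  apply: improves_weaken => B H i j k.
  by apply: (H i _ j _ k) => //; exact: ltn_ord.
apply: (loop_improves (env := [::])) => // {snd}st i iN snd f1.
apply: (loop_improves (env := [:: (1%N, i)])) => // {f1 snd}st j jN snd f1.
apply: (loop_improves (env := [:: (3%N, j); (1%N, i)])) => // {f1 snd}st k kN snd f1.
rewrite /fixes /= andbT in f1; have /and3P[/eqP n5 /eqP n3 /eqP n1] := f1.
have := @entry_body_improves st (Ordinal iN) (Ordinal jN) (Ordinal kN) n1 n3 n5 snd.
apply: improves_weaken => B H a b c ea eb ec.
have -> : a = Ordinal iN by exact: val_inj.
have -> : b = Ordinal jN by exact: val_inj.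
by have -> : c = Ordinal kN by exact: val_inj.
Qed.

End Candidates.

(** * The result of the algorithm *)

Section Outcome.
Variables (m n : nat) (inp : nat -> rat) (D : data rat m n) (C : 'M[rat]_n) (eps : rat).
Hypothesis inp_alpha : forall k : 'I_m, inp k = alpha D k.
Hypothesis inp_gamma : forall k : 'I_m, inp (m + k)%N = gamma D k.
Hypothesis inp_rhs : forall k : 'I_m, inp (2 * m + k)%N = rhs D k.
Hypothesis inp_beta : forall i : 'I_n, inp (3 * m + i)%N = beta D i 0.
Hypothesis inp_delta : forall i : 'I_n, inp (3 * m + n + i)%N = delta D i 0.
Hypothesis inp_obj : forall i j : 'I_n,
  inp (3 * m + 2 * n + (i * n + j))%N = C i j.
Hypothesis inp_eps : inp (3 * m + 2 * n + n * n)%N = eps.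
Hypothesis n_gt0 : (0 < n)%N.

Local Notation run := (denot m n inp).

Definition output_value (st : hstate) (a b : nat) : rat :=
  ((a == nr st 8)%:R * qr st 3 + (a == nr st 9)%:R * qr st 4) *
  ((b == nr st 10)%:R * qr st 5 + (b == nr st 11)%:R * qr st 6).

Lemma output_loopsE st (a b : nat) : (a < n)%N -> (b < n)%N ->
  out (run output_loops st) (a * n + b) = Some (output_value st a b).
Proof.
(* The value is made a function of the cell, so a second write to the same cell is harmless and
   injectivity of the numbering need not be discussed. *)
pose V p := output_value st (p %/ n) (p %% n).
have VE a' b' : (b' < n)%N -> V (a' * n + b')%N = output_value st a' b'.
  by move=> bn; rewrite /V divnMDl// divn_small// addn0 modnMDl modn_small.
pose same s := [/\ nr s 8 = nr st 8, nr s 9 = nr st 9, nr s 10 = nr st 10 &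
  nr s 11 = nr st 11] /\ [/\ qr s 3 = qr st 3, qr s 4 = qr st 4, qr s 5 = qr st 5 &
  qr s 6 = qr st 6].
pose Q a' s := same s /\ forall a b, (a < a')%N -> (b < n)%N ->
  out s (a * n + b)%N = Some (V (a * n + b)%N).
move=> an bn; suff [_ /(_ a b an bn) ->] : Q n (run output_loops st) by rewrite VE.
apply: (iterate_ind (P := Q)) => [|a' s a'n [sm old]].
  by split=> // ? ?; rewrite ltn0.
pose Q' b' s := [/\ same s, nr s 12 = a', forall a b, (a < a')%N -> (b < n)%N ->
  out s (a * n + b)%N = Some (V (a * n + b)%N) &
  forall b, (b < b')%N -> out s (a' * n + b)%N = Some (V (a' * n + b)%N)].
suff [sm' _ old' new] : Q' n (run (CFor true 13 output_body) (set_nr s 12 a')).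
  split=> // a1 b1; rewrite ltnS leq_eqVlt => /orP[/eqP ->|]; [exact: new|exact: old'].
apply: (iterate_ind (P := Q')) => [|b' s' b'n [sm' n12 old' new]].
  by split=> //= ? ; rewrite ltn0.
have wE : output_value s' a' b' = V (a' * n + b')%N.
  have [[h8 h9 h10 h11] [h3 h4 h5 h6]] := sm'.
  by rewrite VE// /output_value h8 h9 h10 h11 h3 h4 h5 h6.
have outE p : out (run output_body (set_nr s' 13 b')) p =
    if p == (a' * n + b')%N then Some (V p) else out s' p.
  rewrite /= /upd /= n12; case: eqP => [->|//]; rewrite -wE /output_value.
  by rewrite ![_%:R * _]mulrC.
split=> //.
- by move=> a1 b1 h1 h2; rewrite outE; case: ifP => // _; exact: old'.
- move=> b1; rewrite ltnS leq_eqVlt outE => /orP[/eqP ->|h]; first by rewrite eqxx.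
  by case: ifP => // _; exact: new.
Qed.

Definition best_possible (B : rat) : Prop :=
  [/\ 0 <= B, forall i j k, entry_covered D C i j k B &
  forall (i i' j j' : 'I_n) (k l : 'I_m) s, s \in curve_points D C eps i i' j j' k l ->
    curve_covered D C i i' j j' (corner_u D k l) (corner_v D k l) s B].

Lemma algorithm_empty : (exists k, rhs D k < 0) -> qr (run (algorithm m) hstate0) 0 = 0.
Proof.
move=> [k bk]; pose F h := (-1) * inp (2 * m + h)%N.
set c := check_all 0 (QMul (QCst (-1)) (q_rhs m 7)).
have q0 : qr (run c hstate0) 0 = 0.
  rewrite (@check_allE m n inp _ _ hstate0 F)//.
  rewrite (_ : all _ _ = false)//; apply/negP => /allP/(_ k).
  by rewrite mem_iota /= ltn_ord /F inp_rhs mulN1r oppr_le0 leNgt bk => /(_ isT).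
by rewrite /algorithm denot_seq denot_if !qevalE q0 ltxx.
Qed.

Lemma algorithm_nonempty : (forall k, 0 <= rhs D k) ->
  let st := run (algorithm m) hstate0 in
  qr st 0 = 1 /\ exists x y : 'cV[rat]_n,
    [/\ nonneg x, nonneg y, forall h, load_of D h x y <= rhs D h,
        forall a b : 'I_n, out st (a * n + b)%N = Some ((x *m y^T) a b) &
        best_possible (value C x y)].
Proof.
move=> b0; pose F h := (-1) * inp (2 * m + h)%N.
set c := check_all 0 (QMul (QCst (-1)) (q_rhs m 7)).
have q0 : qr (run c hstate0) 0 = 1.
  rewrite (@check_allE m n inp _ _ hstate0 F)//.
  rewrite (_ : all _ _ = true)//; apply/allP => h; rewrite mem_iota /= add0n => hm.
  by rewrite /F (inp_rhs (Ordinal hm)) mulN1r oppr_le0.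
(* The initial registers, all 0, describe the zero matrix with value 0, feasible because [rhs] is
   nonnegative. *)
have snd0 : sound D C hstate0.
  exists (Ordinal n_gt0), (Ordinal n_gt0), (Ordinal n_gt0), (Ordinal n_gt0).
  split=> //; rewrite /pair_vec !scale0r addr0; split; last first.
    by rewrite /value mulmx0 /dot big1// => i _; rewrite mxE mul0r.
  split=> // h; rewrite /pair_vec !scale0r addr0.
  by rewrite /load_of /dot !big1 ?mulr0 ?addr0// => i _; rewrite mxE mulr0.
have [snd1 q02] : sound D C (run c hstate0) /\ qr (run c hstate0) 2 = qr hstate0 2.
  exact: sound_frame.
rewrite /algorithm denot_seq denot_if !qevalE -/c q0 ltr01.
move: (run c hstate0) q0 q02 snd1 => s q0 q02 snd1; rewrite !denot_seq.
set s1 := run (entry_loops m) s; set s2 := run (curve_loops m) s1; set st := run output_loops s2.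
have im1 := entry_loops_improves inp_alpha inp_gamma inp_rhs inp_beta inp_delta inp_obj snd1.
have [snd2 _ _] := im1.
have im2 := curve_loops_improves inp_alpha inp_gamma inp_rhs inp_beta inp_delta
  inp_obj inp_eps snd2.
have [[i [i' [j [j' [[n8 n9 n10 n11] [[h3 h4 h5 h6 h] q2]]]]]] le2 best] := improves_seq im1 im2.
split.
  by rewrite /st frame_qr// /s2 frame_qr// /s1 frame_qr.
exists (pair_vec i i' (qr s2 3) (qr s2 4)), (pair_vec j j' (qr s2 5) (qr s2 6)).
split=> //.
- by move=> a; rewrite !mxE addr_ge0// mulr_ge0// ler0n.
- by move=> a; rewrite !mxE addr_ge0// mulr_ge0// ler0n.
- move=> a b; rewrite /st output_loopsE// /output_value n8 n9 n10 n11.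
  by rewrite !mxE big_ord1 !mxE !andbT ![_%:R * _]mulrC.
- by rewrite -q2; have [e1 e2] := best _ (lexx _); split=> //; rewrite q02 in le2.
Qed.

End Outcome.

(** * Optimality of the candidates *)

Lemma curve_value_sub (F : fieldType) (a b c s e : F) : s != 0 -> e != 0 ->
  a * s + b + c / s - (a * e + b + c / e) = (s - e) * (a - c / (s * e)).
Proof. by move=> s0 e0; field; rewrite s0 e0. Qed.

Section CurveBound.
Variables (R : rcfType) (a b c lo hi s : R).
Hypotheses (lo_gt0 : 0 < lo) (los : lo <= s) (shi : s <= hi).

Local Notation f x := (a * x + b + c / x).

(** By [curve_value_sub], the sign of [a - c / (s * e)] tells whether the end [e] is at least as
    good as [s]. If it is positive for [lo], the sign assumption makes it nonnegative for [hi]. *)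
Lemma curve_monotone B : f lo <= B -> f hi <= B -> 0 <= a \/ 0 <= c -> f s <= B.
Proof.
move=> flo fhi ac; have s0 : 0 < s by apply: lt_le_trans los.
have h0 : 0 < hi by apply: lt_le_trans shi.
have [al|al] := leP a (c / (s * lo)).
  apply: le_trans flo; rewrite -subr_le0 curve_value_sub ?gt_eqF//.
  by rewrite mulr_ge0_le0 ?subr_ge0 ?subr_le0.
apply: le_trans fhi; rewrite -subr_le0 curve_value_sub ?gt_eqF//.
rewrite mulr_le0_ge0 ?subr_le0// subr_ge0.
have [c0|c0] := leP 0 c.
  apply: le_trans (ltW al); rewrite ler_pM// ?invr_ge0 ?mulr_ge0 ?(ltW s0) ?(ltW h0)//.
  rewrite lef_pV2 ?posrE ?mulr_gt0//.
  by rewrite ler_pM2l// (le_trans los).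
case: ac => [a0|]; last by rewrite leNgt c0.
by apply: le_trans a0; rewrite mulr_le0_ge0 ?invr_ge0 ?mulr_ge0 ?(ltW s0) ?(ltW h0)// ltW.
Qed.

Variables (sg K t eps B : R).
Hypotheses (sg_gt0 : 0 < sg) (sg_lo : sg <= lo) (eps_gt0 : 0 < eps).
Hypotheses (a_lt0 : a < 0) (c_lt0 : c < 0) (KE : K = 1 - a / (sg * eps)).
Hypotheses (t_le : t <= Num.sqrt (c / a)) (t_ge : Num.sqrt (c / a) <= t + K^-1).

(** With [r] the critical point: [hi] is best if [t > hi], and [lo] is best if [t < lo] and
    [r <= lo]. In the remaining cases [t] or [lo] is a tested point within [1 / K] of [r]. *)
Lemma curve_critical : f lo <= B -> f hi <= B -> (lo <= t <= hi -> f t <= B) ->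
  f s <= B + eps.
Proof.
move=> flo fhi ft; have s0 : 0 < s by apply: lt_le_trans los.
have h0 : 0 < hi by apply: lt_le_trans shi.
have tle := t_le; have tge := t_ge; set r := Num.sqrt (c / a) in tle tge.
have ca0 : 0 < c / a by rewrite nmulr_rgt0// invr_lt0.
have r0 : 0 < r by rewrite sqrtr_gt0.
have cE : c = a * r ^+ 2 by rewrite sqr_sqrtr ?ltW// mulrC divfK// lt_eqF.
have sub e : 0 < e -> f s - f e = a * ((s - e) * (s * e - r ^+ 2)) / (s * e).
  move=> e0; rewrite curve_value_sub ?gt_eqF// cE; field.
  by rewrite !gt_eqF.
have fB B' : f s <= B' -> B' <= B -> f s <= B + eps.
  by move=> h1 h2; rewrite (le_trans (le_trans h1 h2))// lerDl ltW.
have se_gt0 e : 0 < e -> 0 <= (s * e)^-1 by move=> e0; rewrite invr_ge0 mulr_ge0// ltW.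
have q0 : 0 < sg * eps by rewrite mulr_gt0.
have K1 : 1 <= K by rewrite KE lerDl oppr_ge0 mulr_le0_ge0 ?invr_ge0 ?ltW.
have K0 : 0 < K by apply: lt_le_trans K1.
(* The loss at [e] is [- a * (e - r) ^+ 2 / e], at most [- a / (K * sg)] since [K >= 1], and this is
   at most [eps] because [sg * eps * K = sg * eps - a]. *)
have near e : lo <= e -> f e <= B -> `|e - r| <= K^-1 -> f s <= B + eps.
  move=> le fe er; have e0 : 0 < e by apply: lt_le_trans le.
  have fsr : f s <= f r.
    rewrite -subr_le0 sub// -mulrA mulr_le0_ge0 ?(ltW a_lt0)//.
    rewrite mulr_ge0 ?se_gt0// (_ : _ * _ = r^-1 * (r * (s - r)) ^+ 2).
      by rewrite mulr_ge0 ?sqr_ge0// invr_ge0 ltW.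
    by field; rewrite gt_eqF.
  have fre : f r - f e = - a * (e - r) ^+ 2 / e.
    by rewrite cE; field; rewrite !gt_eqF.
  apply: (le_trans fsr); rewrite -(subrK (f e) (f r)) addrC lerD// fre.
  rewrite ler_pdivrMr//.
  have er2 : (e - r) ^+ 2 <= K^-1.
    rewrite -real_normK ?num_real// (@le_trans _ _ (K^-1 ^+ 2))//.
      by rewrite ler_pXn2r// nnegrE ?invr_ge0 ltW.
    by rewrite expr2 ler_piMr ?invr_ge0 ?(ltW K0)// invf_le1.
  have aN : 0 < - a by rewrite oppr_gt0.
  apply: (@le_trans _ _ (- a * K^-1)); first by rewrite ler_pM2l.
  rewrite ler_pdivrMr//; apply: (@le_trans _ _ (eps * sg * K)); last first.
    by rewrite ler_pM2r// ler_pM2l// (le_trans sg_lo).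
  rewrite KE mulrBr mulr1 (_ : _ - _ = eps * sg + - a).
    by rewrite lerDr mulr_ge0 ?ltW.
  by field; rewrite !gt_eqF.
have [tlo|tlo] := ltP t lo.
  have [rlo|rlo] := leP r lo.
    apply: fB flo; rewrite -subr_le0 sub// -mulrA mulr_le0_ge0 ?(ltW a_lt0)//.
    rewrite mulr_ge0 ?se_gt0// mulr_ge0 ?subr_ge0//.
    by rewrite expr2 ler_pM ?(ltW r0)// (le_trans rlo).
  apply: (near lo) => //; rewrite distrC ger0_norm ?subr_ge0 ?(ltW rlo)//.
  by rewrite lerBlDr addrC (le_trans tge)// lerD2r ltW.
have [thi|thi] := leP t hi.
  apply: (near t) => //; first by apply: ft; rewrite tlo thi.
  by rewrite distrC ger0_norm ?subr_ge0// lerBlDr addrC.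
apply: fB fhi; rewrite -subr_le0 sub// -mulrA mulr_le0_ge0 ?(ltW a_lt0)//.
rewrite mulr_ge0 ?se_gt0// mulr_le0// subr_le0//.
have hr : hi <= r by rewrite (le_trans (ltW thi)).
by rewrite expr2 ler_pM ?(ltW s0) ?(ltW h0)// (le_trans shi).
Qed.

End CurveBound.

(** The integer root of the integer part is the integer part of the root, so the scaled root locates
    the real one within [1 / K]. *)
Lemma floor_sqrtP (R : rcfType) (q K : rat) : 0 < q -> 0 < K ->
  let t := (floor_sqrt (q * (K * K)))%:R / K in
  ratr t <= Num.sqrt (ratr q : R) <= ratr t + (ratr K)^-1.
Proof.
move=> q0 K0 /=; set M := floor_sqrt _; set t : rat := M%:R / K.
have qK : 0 < q * (K * K) by rewrite !mulr_gt0.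
have [l h] : (M%:R ^+ 2 <= q * (K * K) /\ q * (K * K) < (M%:R + 1) ^+ 2).
  pose N := `|Num.floor (q * (K * K))|%N.
  have f0 : 0 <= Num.floor (q * (K * K)) by rewrite floor_ge0 ltW.
  have NE : N%:Z = Num.floor (q * (K * K)) by rewrite gez0_abs.
  have ME : M = Nat.sqrt N by rewrite /M /floor_sqrt; congr Nat.sqrt; rewrite /N; lia.
  have [s1 s2] := PeanoNat.Nat.sqrt_spec N (PeanoNat.Nat.le_0_l N).
  have fl : (N%:R : rat) <= q * (K * K) by rewrite pmulrn NE floor_le.
  have fg : q * (K * K) < (N%:R + 1 : rat).
    by have := floorD1_gt (q * (K * K)); rewrite intrD -NE -pmulrn.
  split.
    apply: le_trans fl; rewrite -natrX ler_nat; rewrite ME -mulnn; lia.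
  apply: (lt_le_trans fg); rewrite !natr1 -natrX ler_nat ME -mulnn; lia.
have R0 x : 0 <= x -> 0 <= ratr x :> R by rewrite ler0q.
have t0 : 0 <= t by rewrite divr_ge0// ltW.
have tK : t + K^-1 = (M%:R + 1) / K by rewrite /t mulrDl mul1r.
have -> : ratr t + (ratr K)^-1 = ratr ((M%:R + 1) / K) :> R.
  by rewrite -tK rmorphD fmorphV.
apply/andP; split.
  rewrite -(ger0_norm (R0 _ t0)) -sqrtr_sqr ler_wsqrtr// -rmorphXn ler_rat.
  by rewrite /t expr_div_n ler_pdivrMr ?exprn_gt0.
have u0 : 0 <= (M%:R + 1) / K by rewrite divr_ge0 ?addr_ge0// ltW.
rewrite -(ger0_norm (R0 _ u0)) -sqrtr_sqr ler_wsqrtr// -rmorphXn ler_rat.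
by rewrite expr_div_n ler_pdivlMr ?exprn_gt0// ltW.
Qed.

(** The formula of [inner] over any ring, so that rational and real values can be compared; over the
    reals the two are convertible. *)
Definition frob (F : pzRingType) (n : nat) (U V : 'M[F]_n) : F :=
  \sum_i \sum_j U i j * V i j.

Lemma frobD (F : comPzRingType) n (U V W : 'M[F]_n) :
  frob U (V + W) = frob U V + frob U W.
Proof.
rewrite /frob -big_split; apply: eq_bigr => i _; rewrite -big_split.
by apply: eq_bigr => j _; rewrite mxE mulrDr.
Qed.

Lemma frobZ (F : comPzRingType) n (U V : 'M[F]_n) c :
  frob U (c *: V) = c * frob U V.
Proof.
rewrite /frob mulr_sumr; apply: eq_bigr => i _; rewrite mulr_sumr.
by apply: eq_bigr => j _; rewrite mxE mulrCA.
Qed.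

Lemma frob_rank1 n (U : 'M[rat]_n) x y : frob U (x *m y^T) = value U x y.
Proof.
rewrite /frob /value /dot; apply: eq_bigr => i _; rewrite mxE mulr_suml.
by apply: eq_bigr => j _; rewrite !mxE big_ord1 !mxE; ring.
Qed.

Lemma mulmx_trZ (F : comPzRingType) n (x y : 'cV[F]_n) c :
  x *m (c *: y)^T = c *: (x *m y^T).
Proof. by rewrite linearZ/= scalemxAr. Qed.

(** * From rational to real data *)

Section MapData.
Variables (F G : fieldType) (f : {rmorphism F -> G}) (m n : nat) (D : data F m n).

Local Notation E := (map_data f D).

Lemma frob_map (U V : 'M[F]_n) : frob (map_mx f U) (map_mx f V) = f (frob U V).
Proof.
rewrite /frob rmorph_sum; apply: eq_bigr => i _; rewrite rmorph_sum.
by apply: eq_bigr => j _; rewrite !mxE rmorphM.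
Qed.

Lemma dot_map (a x : 'cV[F]_n) : dot (map_mx f a) (map_mx f x) = f (dot a x).
Proof. by rewrite /dot rmorph_sum; apply: eq_bigr => i _; rewrite !mxE rmorphM. Qed.

Lemma cross_map i j : cross E i j = f (cross D i j).
Proof. by rewrite /cross !mxE rmorphB !rmorphM. Qed.

Lemma minor_map k l : minor E k l = f (minor D k l).
Proof. by rewrite /minor rmorphB !rmorphM. Qed.

Lemma corner_u_map k l : corner_u E k l = f (corner_u D k l).
Proof. by rewrite /corner_u minor_map fmorph_div; congr (_ / _); rewrite rmorphB !rmorphM. Qed.

Lemma corner_v_map k l : corner_v E k l = f (corner_v D k l).
Proof. by rewrite /corner_v minor_map fmorph_div; congr (_ / _); rewrite rmorphB !rmorphM. Qed.

Lemma pt_map i j p q : pt E i j (f p) (f q) = map_mx f (pt D i j p q).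
Proof.
apply/matrixP => a b; rewrite !mxE cross_map; move: (cross D i j) => c.
by rewrite !(rmorphD, rmorphN, rmorphM, fmorphV, rmorph_nat).
Qed.

Lemma load_of_map k x y : load_of E k (map_mx f x) (map_mx f y) = f (load_of D k x y).
Proof. by rewrite /load_of !dot_map rmorphD !rmorphM. Qed.

Lemma curve_lin_map i i' j j' k l :
  curve_lin E i i' j j' k l = map_mx f (curve_lin D i i' j j' k l).
Proof.
rewrite /curve_lin corner_u_map -(rmorph0 f) -(rmorph1 f) !pt_map.
by rewrite map_mxZ map_mxM map_trmx.
Qed.

Lemma curve_cst_map i i' j j' k l :
  curve_cst E i i' j j' k l = map_mx f (curve_cst D i i' j j' k l).
Proof.
rewrite /curve_cst corner_u_map corner_v_map -(rmorph0 f) -(rmorph1 f) !pt_map.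
move: (pt D i i' 1 0) (pt D i i' 0 1) (pt D j j' 1 0) (pt D j j' 0 1) => x x' y y'.
by rewrite map_mxD !map_mxZ !map_mxM !map_trmx.
Qed.

Lemma curve_inv_map i i' j j' k l :
  curve_inv E i i' j j' k l = map_mx f (curve_inv D i i' j j' k l).
Proof.
rewrite /curve_inv corner_v_map -(rmorph0 f) -(rmorph1 f) !pt_map.
by rewrite map_mxZ map_mxM map_trmx.
Qed.

End MapData.

(** * Optimality over the reals *)

Section Optimality.
Variables (R : realType) (m n : nat) (D : data rat m n) (C : 'M[rat]_n) (eps : rat).

Local Notation q := (ratr : rat -> R).
Local Notation DR := (map_data q D).
Local Notation CR := (map_mx q C).

Hypothesis n_gt0 : (0 < n)%N.
Hypothesis DR_admissible : admissible DR.
Hypothesis eps_gt0 : 0 < eps.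

Lemma beta_rat_gt0 i : 0 < beta D i 0.
Proof. by have [_ /(_ i) + _ _] := DR_admissible; rewrite mxE ltr0q. Qed.

Lemma delta_rat_gt0 i : 0 < delta D i 0.
Proof. by have [_ _ /(_ i) + _] := DR_admissible; rewrite mxE ltr0q. Qed.

Lemma slope_map i : slope DR i = q (slope D i).
Proof. by rewrite /slope !mxE fmorph_div. Qed.

Lemma dual_slope_map j k l : dual_slope DR j k l = q (dual_slope D j k l).
Proof.
rewrite /dual_slope corner_u_map corner_v_map slope_map.
move: (corner_u D k l) (corner_v D k l) (slope D j) => u v s.
by rewrite fmorph_div rmorphM.
Qed.

Lemma curve_lo_map i j k l : curve_lo DR i j k l = q (curve_lo D i j k l).
Proof. by rewrite /curve_lo slope_map dual_slope_map /Order.max ltr_rat; case: ifP. Qed.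

Lemma curve_hi_map i j k l : curve_hi DR i j k l = q (curve_hi D i j k l).
Proof. by rewrite /curve_hi slope_map dual_slope_map /Order.min ltr_rat; case: ifP. Qed.

Lemma valid_map i i' j j' k l : valid DR i i' j j' k l -> valid D i i' j j' k l.
Proof.
rewrite /valid !cross_map minor_map corner_u_map corner_v_map !ltr0q fmorph_eq0.
case=> ii' jj' kl uv h; split=> // x.
by have := h x; rewrite /= -!rmorphM -rmorphD ler_rat.
Qed.

Section Curve.
Variables (i i' j j' : 'I_n) (k l : 'I_m) (B : rat).
Hypothesis V : valid D i i' j j' k l.

Local Notation A := (crit_lin D C i i' j j' k l).
Local Notation Q := (frob C (curve_cst D i i' j j' k l)).
Local Notation S := (crit_inv D C i i' j j' k l).

Lemma frob_curve_lin : frob C (curve_lin D i i' j j' k l) = A.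
Proof.
rewrite /crit_lin -frob_rank1 /curve_lin; congr frob.
by rewrite -[X in _ = _ *m X^T](_ : corner_u D k l *: pt D j j' 1 0 = _) ?linearZ/=
  -?scalemxAr// -pt_scale mulr1 mulr0.
Qed.

Lemma frob_curve_inv : frob C (curve_inv D i i' j j' k l) = S.
Proof.
rewrite /crit_inv -frob_rank1 /curve_inv; congr frob.
by rewrite -[X in _ = _ *m X^T](_ : corner_v D k l *: pt D j j' 0 1 = _) ?linearZ/=
  -?scalemxAr// -pt_scale mulr1 mulr0.
Qed.

Lemma value_curve (s : rat) : s != 0 ->
  value C (pt D i i' 1 s) (pt D j j' (corner_u D k l) (corner_v D k l / s)) =
  A * s + Q + S / s.
Proof.
move=> s0; rewrite -frob_rank1 -/(curve D i i' j j' k l s) curveE//.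
rewrite -frob_curve_lin -frob_curve_inv.
move: (curve_lin _ _ _ _ _ _ _) (curve_cst _ _ _ _ _ _ _) (curve_inv _ _ _ _ _ _ _) => X Y W.
by rewrite !frobD !frobZ; ring.
Qed.

Lemma inner_curve (s : R) : s != 0 ->
  inner CR (curve DR i i' j j' k l s) = q A * s + q Q + q S / s.
Proof.
move=> s0; rewrite -[inner _ _]/(frob CR _) curveE//.
rewrite curve_lin_map curve_cst_map curve_inv_map -frob_curve_lin -frob_curve_inv.
move: (curve_lin _ _ _ _ _ _ _) (curve_cst _ _ _ _ _ _ _) (curve_inv _ _ _ _ _ _ _) => X Y W.
by rewrite !frobD !frobZ !frob_map; ring.
Qed.

Lemma covered_le s : curve_lo D i j' k l <= s <= curve_hi D i' j k l ->
  curve_covered D C i i' j j' (corner_u D k l) (corner_v D k l) s B ->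
  A * s + Q + S / s <= B.
Proof.
move=> sP cov; have s0 : 0 < s.
  by case/andP: sP => + _; apply: lt_le_trans; apply: curve_lo_gt0;
     [exact: beta_rat_gt0|exact: delta_rat_gt0].
have [x0 y0] := proj2 (valid_range beta_rat_gt0 delta_rat_gt0 V s0) sP.
rewrite -value_curve ?gt_eqF//; case: (V) => ii' jj' _ _ P.
apply: cov => // [||h]; [by rewrite (cross_neq ii')|by rewrite (cross_neq jj')|].
rewrite /load_of !dot_beta_pt ?dot_delta_pt ?gt_eqF// mul1r.
by rewrite [s * _]mulrC divfK ?gt_eqF.
Qed.

Hypothesis cov : forall s, s \in curve_points D C eps i i' j j' k l ->
  curve_covered D C i i' j j' (corner_u D k l) (corner_v D k l) s B.

Lemma curve_optimal (s : R) : curve_lo DR i j' k l <= s <= curve_hi DR i' j k l ->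
  inner CR (curve DR i i' j j' k l s) <= q B + q eps.
Proof.
rewrite curve_lo_map curve_hi_map => /andP[los shi].
set lo := curve_lo D i j' k l in los; set hi := curve_hi D i' j k l in shi.
have lo0 : 0 < lo by apply: curve_lo_gt0; [exact: beta_rat_gt0|exact: delta_rat_gt0].
have qlo0 : 0 < q lo by rewrite ltr0q.
have lohi : lo <= hi by rewrite -(ler_rat R) (le_trans los).
have s0 : 0 < s by apply: lt_le_trans los.
have pts x : x \in curve_points D C eps i i' j j' k l -> lo <= x <= hi ->
    q A * q x + q Q + q S / q x <= q B.
  move=> /cov cx xP; have := covered_le xP cx.
  by rewrite -(ler_rat R) !rmorphD /= rmorphM fmorph_div.
have flo : q A * q lo + q Q + q S / q lo <= q B.
  apply: pts; last by rewrite lexx.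
  (* Whichever way the comparison goes, [lo] is one of the tested points. *)
  rewrite /lo /curve_lo /Order.max; case: ifP => _; rewrite !inE eqxx ?orbT//.
have fhi : q A * q hi + q Q + q S / q hi <= q B.
  apply: pts; last by rewrite lohi lexx.
  rewrite /hi /curve_hi /Order.min; case: ifP => _; rewrite !inE eqxx ?orbT//.
rewrite inner_curve ?gt_eqF//.
have [ac|] := pselect (0 <= q A \/ 0 <= q S).
  apply: (@le_trans _ _ (q B)); first exact: (curve_monotone qlo0 los shi flo fhi ac).
  by rewrite lerDl ler0q ltW.
move=> /not_orP[/negP + /negP]; rewrite -!ltNge => qA0 qS0.
have A0 : A < 0 by rewrite -(ltrq0 R).
have S0 : S < 0 by rewrite -(ltrq0 R).
set K := crit_scale D C eps i i' j j' k l.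
have sl0 : 0 < slope D i by apply: slope_gt0; [exact: beta_rat_gt0|exact: delta_rat_gt0].
have K0 : 0 < K.
  rewrite /K /crit_scale subr_gt0 (@le_lt_trans _ _ 0)// mulr_le0_ge0 ?(ltW A0)//.
  by rewrite invr_ge0 mulr_ge0 ?ltW.
have SA : 0 < S / A by rewrite nmulr_rgt0// invr_lt0.
have /andP[t1 t2] := floor_sqrtP R SA K0.
apply: (@curve_critical R (q A) (q Q) (q S) (q lo) (q hi) s qlo0 los shi
  (q (slope D i)) (q K) (q (crit_approx D C eps i i' j j' k l))) => //.
- by rewrite ltr0q.
- by rewrite ler_rat /lo /curve_lo le_max lexx.
- by rewrite ltr0q.
- by rewrite /K /crit_scale rmorphB rmorph1 fmorph_div rmorphM.
- by rewrite -fmorph_div.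
- by rewrite -fmorph_div -/K.
- move=> /andP[h1 h2]; apply: pts; first by rewrite !inE eqxx !orbT.
  by apply/andP; split; rewrite -(ler_rat R).
Qed.

End Curve.

Hypothesis rhs_ge0 : forall k, 0 <= rhs D k.

(** The tolerance is spent on the arcs alone: 0 and the single entries are bounded by [B] itself. *)
Lemma best_optimal B : best_possible D C eps B ->
  forall W, calU DR W -> inner CR W <= q B + q eps.
Proof.
move=> [B0 Bentry Bcurve]; have [ag bR dR _] := DR_admissible.
have rR k : 0 <= rhs DR k by rewrite ler0q.
have nd := admissible_nondegenerate n_gt0 rR DR_admissible.
apply: (calU_sub _ _ bR dR nd).
- by move=> k; have [] := ag k.
- by move=> k; have [] := ag k.
- move=> X Y t /andP[t0 t1] hX hY; rewrite -[inner _ _]/(frob CR _) frobD !frobZ.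
  rewrite (_ : q B + q eps = t * (q B + q eps) + (1 - t) * (q B + q eps)).
    by rewrite lerD// ler_wpM2l// subr_ge0.
  by ring.
- rewrite (_ : inner CR 0 = 0) ?addr_ge0 ?ler0q ?(ltW eps_gt0)//.
  by rewrite /inner big1// => i _; rewrite big1// => j _; rewrite !mxE mulr0.
- move=> i j k A0.
  have AE : Amx DR k i j = q (load_of D k (delta_mx i 0) (delta_mx j 0)).
    rewrite /load_of !dot_delta !mxE !big_ord1 !mxE.
    by rewrite rmorphD !rmorphM.
  have E : (rhs DR k / Amx DR k i j) *: delta_mx i j =
      map_mx q ((delta_mx i 0 : 'cV_n) *m (tight_weight D i j k *: (delta_mx j 0 : 'cV_n))^T).
    rewrite mulmx_trZ trmx_delta mul_delta_mx map_mxZ map_delta_mx AE.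
    by rewrite /tight_weight fmorph_div.
  rewrite E => -[W0 Wk _]; rewrite -[inner _ _]/(frob CR _) frob_map frob_rank1.
  rewrite -rmorphD ler_rat; apply: (@le_trans _ _ B); last by rewrite lerDl ltW.
  apply: Bentry => [h|h].
    have := W0 i h; rewrite !mxE big_ord1 !mxE !eqxx mul1r ler0q.
    by [].
  have := Wk h; rewrite map_mxM -map_trmx inner_Amx load_of_map.
  by rewrite ler_rat.
- move=> i i' j j' k l s /valid_map V sP.
  by apply: curve_optimal => // x; exact: Bcurve.
Qed.

End Optimality.

(** * Decoding of the input *)

Lemma nth_allpairs_ord (T : Type) (x0 : T) (n : nat) (f : 'I_n -> 'I_n -> T) (i j : 'I_n) :
  nth x0 [seq f i j | i <- enum 'I_n, j <- enum 'I_n] (i * n + j) = f i j.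
Proof.
have h (s : seq 'I_n) k : (k < size s)%N ->
    nth x0 [seq f i j | i <- s, j <- enum 'I_n] (k * n + j) = f (nth i s k) j.
  elim: s k => [//|a s IH] [|k] ks; rewrite /= nth_cat size_map size_enum_ord.
    by rewrite mul0n add0n ltn_ord (nth_map j) ?size_enum_ord// nth_ord_enum.
  by rewrite mulSn -addnA ltnNge leq_addr /= addKn IH.
by rewrite h ?size_enum_ord// nth_ord_enum.
Qed.

Section Encoding.
Variables (m : nat) (x : instance m).
Local Notation n := (size_n x).

Definition instance_rats : seq rat :=
  let D := dat x in
  codom (alpha D) ++ codom (gamma D) ++ codom (rhs D) ++
  [seq beta D i 0 | i <- enum 'I_n] ++ [seq delta D i 0 | i <- enum 'I_n] ++
  [seq obj x i j | i <- enum 'I_n, j <- enum 'I_n] ++ [:: eps x].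

Lemma size_codom_ord (T : Type) k (f : 'I_k -> T) : size (codom f) = k.
Proof. by rewrite size_codom card_ord. Qed.

Lemma nth_codom_ord (T : Type) (x0 : T) k (f : 'I_k -> T) (i : 'I_k) :
  nth x0 (codom f) i = f i.
Proof. by rewrite codomE (nth_map i) ?size_enum_ord// nth_ord_enum. Qed.

Lemma size_map_ord (T : Type) k (f : 'I_k -> T) : size [seq f i | i <- enum 'I_k] = k.
Proof. by rewrite size_map size_enum_ord. Qed.

Lemma nth_map_ord (T : Type) (x0 : T) k (f : 'I_k -> T) (i : 'I_k) :
  nth x0 [seq f i | i <- enum 'I_k] i = f i.
Proof. by rewrite (nth_map i) ?size_enum_ord// nth_ord_enum. Qed.

Lemma nth_skip (T : Type) (x0 : T) (s t : seq T) k : nth x0 (s ++ t) (size s + k) = nth x0 t k.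
Proof. by rewrite nth_cat ltnNge leq_addr /= addKn. Qed.

Lemma nth_keep (T : Type) (x0 : T) (s t : seq T) k : (k < size s)%N ->
  nth x0 (s ++ t) k = nth x0 s k.
Proof. by move=> ks; rewrite nth_cat ks. Qed.

Local Notation inp := (nth 0 instance_rats).

Lemma inst_alpha (k : 'I_m) : inp k = alpha (dat x) k.
Proof. by rewrite /instance_rats nth_keep ?size_codom_ord// nth_codom_ord. Qed.

Lemma inst_gamma (k : 'I_m) : inp (m + k)%N = gamma (dat x) k.
Proof.
rewrite /instance_rats -[X in (X + _)%N](size_codom_ord (alpha (dat x))) nth_skip.
by rewrite nth_keep ?size_codom_ord// nth_codom_ord.
Qed.

Lemma inst_skip2 k : inp (2 * m + k)%N = nth 0 (codom (rhs (dat x)) ++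
  [seq beta (dat x) i 0 | i <- enum 'I_n] ++ [seq delta (dat x) i 0 | i <- enum 'I_n] ++
  [seq obj x i j | i <- enum 'I_n, j <- enum 'I_n] ++ [:: eps x]) k.
Proof.
rewrite mul2n -addnn -addnA /instance_rats.
rewrite -[X in (X + _)%N](size_codom_ord (alpha (dat x))) nth_skip.
by rewrite -[X in (X + _)%N](size_codom_ord (gamma (dat x))) nth_skip.
Qed.

Lemma inst_rhs (k : 'I_m) : inp (2 * m + k)%N = rhs (dat x) k.
Proof. by rewrite inst_skip2 nth_keep ?size_codom_ord// nth_codom_ord. Qed.

Lemma inst_skip3 k : inp (3 * m + k)%N = nth 0 (
  [seq beta (dat x) i 0 | i <- enum 'I_n] ++ [seq delta (dat x) i 0 | i <- enum 'I_n] ++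
  [seq obj x i j | i <- enum 'I_n, j <- enum 'I_n] ++ [:: eps x]) k.
Proof.
rewrite (_ : 3 * m + k = 2 * m + (m + k))%N; last by rewrite mulSn; lia.
rewrite inst_skip2.
by rewrite -[X in (X + _)%N](size_codom_ord (rhs (dat x))) nth_skip.
Qed.

Lemma inst_beta (i : 'I_n) : inp (3 * m + i)%N = beta (dat x) i 0.
Proof. by rewrite inst_skip3 nth_keep ?size_map_ord// nth_map_ord. Qed.

Lemma inst_delta (i : 'I_n) : inp (3 * m + n + i)%N = delta (dat x) i 0.
Proof.
rewrite -addnA inst_skip3 -[X in (X + _)%N](size_map_ord (fun i => beta (dat x) i 0)).
by rewrite nth_skip nth_keep ?size_map_ord// nth_map_ord.
Qed.

Lemma inst_skip5 k : inp (3 * m + 2 * n + k)%N =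
  nth 0 ([seq obj x i j | i <- enum 'I_n, j <- enum 'I_n] ++ [:: eps x]) k.
Proof.
rewrite -addnA inst_skip3 mul2n -addnn -addnA.
rewrite -[X in (X + _)%N](size_map_ord (fun i => beta (dat x) i 0)) nth_skip.
by rewrite -[X in (X + _)%N](size_map_ord (fun i => delta (dat x) i 0)) nth_skip.
Qed.

Lemma size_obj : size [seq obj x i j | i <- enum 'I_n, j <- enum 'I_n] = (n * n)%N.
Proof. by rewrite size_allpairs size_enum_ord. Qed.

Lemma inst_obj (i j : 'I_n) : inp (3 * m + 2 * n + (i * n + j))%N = obj x i j.
Proof.
rewrite inst_skip5 nth_keep ?nth_allpairs_ord// size_obj.
by have := ltn_ord i; have := ltn_ord j; nia.
Qed.

Lemma inst_eps : inp (3 * m + 2 * n + n * n)%N = eps x.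
Proof. by rewrite inst_skip5 -[X in nth _ _ X]addn0 -size_obj nth_skip. Qed.

Lemma size_instance_rats : (n <= size instance_rats)%N.
Proof.
rewrite /instance_rats !size_cat !size_map_ord.
by rewrite !addnA -!addnA addnC -!addnA; lia.
Qed.

End Encoding.

(** * Degree check and final assembly *)

Definition degrees (m : nat) : seq nat :=
  let d := infer_degrees (algorithm m) (infer_degrees (algorithm m) (fun=> 0%N)) in
  [seq d r | r <- iota 0 28].

Definition max_degree : nat := 100 * 100.

(** The computation succeeds with [m] a variable because degrees do not look into index
    expressions. *)
Lemma algorithm_degrees m : all (fun k => k <= max_degree)%N (degrees m) &&
  degree_ok (nth 0%N (degrees m)) max_degree (algorithm m).
Proof. by vm_compute. Qed.

Lemma all_nth_le (s : seq nat) k : all (fun i => i <= k)%N s ->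
  forall r, (nth 0%N s r <= k)%N.
Proof.
move=> /allP sk r; have [rs|rs] := ltnP r (size s); last by rewrite nth_default.
by apply: sk; exact: mem_nth.
Qed.

Lemma algorithm_bounded_degrees m : exists (d : nat -> nat) dmax,
  [/\ forall r, (d r <= dmax)%N, (0 < dmax)%N & degree_ok d dmax (algorithm m)].
Proof.
have /andP[dle dok] := algorithm_degrees m.
exists (nth 0%N (degrees m)), max_degree.
exact: (And3 (all_nth_le dle) isT dok).
Qed.

Lemma optimization_polytime (R : realType) (m : nat) :
  polytime_solvable (@enc_instance m) (@promise R m) (@optimizes R m).
Proof.
have [d [dmax [d_le dmax_gt0 dok]]] := algorithm_bounded_degrees m.
apply: (polytime_denot (m := m) (flag := 0%N) d_le dmax_gt0 dok (size_of := @size_n m)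
  (rats := @instance_rats m)).
  exact: size_instance_rats.
move=> x o [n3 aD e0] st o0 oE; rewrite {}/st in o0 oE.
have n0 : (0 < size_n x)%N by apply: leq_trans n3.
have [b0|/existsNP[k /negP]] := pselect (forall k, 0 <= rhs (dat x) k); last first.
  rewrite -ltNge => bk; left; split.
    by rewrite o0 (algorithm_empty (@inst_rhs m x)) ?floor0//; exists k.
  by apply: (calU_empty (k := k)) => //; rewrite /= ltrq0.
right; have [f1 [y [z [y0 z0 yz oW best]]]] := algorithm_nonempty (@inst_alpha m x)
  (@inst_gamma m x) (@inst_rhs m x) (@inst_beta m x) (@inst_delta m x) (@inst_obj m x) (@inst_eps m x) n0 b0.
split; first by rewrite o0 f1 floor1.
exists (y *m z^T); split.
- by move=> i j; exact: oE (oW i j).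
- apply/calU_pair; exists (map_mx ratr y), (map_mx ratr z).
  rewrite map_mxM map_trmx; split=> //; split=> [i|i|k].
  + by rewrite mxE ler0q.
  + by rewrite mxE ler0q.
  + by rewrite load_of_map ler_rat.
- move=> W UW; rewrite -[inner _ (map_mx _ _)]/(frob _ _) frob_map frob_rank1.
  exact: (best_optimal n0 aD e0 b0 best).
Qed.

Theorem theorem3 (R : realType) (m : nat) (m_ge1 : (1 <= m)%N) :
  (forall (n1 : nat) (D : data R m n1), (3 <= n1)%N -> admissible D ->
     SOCr (@vec R n1 @` conv_hull (calU D))) /\
  polytime_solvable (@enc_instance m) (@promise R m) (@optimizes R m).
Proof.
split; last exact: optimization_polytime.
move=> n1 D n3 aD; apply: SOCr_conv_calU aD.
exact: leq_trans n3.
Qed.
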